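(* Let $X$ be a countable set, $w:X\to\mathbb C$ a function, and $\varphi:X\to X$ a map with a single orbit and with finite branching index. Let $C_{\varphi,w}$ be a bounded left-invertible weighted composition operator in $\ell^2(X)$. Let $E$ be the subspace, $r^+=r^+_{w,\varphi}$ the outer radius and $r^-=r^-_{w,\varphi}$ the inner radius of convergence of $C_{\varphi,w}$ defined in the context, and suppose that $[E]_{C_{\varphi,w}^*,C_{\varphi,w}'}=\ell^2(X)$. If $r^+>r^-$, then there exist a $z$-invariant reproducing kernel Hilbert space $\mathscr H$ of $E$-valued holomorphic functions on the annulus $\mathbb A(r^-,r^+)=\{z\in\mathbb C:r^-<|z|<r^+\}$ and a unitary map $U:\ell^2(X)\to\mathscr H$ such that $\mathscr M_zU=UC_{\varphi,w}$, where $\mathscr M_z$ is the operator of multiplication by $z$ on $\mathscr H$. Moreover, the following hold. (i) The reproducing kernel $\kappa_{\mathscr H}:\mathbb A(r^-,r^+)\times\mathbb A(r^-,r^+)\to\boldsymbol B(E)$ of $\mathscr H$ satisfies $\kappa_{\mathscr H}(\cdot,\mu)g\in\mathscr H$ and $\langle Uf,\kappa_{\mathscr H}(\cdot,\mu)g\rangle=\langle (Uf)(\mu),g\rangle$ for all $f\in\ell^2(X)$, $g\in E$, $\mu\in\mathbb A(r^-,r^+)$. (ii) The kernel has the form $$\kappa_{\mathscr H}(z,\lambda)=\sum_{i,j\ge1}A_{i,j}\frac1{z^i}\frac1{\bar\lambda^j}+\sum_{i\ge1,j\ge0}B_{i,j}\frac1{z^i}\bar\lambda^j+\sum_{i\ge0,j\ge1}C_{i,j}z^i\frac1{\bar\lambda^j}+\sum_{i,j\ge0}D_{i,j}z^i\bar\lambda^j$$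 with $A_{i,j},B_{i,j},C_{i,j},D_{i,j}\in\boldsymbol B(E)$; if additionally $\varphi$ has no cycle, then $A_{i,j}=0$ if $|i-j|>k_\varphi(E)$, $B_{i,j}=0$ if $i+j>k_\varphi(E)$, $C_{i,j}=0$ if $i+j>k_\varphi(E)$, and $D_{i,j}=0$ if $|i-j|>k_\varphi(E)$. (iii) If $\varphi$ has no cycle, then the linear subspace generated by $E$-valued polynomials in $z$ and $\tilde E$-valued polynomials involving only negative powers of $z$ is dense in $\mathscr H$: $$\bigvee\Big(\{z^nE:n\in\mathbb N\}\cup\{z^{-n}\tilde E:n\in\mathbb Z_+\}\Big)=\mathscr H,\qquad \tilde E:=\bigvee\{e_x:x\in\mathrm{Gen}_\varphi(1,1)\}.$$ If $\varphi$ has a cycle $\mathscr C_\varphi$ with $\tau:=\operatorname{card}\mathscr C_\varphi$, then, with $\Lambda:=\prod_{x\in\mathscr C_\varphi}w(x)$, there exist vectors $A^{(j)}_i\in E$ ($i,j=1,\dots,\tau$) such that the $\tau$ functions on $\mathbb A(r^-,r^+)$ given by the Laurent series $$f_j(z):=\sum_{k=0}^\infty\sum_{i=1}^\tau\Lambda^kA^{(j)}_i\frac1{z^{k\tau+i}},\qquad j=1,\dots,\tau,$$ satisfy $$\bigvee\Big(\{z^nE:n\in\mathbb N\}\cup\{f_j:j\in\{1,\dots,\tau\}\}\Big)=\mathscr H .$$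
   Context: $\mathbb N=\{0,1,\dots\}$, $\mathbb Z_+=\{1,2,\dots\}$. ''Countable'' means finite or countably infinite. $\bigvee W$ is the closed linear span of $W$; $\mathcal N(A)$ is the kernel of $A$. $\{e_x\}_{x\in X}$ is the standard orthonormal basis of $\ell^2(X)$, and for $Y\subset X$, $\ell^2(Y)=\bigvee\{e_y:y\in Y\}$. Weighted composition operator: $C_{\varphi,w}f=w\cdot(f\circ\varphi)$ in $\ell^2(X)$. For a left-invertible $T$ the Cauchy dual is $T'=T(T^*T)^{-1}$. For $T=C_{\varphi,w}$ the Cauchy dual is the weighted composition operator $C_{\varphi,w'}$ with $w'(x)=w(x)\big/\sum_{y\in\varphi^{-1}(\varphi(x))}|w(y)|^2$. For a subspace $E$, $[E]_{T^*,T'}=\bigvee\big(\{T^{*n}x:x\in E,n\in\mathbb N\}\cup\{T'^nx:x\in E,n\in\mathbb N\}\big)$. Orbits, cycles, levels: $\varphi^{(n)}$ is the $n$-th iterate of $\varphi$. For $n\ge0$ and $Y\subset X$, $\varphi^{(-n)}(Y)$ is the preimage of $Y$ under $\varphi^{(n)}$; for $n<0$, $\varphi^{(-n)}(Y)$ is the image of $Y$ under $\varphi^{(|n|)}$. The orbit of $x$ is $\{y:\varphi^{(i)}(x)=\varphi^{(j)}(y)\text{ for some }i,j\in\mathbb N\}$. If $\varphi^{(i)}(x)=x$ for some $i\ge1$, the cycle containing $x$ is $\mathscr C_\varphi=\{\varphi^{(i)}(x):i\in\mathbb N\}$; a map with a single orbit has at most one cycle. The level function $[\varphi]:X\to\mathbb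 Z$ satisfies: $[\varphi](x)=0$ if $x$ is in the cycle; if there is no cycle, $[\varphi](x^* )=0$ for a fixed element $x^*$; and $[\varphi](\varphi(x))=[\varphi](x)-1$ if $x$ is not in a cycle. $\varphi$ has finite branching index if $\sup\{|[\varphi](x)|:x\in X,\ \operatorname{card}(\varphi^{-1}(x))\ge2\}<\infty$ (this does not depend on the choice of $x^*$). If $\varphi$ has no cycle, the graph on $X$ with edges $(\varphi(y),y)$ is a rootless directed tree (the parent of $y$ is $\varphi(y)$); its generalized root $\omega$ is a vertex such that $\operatorname{card}\varphi^{-1}(\varphi^{(n)}(\omega))=1$ for all $n\ge1$, and with $\operatorname{card}\varphi^{-1}(\omega)\ge2$ (in which case it is unique) whenever some vertex has at least two preimages. In the no-cycle case one takes $x^*:=\varphi(\omega)$, so $[\varphi](\omega)=1$. For $m,n\in\mathbb Z$, $\mathrm{Gen}_\varphi(m,n)=\{x\in X:m\le[\varphi](x)\le n\}$, and $\mathrm{Des}(x)=\bigcup_{n=0}^\infty\varphi^{(-n)}(\{x\})$. The subspace $E$: if $\varphi$ has no cycle, $E=\langle e_\omega\rangle\oplus\mathcal N(C_{\varphi,w}^* )$. If $\varphi$ has a cycle, $E$ is the closed linear span of the vectors $e_x$ and the subspaces $\mathcal N\big((C_{\varphi,w}|_{\ell^2(\mathrm{Des}(x))})^*\big)$ for $x\in\mathrm{Gen}_\varphi(1,1)$; here $\ell^2(\mathrm{Des}(x))$ is invariant for $C_{\varphi,w}$ and the adjoint is taken in $\ell^2(\mathrm{Des}(x))$. Index and sets: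 $k_\varphi(E)=\min\{n\in\mathbb N:E\subset\bigvee\{e_x:x\in\mathrm{Gen}_\varphi(1,n)\}\}$; $W_0^{E,\varphi}=\mathrm{Gen}_\varphi(1,k_\varphi(E))$ and $W_n^{E,\varphi}=\varphi^{(-n)}(W_0^{E,\varphi})$, for $n\in\mathbb N$ if $\varphi$ has a cycle and for $n\in\mathbb Z$ otherwise. Radii of convergence: $$r^+_{w,\varphi}=\liminf_{n\to\infty}\Big(\sum_{x\in W^{E,\varphi}_n}|w'(x)w'(\varphi(x))\cdots w'(\varphi^{(n-1)}(x))|^2\Big)^{-\frac1{2n}},$$ $$r^-_{w,\varphi}=\Big(\prod_{x\in\mathscr C_\varphi}|w(x)|\Big)^{1/\tau}\ (\tau=\operatorname{card}\mathscr C_\varphi)\text{ if }\varphi\text{ has a cycle},$$ $$r^-_{w,\varphi}=\limsup_{n\to\infty}\sqrt[n]{|w(\varphi^{(1)}(\omega))w(\varphi^{(2)}(\omega))\cdots w(\varphi^{(n)}(\omega))|}\text{ otherwise}.$$ A Hilbert space $\mathscr H$ of $E$-valued functions on $\Omega$ is a reproducing kernel Hilbert space with kernel $\kappa_{\mathscr H}:\Omega\times\Omega\to\boldsymbol B(E)$ if $\kappa_{\mathscr H}(\cdot,\lambda)e\in\mathscr H$ and $\langle f(\lambda),e\rangle_E=\langle f,\kappa_{\mathscr H}(\cdot,\lambda)e\rangle_{\mathscr H}$ for all $e\in E$, $f\in\mathscr H$, $\lambda\in\Omega$; $z$-invariant means $z\mathscr H\subset\mathscr H$. *)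

(* Defs.v *)
From HB Require Import structures.
From mathcomp Require Import all_boot all_order all_algebra.
From mathcomp Require Import all_classical all_reals all_analysis.
From mathcomp Require Import finmap complex sesquilinear.
From mathcomp.analysis.showcase Require Import summability.
From mathcomp Require Import ring lra.

Set Implicit Arguments.
Unset Strict Implicit.
Unset Printing Implicit Defensive.

Import Order.TTheory GRing.Theory Num.Theory.
Import numFieldNormedType.Exports Normc.

Local Open Scope classical_set_scope.
Local Open Scope ring_scope.
Local Open Scope complex_scope.
Local Notation Re := complex.Re.
Local Notation Im := complex.Im.

HB.instance Definition _ (R : realType) := NormedModule.copy R[i] R[i]^o.

#[global] Existing Instance totally_filter.

Lemma partial_sumE (I : choiceType) (V : zmodType) (F : I -> V) (J : {fset I}) :
  partial_sum F J = \sum_(x <- J) F x.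
Proof. by rewrite /partial_sum big_seq_fsetE. Qed.

Section ComplexModulus.
Variable R : realType.
Implicit Types z : R[i].

Lemma normC_normc z : `|z| = (normc z)%:C.
Proof. by rewrite normc_def; case: z. Qed.

Lemma normc_ge0 z : 0 <= normc z.
Proof. by rewrite -lecR -normC_normc normr_ge0. Qed.

Lemma normc_sqr z : normc z ^+ 2 = Re z ^+ 2 + Im z ^+ 2.
Proof. by case: z => a b /=; rewrite sqr_sqrtr// addr_ge0 ?sqr_ge0. Qed.

Lemma normc_sqrD z1 z2 (a b : R) : 0 < a -> 0 < b ->
  normc (z1 + z2) ^+ 2 <=
  (1 + b / a) * normc z1 ^+ 2 + (1 + a / b) * normc z2 ^+ 2.
Proof.
move=> a0 b0; rewrite !normc_sqr; case: z1 z2 => [x y] [u v] /=.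
have real_case (s t : R) :
    (s + t) ^+ 2 <= (1 + b / a) * s ^+ 2 + (1 + a / b) * t ^+ 2.
  rewrite -subr_ge0.
  have -> : (1 + b / a) * s ^+ 2 + (1 + a / b) * t ^+ 2 - (s + t) ^+ 2 =
            (b * s - a * t) ^+ 2 / (a * b).
    by field; rewrite !gt_eqF.
  by rewrite divr_ge0 ?sqr_ge0// mulr_ge0 ?ltW.
by rewrite !mulrDr addrACA lerD.
Qed.

End ComplexModulus.

Section NonnegFamilies.
Variables (R : realType) (X : choiceType).
Implicit Types a : X -> R.

Lemma fsum_le_esum a (J : {fset X}) : (forall x, 0 <= a x) ->
  ((\sum_(x <- J) a x)%:E <= \esum_(x in [set: X]) (a x)%:E)%E.
Proof.
move=> a0; apply: esum_ge; exists [set` J]; first by split.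
rewrite fsbig_finite//= set_fsetK sumEFin//.
Qed.

Lemma esum_le a (M : \bar R) :
  (forall J : {fset X}, ((\sum_(x <- J) a x)%:E <= M)%E) ->
  (\esum_(x in [set: X]) (a x)%:E <= M)%E.
Proof.
move=> aM; apply: ge_ereal_sup => _ [A [finA _] <-].
by rewrite fsbig_finite//= sumEFin.
Qed.

Lemma cvg_nnsum a : (forall x, 0 <= a x) ->
  (\esum_(x in [set: X]) (a x)%:E < +oo)%E ->
  partial_sum (fun x => (a x)%:C) @ totally -->
    ((fine (\esum_(x in [set: X]) (a x)%:E))%:C : R[i]).
Proof.
move=> a0 afin.
have Sfin : (\esum_(x in [set: X]) (a x)%:E)%E \is a fin_num.
  by rewrite ge0_fin_numE// esum_ge0// => x _; rewrite lee_fin.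
apply/cvgrPdist_le => e e0.
have eR : (Re e)%:C = e by rewrite RRe_real// gtr0_real.
have e'0 : 0 < Re e by rewrite -ltcR eR.
have [J0 J0P] : exists J0 : {fset X},
    fine (\esum_(x in [set: X]) (a x)%:E) - Re e <= \sum_(x <- J0) a x.
  apply: contrapT => /forallNP H.
  have : (\esum_(x in [set: X]) (a x)%:E <=
     (fine (\esum_(x in [set: X]) (a x)%:E) - Re e)%:E)%E.
    apply: esum_le => J; rewrite lee_fin; apply: ltW.
    by have /negP := H J; rewrite -ltNge.
  by rewrite -{1}(fineK Sfin) lee_fin lerDl oppr_ge0 leNgt e'0.
exists J0 => // J /= /fsubsetP J0J.
rewrite partial_sumE.
rewrite -rmorph_sum -rmorphB/= -eR normC_normc lecR /=.
rewrite expr0n/= addr0 sqrtr_sqr ler_norml.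
have SJ : \sum_(x <- J) a x <= fine (\esum_(x in [set: X]) (a x)%:E).
  by rewrite -lee_fin fineK// fsum_le_esum.
have JJ0 : \sum_(x <- J0) a x <= \sum_(x <- J) a x.
  rewrite (big_fsetID _ (mem J0) J)/=.
  have -> : [fset x in J | x \in J0]%fset = J0.
    apply/fsetP => x; rewrite !inE/=; apply/andP/idP => [[]//|xJ0].
    by split => //; exact: J0J.
  by rewrite lerDl sumr_ge0.
by apply/andP; split; lra.
Qed.

End NonnegFamilies.

(* The inner product is the library's [{dot _ for conj}]: linear in the first
   argument, conjugate-linear in the second. *)
HB.mixin Record CompleteNormedModule_isHilbert (R : realType) V
    & CompleteNormedModule R[i] V := {
  hdot : {dot V for @Num.conj R[i]} ;
  hdot_norm : forall u : V, hdot u u = `|u| ^+ 2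
}.

#[short(type="hilbertType")]
HB.structure Definition Hilbert (R : realType) :=
  {V of CompleteNormedModule_isHilbert R V & CompleteNormedModule R[i] V}.

Section SquareSummable.
Variables (R : realType) (X : choiceType).
Implicit Types f g : X -> R[i].

Definition sqsum f : \bar R := \esum_(x in [set: X]) (normc (f x) ^+ 2)%:E.

Definition l2_pred : pred (X -> R[i]) := fun f => `[< (sqsum f < +oo)%E >].

Record l2 := L2 { l2_fun :> X -> R[i]; l2_funP : l2_pred l2_fun }.

Definition l2_norm f : R := Num.sqrt (fine (sqsum f)).

Lemma sqsum_ge0 f : (0 <= sqsum f)%E.
Proof. by apply: esum_ge0 => x _; rewrite lee_fin sqr_ge0. Qed.

Lemma l2_norm_ge0 f : 0 <= l2_norm f. Proof. exact: sqrtr_ge0. Qed.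

Lemma sqsumE f : l2_pred f -> sqsum f = (l2_norm f ^+ 2)%:E.
Proof.
move=> /asboolP fl2; rewrite sqr_sqrtr ?fine_ge0 ?sqsum_ge0// fineK//.
by rewrite ge0_fin_numE ?sqsum_ge0.
Qed.

Lemma l2_predP f (M : R) : 0 <= M ->
  (forall J : {fset X}, \sum_(x <- J) normc (f x) ^+ 2 <= M ^+ 2) ->
  l2_pred f /\ l2_norm f <= M.
Proof.
move=> M0 fM.
have sM : (sqsum f <= (M ^+ 2)%:E)%E by apply: esum_le => J; rewrite lee_fin.
have fl2 : l2_pred f by apply/asboolP; rewrite (le_lt_trans sM) ?ltry.
split=> //; rewrite -(@ler_pXn2r _ 2)// ?nnegrE ?l2_norm_ge0//.
by rewrite -lee_fin -sqsumE.
Qed.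

Lemma fsum_le_l2_norm f (J : {fset X}) : l2_pred f ->
  \sum_(x <- J) normc (f x) ^+ 2 <= l2_norm f ^+ 2.
Proof.
move=> fl2; rewrite -lee_fin -sqsumE//.
by apply: fsum_le_esum => x; rewrite sqr_ge0.
Qed.

Lemma normc_le_l2_norm f x : l2_pred f -> normc (f x) <= l2_norm f.
Proof.
move=> fl2; rewrite -(@ler_pXn2r _ 2)// ?nnegrE ?l2_norm_ge0 ?normc_ge0//.
by have := fsum_le_l2_norm [fset x]%fset fl2; rewrite big_seq_fset1.
Qed.

Lemma l2_addP f g : l2_pred f -> l2_pred g ->
  l2_pred (f + g) /\ l2_norm (f + g) <= l2_norm f + l2_norm g.
Proof.
move=> fl2 gl2.
suff H (e : R) : 0 < e -> l2_pred (f + g) /\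
    l2_norm (f + g) <= l2_norm f + l2_norm g + (e + e).
  split; first by have [] := H 1 ltr01.
  apply/ler_addgt0Pr => e e0.
  by have [|_] := H (e / 2); [exact: divr_gt0|rewrite -splitr].
move=> e0; set a := l2_norm f + e; set b := l2_norm g + e.
have a0 : 0 < a by rewrite ltr_wpDl ?l2_norm_ge0.
have b0 : 0 < b by rewrite ltr_wpDl ?l2_norm_ge0.
rewrite addrACA -/a -/b.
apply: l2_predP; first by rewrite addr_ge0 ?ltW.
move=> J; apply: (@le_trans _ _
  ((1 + b / a) * \sum_(x <- J) normc (f x) ^+ 2 +
   (1 + a / b) * \sum_(x <- J) normc (g x) ^+ 2)).
  rewrite !mulr_sumr -big_split/=; apply: ler_sum => x _.
  exact: normc_sqrD.
have -> : (a + b) ^+ 2 = (1 + b / a) * a ^+ 2 + (1 + a / b) * b ^+ 2.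
  by field; rewrite !gt_eqF.
apply: lerD; rewrite ler_wpM2l ?addr_ge0 ?divr_ge0 ?(ltW a0) ?(ltW b0)//.
  apply: le_trans (fsum_le_l2_norm J fl2) _.
  by rewrite ler_pXn2r ?nnegrE ?l2_norm_ge0 ?(ltW a0)// lerDl ltW.
apply: le_trans (fsum_le_l2_norm J gl2) _.
by rewrite ler_pXn2r ?nnegrE ?l2_norm_ge0 ?(ltW b0)// lerDl ltW.
Qed.

Lemma l2_scaleP (c : R[i]) f : l2_pred f ->
  l2_pred (c *: f) /\ l2_norm (c *: f) <= normc c * l2_norm f.
Proof.
move=> fl2; apply: l2_predP; first by rewrite mulr_ge0 ?normc_ge0 ?l2_norm_ge0.
move=> J; rewrite exprMn.
apply: (@le_trans _ _ (normc c ^+ 2 * \sum_(x <- J) normc (f x) ^+ 2)).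
  rewrite mulr_sumr; apply: ler_sum => x _.
  by rewrite -exprMn -normcM.
by rewrite ler_wpM2l ?sqr_ge0// fsum_le_l2_norm.
Qed.

Lemma l2_0P : l2_pred 0.
Proof.
apply: (@l2_predP 0 0 (lexx _) _).1 => J.
by rewrite big1 ?expr0n// => x _; rewrite normc0 expr0n.
Qed.

Lemma l2_submod_closed : submod_closed l2_pred.
Proof.
split; first exact: l2_0P.
move=> c f g fl2 gl2; apply: (l2_addP _ gl2).1; exact: (l2_scaleP c fl2).1.
Qed.

HB.instance Definition _ := GRing.isSubmodClosed.Build _ _ l2_pred l2_submod_closed.

HB.instance Definition _ := [isSub for l2_fun].
HB.instance Definition _ := [Choice of l2 by <:].
HB.instance Definition _ := [SubChoice_isSubLmodule of l2 by <:].

Lemma l2_norm_eq0 f : l2_pred f -> l2_norm f = 0 -> f = 0.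
Proof.
move=> fl2 f0; apply/funext => x; apply: eq0_normc; apply/eqP.
by rewrite eq_le normc_ge0 andbT -f0 normc_le_l2_norm.
Qed.

Lemma l2_normZ c f : l2_pred f -> l2_norm (c *: f) = normc c * l2_norm f.
Proof.
move=> fl2; apply/eqP; rewrite eq_le (l2_scaleP c fl2).2/=.
have [->|c0] := eqVneq c 0; first by rewrite normc0 mul0r l2_norm_ge0.
have nc0 : 0 < normc c.
  by rewrite lt_def normc_ge0 andbT; apply: contra c0 => /eqP/eq0_normc ->.
have [cfl2 _] := l2_scaleP c fl2.
have := (l2_scaleP c^-1 cfl2).2.
by rewrite scalerA mulVf// scale1r normcV mulrC ler_pdivlMr// mulrC.
Qed.

End SquareSummable.

Section L2Normed.
Variables (R : realType) (X : choiceType).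
Local Notation l2 := (l2 R X).
Implicit Types f g : l2.

Let nrm f : R[i] := (l2_norm f)%:C.

Let nrm_triangle f g : nrm (f + g) <= nrm f + nrm g.
Proof.
rewrite /nrm -rmorphD lecR; exact: (l2_addP (l2_funP f) (l2_funP g)).2.
Qed.

Let nrmZ (c : R[i]) f : nrm (c *: f) = `|c| * nrm f.
Proof.
rewrite /nrm normC_normc -rmorphM; congr (_%:C).
exact: l2_normZ (l2_funP f).
Qed.

Let nrm_eq0 f : nrm f = 0 -> f = 0.
Proof.
move=> [] /(l2_norm_eq0 (l2_funP f)) f0; exact/val_inj.
Qed.

HB.instance Definition _ :=
  @Lmodule_isNormed.Build R[i] l2 nrm nrm_triangle nrmZ nrm_eq0.

Lemma l2_normE f : `|f| = (l2_norm f)%:C. Proof. by []. Qed.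

End L2Normed.

Section L2Complete.
Variables (R : realType) (X : choiceType).
Local Notation l2 := (l2 R X).
Implicit Types f g : l2.

Lemma l2_complete (F : set_system l2) : ProperFilter F -> cauchy F -> cvg F.
Proof.
move=> FF /cauchyP Fc.
have FcR (e : R) : 0 < e -> exists f0 : l2, F [set f | l2_norm (f0 - f) < e].
  move=> e0; have [|f0 Ff0] := Fc e%:C; first by rewrite ltcR.
  by exists f0; apply: filterS Ff0 => f; rewrite /ball/= -ltcR.
have val_le f g x : normc (f x - g x) <= l2_norm (f - g).
  exact: normc_le_l2_norm (l2_funP (f - g)).
have comp (p : R[i] -> R) x :
    (forall z1 z2, `|p z1 - p z2| <= normc (z1 - z2)) ->
    cvg ((fun f : l2 => p (f x)) @ F).
  move=> pL; apply: R_complete; apply/cauchyP => e e0.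
  have [f0 Ff0] := FcR e e0; exists (p (f0 x)).
  suff : F [set f : l2 | ball (p (f0 x)) e (p (f x))] by [].
  apply: filterS Ff0 => f /= f0f; rewrite /ball/=.
  apply: le_lt_trans f0f; apply: le_trans (pL _ _) _; exact: val_le.
have ReL (z1 z2 : R[i]) : `|Re z1 - Re z2| <= normc (z1 - z2).
  by case: z1 z2 => [a b] [c d] /=; rewrite -sqrtr_sqr ler_wsqrtr// lerDl sqr_ge0.
have ImL (z1 z2 : R[i]) : `|Im z1 - Im z2| <= normc (z1 - z2).
  by case: z1 z2 => [a b] [c d] /=; rewrite -sqrtr_sqr ler_wsqrtr// lerDr sqr_ge0.
pose g x := lim ((fun f : l2 => Re (f x)) @ F) +i*
            lim ((fun f : l2 => Im (f x)) @ F).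
have key (e : R) : 0 < e -> F [set f : l2 | forall J : {fset X},
    \sum_(x <- J) normc (g x - f x) ^+ 2 <= e ^+ 2].
  move=> e0; have [|f0 Ff0] := FcR (e / 2); first exact: divr_gt0.
  apply: filterS (Ff0) => f /= f0f J.
  have fc : (fun h : l2 => \sum_(x <- J) normc (h x - f x) ^+ 2) @ F -->
      \sum_(x <- J) normc (g x - f x) ^+ 2.
    apply: cvg_big => [|x _]; first exact: add_continuous.
    have -> : (fun h : l2 => normc (h x - f x) ^+ 2) =
        (fun h : l2 => (Re (h x) - Re (f x)) ^+ 2 + (Im (h x) - Im (f x)) ^+ 2).
      apply/funext => h; rewrite normc_sqr.
      by case: (h x) (f x) => [a b] [c d].
    have -> : normc (g x - f x) ^+ 2 =
        (lim ((fun f : l2 => Re (f x)) @ F) - Re (f x)) ^+ 2 +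
        (lim ((fun f : l2 => Im (f x)) @ F) - Im (f x)) ^+ 2.
      by rewrite normc_sqr /g; case: (f x) => [c d].
    have cvg2 (u : l2 -> R) (a b : R) : u @ F --> a ->
        (fun h => (u h - b) ^+ 2) @ F --> (a - b) ^+ 2.
      move=> ua; have ub : (fun h => u h - b) @ F --> a - b.
        by apply: cvgB => //; exact: cvg_cst.
      by under eq_fun do rewrite expr2; rewrite expr2; exact: cvgM.
    by apply: cvgD; apply: cvg2; [exact: (comp _ _ ReL)|exact: (comp _ _ ImL)].
  apply: (cvgr_to_le fc); apply: filterS (Ff0) => h /= f0h.
  have hf : l2_norm (h - f) <= e.
    have -> : h - f = (h - f0) + (f0 - f) by rewrite addrA subrK.
    apply: le_trans (l2_addP (l2_funP (h - f0)) (l2_funP (f0 - f))).2 _.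
    rewrite [leRHS]splitr lerD ?(ltW f0f)//.
    by rewrite -lecR -[leLHS]l2_normE distrC l2_normE lecR ltW.
  apply: le_trans (fsum_le_l2_norm J (l2_funP (h - f))) _.
  by rewrite ler_pXn2r ?nnegrE ?l2_norm_ge0// ltW.
have gl2 : l2_pred g.
  have /filter_ex[f /= fP] := key 1 ltr01.
  have gf : l2_pred (g - val f) by exact: (l2_predP ler01 fP).1.
  by have := (l2_addP gf (l2_funP f)).1; rewrite subrK.
apply/cvg_ex; exists (L2 gl2); apply/cvgrPdist_le => e e0.
have eR : (Re e)%:C = e by rewrite RRe_real// gtr0_real.
have e'0 : 0 < Re e by rewrite -ltcR eR.
apply: filterS (key _ e'0) => f /= fP.
rewrite l2_normE -eR lecR; exact: (l2_predP (ltW e'0) fP).2.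
Qed.

HB.instance Definition _ := Uniform_isComplete.Build l2 l2_complete.

End L2Complete.

Section L2Dot.
Variables (R : realType) (X : choiceType).
Local Notation l2 := (l2 R X).
Implicit Types f g h : l2.

Lemma l2_addE f g x : (f + g) x = f x + g x. Proof. by []. Qed.
Lemma l2_oppE f x : (- f) x = - f x. Proof. by []. Qed.
Lemma l2_scaleE (c : R[i]) f x : (c *: f) x = c * f x. Proof. by []. Qed.

(* Unordered sum: limit of the finite partial sums along the filter
   [totally] of finite subsets of [X]. *)
Definition l2_dot f g : R[i] := summability.sum (fun x => f x * (g x)^*).

Lemma l2_sqr_cvg f :
  partial_sum (fun x => (normc (f x) ^+ 2)%:C) @ totally --> `|f| ^+ 2.
Proof.
have /asboolP ffin := l2_funP f.
rewrite l2_normE -rmorphXn/= sqr_sqrtr ?fine_ge0 ?sqsum_ge0//.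
by apply: cvg_nnsum ffin => x; rewrite sqr_ge0.
Qed.

Lemma cvg_partial_sum_eq (u v : X -> R[i]) (a : R[i]) : u =1 v ->
  partial_sum u @ totally --> a -> partial_sum v @ totally --> a.
Proof. by move=> /funext ->. Qed.

Lemma cvg_partial_sumD (u v : X -> R[i]) (a b : R[i]) :
  partial_sum u @ totally --> a -> partial_sum v @ totally --> b ->
  partial_sum (fun x => u x + v x) @ totally --> a + b.
Proof.
move=> ua vb; rewrite (_ : partial_sum _ =
    fun A => partial_sum u A + partial_sum v A).
  exact: (cvgD ua vb).
by apply/funext => A; rewrite /partial_sum big_split.
Qed.

Lemma cvg_partial_sumM (u : X -> R[i]) (c a : R[i]) :
  partial_sum u @ totally --> a ->
  partial_sum (fun x => c * u x) @ totally --> c * a.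
Proof.
move=> ua; rewrite (_ : partial_sum _ = fun A => c * partial_sum u A).
  exact: (cvgM (cvg_cst c) ua).
by apply/funext => A; rewrite /partial_sum mulr_sumr.
Qed.

Lemma cvg_l2_dot_polar f g :
  partial_sum (fun x => f x * (g x)^*) @ totally -->
  4^-1 * (`|f + g| ^+ 2 + (-1 * `|f - g| ^+ 2 +
    ((0 +i* 1) * `|f + (0 +i* 1) *: g| ^+ 2 +
     (0 +i* -1) * `|f - (0 +i* 1) *: g| ^+ 2))).
Proof.
have := cvg_partial_sumM (c := 4^-1) (cvg_partial_sumD (@l2_sqr_cvg (f + g))
  (cvg_partial_sumD (cvg_partial_sumM (c := -1) (@l2_sqr_cvg (f - g)))
  (cvg_partial_sumD
    (cvg_partial_sumM (c := 0 +i* 1) (@l2_sqr_cvg (f + (0 +i* 1) *: g)))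
    (cvg_partial_sumM (c := 0 +i* -1) (@l2_sqr_cvg (f - (0 +i* 1) *: g)))))).
apply: cvg_partial_sum_eq => x.
rewrite -[RHS](mulKf (_ : 4 != 0)) ?pnatr_eq0//; congr (_ * _).
rewrite -[4]/(4%:R) mulr_natl.
rewrite !(l2_addE, l2_oppE, l2_scaleE) !normc_sqr.
case: (f x) (g x) => [a b] [c d].
rewrite !mulrS mulr0n; simpc => /=.
by congr (_ +i* _); ring.
Qed.

Lemma l2_dot_cvg f g : partial_sum (fun x => f x * (g x)^*) @ totally --> l2_dot f g.
Proof. by apply: (cvgP _ (@cvg_l2_dot_polar f g)). Qed.

Lemma l2_dotP f g (c : R[i]) :
  partial_sum (fun x => f x * (g x)^*) @ totally --> c -> l2_dot f g = c.
Proof. by move=> ?; apply: cvg_lim => //; exact: norm_hausdorff. Qed.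

Lemma l2_dot_norm f : l2_dot f f = `|f| ^+ 2.
Proof.
apply: l2_dotP; have := @l2_sqr_cvg f.
apply: cvg_partial_sum_eq => x.
by rewrite -normCK normC_normc rmorphXn.
Qed.

Lemma l2_dot_linl (c : R[i]) f g h : l2_dot (c *: f + g) h = c * l2_dot f h + l2_dot g h.
Proof.
apply: l2_dotP.
have := cvg_partial_sumD (cvg_partial_sumM (c := c) (@l2_dot_cvg f h))
  (@l2_dot_cvg g h).
apply: cvg_partial_sum_eq => x.
by rewrite mulrDl mulrA.
Qed.

Lemma l2_dotC f g : l2_dot f g = (l2_dot g f)^*.
Proof.
apply: l2_dotP; apply/cvgrPdist_le => e e0.
have /cvgrPdist_le/(_ e e0) := @l2_dot_cvg g f.
apply: filterS => A; rewrite -normcJ rmorphB/=; congr (`|_ - _| <= _).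
rewrite /partial_sum rmorph_sum/=; apply: eq_bigr => x _.
by rewrite rmorphM/= conjcK mulrC.
Qed.

Lemma l2_dot_linr f : linear_for (@Num.conj R[i] \; *%R) (l2_dot f).
Proof.
move=> c g h; rewrite l2_dotC l2_dot_linl rmorphD rmorphM/=.
by rewrite -!l2_dotC.
Qed.

HB.instance Definition _ := @bilinear_isBilinear.Build R[i] l2 l2 R[i]
  *%R (@Num.conj R[i] \; *%R) l2_dot
  (conj (fun h c f g => l2_dot_linl c f g h) l2_dot_linr).

HB.instance Definition _ := @isHermitianSesquilinear.Build R[i] l2
  false (@Num.conj R[i]) l2_dot
  (fun f g => etrans (l2_dotC f g) (esym (mul1r _))).

Lemma l2_dot_gt0 f : f != 0 -> 0 < l2_dot f f.
Proof. by move=> f0; rewrite l2_dot_norm exprn_gt0// normr_gt0. Qed.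

HB.instance Definition _ :=
  @isDotProduct.Build R[i] l2 l2_dot l2_dot_gt0.

HB.instance Definition _ :=
  @CompleteNormedModule_isHilbert.Build R l2 l2_dot l2_dot_norm.

End L2Dot.

Section Basis.
Variables (R : realType) (X : choiceType).

Lemma l2_basisP (x : X) : l2_pred (fun y => (y == x)%:R : R[i]).
Proof.
apply: (@l2_predP R X _ 1 ler01 _).1 => J; rewrite expr1n.
have [xJ|xJ] := boolP (x \in J).
  rewrite (big_fsetD1 x)//= eqxx normc1 expr1n big_seq big1 ?addr0// => y.
  by rewrite !inE => /andP[/negPf -> _]; rewrite normc0 expr0n.
rewrite big_seq big1 ?ler01// => y yJ; case: eqVneq => [yx|_].
  by rewrite -yx yJ in xJ.
by rewrite normc0 expr0n.
Qed.

Definition l2_basis (x : X) : l2 R X := L2 (l2_basisP x).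

End Basis.

Section Operators.
Variable R : realType.
Implicit Types V W : hilbertType R.

Definition closed_span V (A : set V) : set V :=
  closure [set v | exists n (c : 'I_n -> R[i]) (u : 'I_n -> V),
    (forall i, A (u i)) /\ v = \sum_i c i *: u i].

(* [bounded_op E F T]: the restriction of [T] to [E] belongs to B(E, F); the
   values of [T] off [E] are irrelevant. *)
Definition bounded_op V W (E : set V) (F : set W) (T : V -> W) :=
  [/\ forall x, E x -> F (T x),
      forall (c : R[i]) x y, E x -> E y -> T (c *: x + y) = c *: T x + T y &
      exists M : R, forall x, E x -> `|T x| <= M%:C * `|x|].

Definition left_invertible V (T : V -> V) :=
  exists2 L : V -> V, bounded_op setT setT L & cancel T L.

(* For a closed subspace [M] invariant under the bounded operator [T], this is
   the adjoint of the restriction of [T] to [M], computed in the Hilbert space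
   [M]; the Riesz representation theorem provides the (unique) value. *)
Definition adjoint_on V (M : set V) (T : V -> V) (y : V) : V :=
  xget 0 [set z | M z /\ forall x, M x -> hdot (T x) y = hdot x z].

Definition adjoint V (T : V -> V) : V -> V := adjoint_on setT T.

(* Meant for bijective [A]. *)
Definition op_inv V (A : V -> V) (y : V) : V := xget 0 [set x | A x = y].

Definition cauchy_dual V (T : V -> V) : V -> V :=
  T \o op_inv (adjoint T \o T).

(* [E]_{T*,T'} *)
Definition dual_hull V (T : V -> V) (E : set V) : set V :=
  closed_span
    ([set v | exists n, exists2 x, E x & v = iter n (adjoint T) x] `|`
     [set v | exists n, exists2 x, E x & v = iter n (cauchy_dual T) x]).

Definition unitary_map V W (U : V -> W) :=
  [/\ linear U, forall f g, hdot (U f) (U g) = hdot f g &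
      forall h, exists f, U f = h].

End Operators.

Section Dynamics.
Variables (X : choiceType) (phi : X -> X).

Definition orbit_of (x : X) : set X :=
  [set y | exists i j, iter i phi x = iter j phi y].

Definition single_orbit := exists x, orbit_of x = setT.

Definition periodic (x : X) := exists2 i, (0 < i)%N & iter i phi x = x.

Definition has_cycle := exists x, periodic x.

(* When [phi] has a single orbit, there is at most one cycle, so the union below
   is that cycle, or empty. *)
Definition cycle_set : set X :=
  \bigcup_(x in periodic) range (fun i => iter i phi x).

Definition cycle_card : nat := #|` fset_set cycle_set|%fset.

(* [xs] is the base point, which only matters when there is no cycle. If [phi]
   has a single orbit, there is exactly one such [l]. *)
Definition is_level (xs : X) (l : X -> int) :=
  [/\ forall x, cycle_set x -> l x = 0,
      ~ has_cycle -> l xs = 0 &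
      forall x, ~ cycle_set x -> l (phi x) = l x - 1].

Definition level (xs : X) : X -> int := xget (fun=> 0) (is_level xs).

Definition branching (x : X) :=
  exists y z, [/\ y <> z, phi y = x & phi z = x].

(* The condition does not depend on the base point [xs]. *)
Definition finite_branching_index :=
  exists xs, exists n : nat, forall x, branching x -> `|level xs x| <= n%:Z.

Definition generalized_root (om : X) :=
  (forall n, (0 < n)%N -> exists! y, phi y = iter n phi om) /\
  ((exists x, branching x) -> branching om).

(* Here and below [om] is the generalized root, and levels are normalized by
   [level phi (phi om) om = 1] when there is no cycle; otherwise [om] is irrelevant. *)
Definition Gen (om : X) (m n : int) : set X :=
  [set x | m <= level (phi om) x <= n].

Definition Des (x : X) : set X := \bigcup_n (iter n phi) @^-1` [set x].

End Dynamics.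

Section WeightedComposition.
Variables (R : realType) (X : choiceType).
Variables (phi : X -> X) (om : X) (w : X -> R[i]).
Variable (T : l2 R X -> l2 R X).

(* [T], everywhere defined on l^2(X), is the operator C_{phi,w}. *)
Definition is_wcomp := forall f x, T f x = w x * f (phi x).

(* w' : the weight of the Cauchy dual of C_{phi,w}; the sum in the denominator is
   finite, equal to the squared norm of the image of the basis vector at [phi x]. *)
Definition dual_weight (x : X) : R[i] :=
  w x / (fine (\esum_(y in phi @^-1` [set phi x]) (normc (w y) ^+ 2)%:E))%:C.

(* l^2(Y), as a closed subspace of l^2(X). *)
Definition l2_on (Y : set X) : set (l2 R X) :=
  closed_span [set l2_basis R y | y in Y].

Definition spaceE : set (l2 R X) :=
  if `[< has_cycle phi >] then
    closed_span
      ([set l2_basis R x | x in Gen phi om 1 1] `|`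
       \bigcup_(x in Gen phi om 1 1)
         [set f | l2_on (Des phi x) f /\
                  adjoint_on (l2_on (Des phi x)) T f = 0])
  else [set f | exists c g, adjoint T g = 0 /\ f = c *: l2_basis R om + g].

(* k_phi(E) *)
Definition indexE : nat :=
  xget 0%N [set n : nat | spaceE `<=` l2_on (Gen phi om 1 n%:Z) /\
    forall m : nat, spaceE `<=` l2_on (Gen phi om 1 m%:Z) -> (n <= m)%N].

(* W_n for n >= 0; the sets with negative index do not occur in the radii. *)
Definition Wset (n : nat) : set X := iter n phi @^-1` Gen phi om 1 indexE%:Z.

(* The sum may be infinite (the term is then 0), hence the power and the inverse
   are taken in the extended reals, the root before the inverse because
   +oo `^ r = +oo for every r <> 0, whereas +oo ^-1 = 0. *)
Definition outer_radius : \bar R := limn_einf (fun n =>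
  ((\esum_(x in Wset n)
      (normc (\prod_(i < n) dual_weight (iter i phi x)) ^+ 2)%:E)
   `^ (2 * n%:R)^-1)^-1)%E.

Definition inner_radius : \bar R :=
  if `[< has_cycle phi >] then
    ((\big[*%R/1]_(x \in cycle_set phi) normc (w x))
       `^ (cycle_card phi)%:R^-1)%:E
  else limn_esup (fun n =>
    ((\prod_(1 <= i < n.+1) normc (w (iter i phi om))) `^ n%:R^-1)%:E).

End WeightedComposition.

Definition annulus (R : realType) (rm rp : \bar R) : set R[i] :=
  [set z | (rm < (normc z)%:E < rp)%E].

(* A Hilbert space of [E]-valued functions on [Om]: a Hilbert space whose vectors
   are identified with functions on [Om] through a linear injective evaluation;
   values off [Om] are irrelevant. *)
Record hfspace (R : realType) (V : hilbertType R) (Om : set R[i])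
    (E : set V) := HFSpace {
  hfs_space :> hilbertType R ;
  hfs_eval : hfs_space -> R[i] -> V ;
  hfs_evalE : forall f z, Om z -> E (hfs_eval f z) ;
  hfs_eval_linear : forall (c : R[i]) f g z, Om z ->
    hfs_eval (c *: f + g) z = c *: hfs_eval f z + hfs_eval g z ;
  hfs_eval_inj : forall f g,
    (forall z, Om z -> hfs_eval f z = hfs_eval g z) -> f = g
}.

Section FunctionSpaces.
Variables (R : realType) (V : hilbertType R) (Om : set R[i]) (E : set V).
Variable (H : hfspace Om E).

Definition represents (h : H) (F : R[i] -> V) :=
  forall z, Om z -> hfs_eval h z = F z.

(* Complex differentiability in norm; [Om] is meant to be open. *)
Definition holomorphic_space :=
  forall (h : H) z, Om z -> derivable (hfs_eval h) z 1.

Definition z_invariant :=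
  forall h : H, exists g : H, represents g (fun z => z *: hfs_eval h z).

Definition mult_z (h : H) : H :=
  xget 0 [set g | represents g (fun z => z *: hfs_eval h z)].

Definition reproducing_kernel (K : R[i] -> R[i] -> V -> V) :=
  (forall z l, Om z -> Om l -> bounded_op E E (K z l)) /\
  (forall l e, Om l -> E e -> exists2 k : H,
     represents k (fun z => K z l e) &
     forall f : H, hdot (hfs_eval f l) e = hdot f k).

(* The double series with terms [A p] converges unconditionally to [S] in the
   operator norm of B(E). *)
Definition op_sum (A : nat * nat -> V -> V) (S : V -> V) :=
  forall eps : R, 0 < eps -> \forall J \near @totally (nat * nat)%type,
    forall e, E e -> `|partial_sum (A^~ e) J - S e| <= eps%:C * `|e|.

(* The elements of [H] of the form z^n e with [e] in [S]; [has_monomials] says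
   that all these functions belong to [H]. *)
Definition monomials (n : int) (S : set V) : set H :=
  [set h | exists2 e, S e & represents h (fun z => z ^ n *: e)].

Definition has_monomials (n : int) (S : set V) :=
  forall e, S e -> exists h : H, represents h (fun z => z ^ n *: e).

End FunctionSpaces.

Arguments monomials {R V Om E} H n S.
Arguments has_monomials {R V Om E} H n S.
Arguments holomorphic_space {R V Om E} H.
Arguments z_invariant {R V Om E} H.
Arguments reproducing_kernel {R V Om E} H K.

(* Main.v *)
(** Let L = (T* T)^-1 T* be the left inverse of T, so that L is the adjoint of
the Cauchy dual T', and let P be the projection onto E. The model space is
l^2(X) itself, a vector f being identified with the Laurent series
  (U f)(z) = sum_(n >= 0) z^n P L^n f + sum_(n >= 1) z^-n P T^n f,
so that U (T f) = z (U f). If U f = 0 on the annulus, averaging over roots of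
unity shows that all coefficients vanish; then f is orthogonal to
[E]_{T*,T'}, hence f = 0.

Let B be the set of points of level at most 0, which phi maps into itself.
With or without a cycle, E is the wandering subspace of the restriction of T
to l^2(~` B), and P = Q - T' Q T* for Q the restriction to ~` B. Hence U e = e
for e in E, while U f has only negative powers when f is supported in B.
Moreover P T^(n+1) f = P T (1_0 T^n f), where 1_0 restricts to the finitely many
points of level 0; this bounds the negative coefficients by the inner radius.
The positive ones are bounded by duality, T'^n being controlled on
l^2(Gen(1,k)) by the sums over W_n.

Density comes from e_x = P e_x + c T e_(phi x), with c = 0 when phi x is in B:
by induction on the level, each e_x with x outside B is a combination of
vectors T^n e with e in E. *)

Require Import Defs.
From mathcomp Require Import all_boot all_order all_algebra.
From mathcomp Require Import all_classical all_reals all_analysis.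
From mathcomp Require Import finmap complex sesquilinear.
From mathcomp.analysis.showcase Require Import summability.
From mathcomp Require Import ring lra zify.
From mathcomp Require cyclic separable cyclotomic.

Set Implicit Arguments.
Unset Strict Implicit.
Unset Printing Implicit Defensive.

Import Order.TTheory GRing.Theory Num.Theory.
Import numFieldNormedType.Exports Normc.

Local Open Scope classical_set_scope.
Local Open Scope ring_scope.
Local Open Scope complex_scope.

(** * Geometrically dominated series *)

(** The radii only yield, for [r] below the outer and [s] above the inner one, operator bounds
    [C r^-n] and [C s^n] on the coefficients, with an unspecified [C]. This is the sole analytic
    input: each series is dominated by a geometric one, uniformly on the unit ball, which gives
    evaluation, termwise differentiation and unconditional convergence in operator norm. The
    averages over roots of unity stand for Cauchy's integral formula. As [U] is the identity of the
    underlying space, the kernel is forced: [K(z, l)] is evaluation at [z] composed with the adjoint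
    of evaluation at [l]. Its coefficients are [P S^i R^j P] with [S] either [T] or [L], and [R]
    either [T*] or [T']. Without a cycle, [T] and [T'] raise levels by one, [T*] and [L] lower them,
    and [E] lives on the levels 1 to k, so many coefficients vanish. Vectors supported in B supply
    the negative powers. Without a cycle, [U] sends each basis vector there to one negative
    monomial. With a cycle of length t, [T^t e_x] is [Lambda e_x] plus a term vanishing on the
    cycle, which [P T^n] kills for n > 0; hence the coefficients repeat up to powers of Lambda. *)

Lemma normcX (R : realType) (z : R[i]) n : normc (z ^+ n) = normc z ^+ n.
Proof.
elim: n => [|n IH]; first by rewrite !expr0 normc1.
by rewrite !exprS normcM IH.
Qed.

Section RealNorm.
Variables (R : realType) (V : normedModType R[i]).
Implicit Types (u v : V) (c : R[i]).

(** Norms over [R[i]] are themselves elements of [R[i]]; the real part gives access to real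
    inequalities and [lra]. *)
Definition nrm v : R := complex.Re `|v|.

Lemma nrmE v : `|v| = (nrm v)%:C.
Proof. by rewrite /nrm RRe_real. Qed.

Lemma nrm_ge0 v : 0 <= nrm v.
Proof. by rewrite -lecR -nrmE normr_ge0. Qed.

Lemma nrm0 : nrm (0 : V) = 0.
Proof. by rewrite /nrm normr0. Qed.

Lemma nrm0_eq0 v : nrm v = 0 -> v = 0.
Proof. by move=> v0; apply/normr0_eq0; rewrite nrmE v0. Qed.

Lemma nrmN v : nrm (- v) = nrm v.
Proof. by rewrite /nrm normrN. Qed.

Lemma nrmD u v : nrm (u + v) <= nrm u + nrm v.
Proof. by rewrite -lecR rmorphD/= -!nrmE ler_normD. Qed.

Lemma nrmB u v : nrm (u - v) <= nrm u + nrm v.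
Proof. by rewrite -(nrmN v) nrmD. Qed.

Lemma nrmZ c v : nrm (c *: v) = normc c * nrm v.
Proof. by apply: complexI; rewrite rmorphM/= -!nrmE normrZ normC_normc. Qed.

Lemma nrm_sum (I : Type) (r : seq I) (P : pred I) (F : I -> V) :
  nrm (\sum_(i <- r | P i) F i) <= \sum_(i <- r | P i) nrm (F i).
Proof.
elim/big_rec2 : _ => [|i x y _ xy]; first by rewrite nrm0.
by rewrite (le_trans (nrmD _ _))// lerD2l.
Qed.

Lemma cvg_nrmP (T : Type) (F : set_system T) (FF : Filter F) (f : T -> V) (l : V) :
  f @ F --> l <-> forall e : R, 0 < e -> \forall x \near F, nrm (l - f x) <= e.
Proof.
split=> [/cvgrPdist_le fl e e0|fl].
  have := fl e%:C; rewrite ltcR => /(_ e0); apply: filterS => x.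
  by rewrite nrmE lecR.
apply/cvgrPdist_le => e e0.
have eR : (complex.Re e)%:C = e by rewrite RRe_real// gtr0_real.
have e'0 : 0 < complex.Re e by rewrite -ltcR eR.
by apply: filterS (fl _ e'0) => x; rewrite nrmE -{2}eR lecR.
Qed.

Lemma ball_nrm v (e : R) u : ball v e%:C u <-> nrm (v - u) < e.
Proof. by rewrite -ball_normE/= nrmE ltcR. Qed.

Lemma closure_nrmP (A : set V) v :
  closure A v <-> forall e : R, 0 < e -> exists2 u, A u & nrm (v - u) < e.
Proof.
split=> [Av e e0|Av B /nbhs_ballP[e /= e0 eB]].
  have [|u [Au /ball_nrm]] := Av (ball v e%:C); last by exists u.
  by apply: nbhsx_ballx; rewrite ltcR.
have eR : (complex.Re e)%:C = e by rewrite RRe_real// gtr0_real.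
have e'0 : 0 < complex.Re e by rewrite -ltcR eR.
have [u Au uv] := Av _ e'0; exists u; split => //.
by apply: eB; rewrite -eR; apply/ball_nrm.
Qed.

End RealNorm.

Lemma exprn_small (R : realType) (q e : R) : 0 <= q < 1 -> 0 < e ->
  exists N, forall n, (N <= n)%N -> q ^+ n <= e.
Proof.
move=> /andP[q0 q1] e0; have := @cvg_expr R q.
rewrite ger0_norm// => /(_ q1) /cvgrPdist_le/(_ e e0)[N _ NP].
exists N => n /NP /=; rewrite sub0r normrN ger0_norm//.
exact: exprn_ge0.
Qed.

Lemma geometric_sum_le (R : realType) (q : R) m n : 0 <= q < 1 ->
  \sum_(m <= k < n) q ^+ k <= q ^+ m / (1 - q).
Proof.
move=> /andP[q0 q1]; have q1' : 0 < 1 - q by rewrite subr_gt0.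
have [mn|nm] := leqP m n; last first.
  by rewrite (big_geq (ltnW nm)) divr_ge0 ?exprn_ge0 ?(ltW q1').
rewrite -[leLHS](@mulfK _ (1 - q)) ?gt_eqF// ler_pM2r ?invr_gt0//.
have -> : (\sum_(m <= k < n) q ^+ k) * (1 - q) =
    \sum_(m <= k < n) (- q ^+ k.+1 - - q ^+ k).
  by rewrite mulr_suml; apply: eq_bigr => k _; rewrite exprS; ring.
by rewrite (telescope_sumr (fun k => - q ^+ k))// opprK addrC gerBl exprn_ge0.
Qed.

Definition geo_le (R : realType) (V : normedModType R[i]) (C q : R)
  (u : nat -> V) := forall n, nrm (u n) <= C * q ^+ n.

Section GeometricSeries.
Variables (R : realType) (V : completeNormedModType R[i]).
Implicit Types (u v : nat -> V) (C q : R).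

Definition vsum u : V := limn (series u).

Lemma geo_sum_le C q u m n : 0 <= C -> 0 <= q < 1 -> geo_le C q u ->
  nrm (\sum_(m <= k < n) u k) <= C * q ^+ m / (1 - q).
Proof.
move=> C0 q01 uq; apply: le_trans (nrm_sum _ _ _) _.
apply: le_trans (ler_sum _ (fun k _ => uq k)) _.
by rewrite -mulr_sumr -mulrA ler_wpM2l// geometric_sum_le.
Qed.

Lemma geo_small C q (e : R) : 0 <= C -> 0 <= q < 1 -> 0 < e ->
  exists N, forall n, (N <= n)%N -> C * q ^+ n / (1 - q) <= e.
Proof.
move=> C0 q01 e0; have /andP[q0 q1] := q01.
have q1' : 0 < 1 - q by rewrite subr_gt0.
(* [C] may be 0, hence [C + 1]; the same shift recurs below with other bounds. *)
have C1 : 0 < C + 1 by rewrite ltr_wpDl.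
have [|N NP] := @exprn_small _ q (e * (1 - q) / (C + 1)) q01.
  by rewrite divr_gt0 ?mulr_gt0.
exists N => n /NP qn; rewrite ler_pdivrMr//.
apply: (@le_trans _ _ ((C + 1) * q ^+ n)).
  by rewrite ler_wpM2r ?exprn_ge0// lerDl.
by move: qn; rewrite ler_pdivlMr// mulrC.
Qed.

Lemma geo_cvg C q u : 0 <= C -> 0 <= q < 1 -> geo_le C q u ->
  series u @ \oo --> vsum u.
Proof.
move=> C0 q01 uq; apply: cauchy_cvg; apply/cauchy_seriesP => e e0.
have eR : (complex.Re e)%:C = e by rewrite RRe_real// gtr0_real.
have e'0 : 0 < complex.Re e / 2 by rewrite divr_gt0// -ltcR eR.
have [N NP] := geo_small C0 q01 e'0.
exists ([set n | (N <= n)%N], [set n | (N <= n)%N]).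
  by split; exists N.
move=> [m n] /= [Nm _]; rewrite nrmE -eR ltcR.
apply: le_lt_trans (geo_sum_le m n C0 q01 uq) _.
apply: le_lt_trans (NP _ Nm) _.
by rewrite ltr_pdivrMr// mulr_natr mulr2n ltrDl -ltcR eR.
Qed.

Lemma vsum_eq u (l : V) : series u @ \oo --> l -> vsum u = l.
Proof. by move=> ul; apply: cvg_lim => //; exact: norm_hausdorff. Qed.

(** The partial sum of order [n] is compared with a later one that is [e]-close to the limit; the
    gap between the two is a finite geometric sum. *)
Lemma vsum_tail C q u n : 0 <= C -> 0 <= q < 1 -> geo_le C q u ->
  nrm (vsum u - series u n) <= C * q ^+ n / (1 - q).
Proof.
move=> C0 q01 uq; apply/ler_addgt0Pr => e e0.
have /cvg_nrmP/(_ e e0)[N _ NP] := geo_cvg C0 q01 uq.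
pose p := maxn N n; have := NP p (leq_maxl _ _).
have -> : vsum u - series u n = vsum u - series u p + (\sum_(n <= k < p) u k).
  by rewrite -sub_series_geq ?leq_maxr// addrA subrK.
move=> up; apply: le_trans (nrmD _ _) _; rewrite addrC lerD//.
exact: geo_sum_le.
Qed.

Lemma nrm_vsum C q u : 0 <= C -> 0 <= q < 1 -> geo_le C q u ->
  nrm (vsum u) <= C / (1 - q).
Proof.
move=> C0 q01 uq; have := vsum_tail 0 C0 q01 uq.
by rewrite seriesEord/= big_ord0 subr0 expr0 mulr1.
Qed.

Lemma vsumD C q D r u v : 0 <= C -> 0 <= q < 1 -> geo_le C q u ->
  0 <= D -> 0 <= r < 1 -> geo_le D r v ->
  vsum (fun n => u n + v n) = vsum u + vsum v.
Proof.
move=> C0 q01 uq D0 r01 vr; apply: vsum_eq.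
rewrite (_ : series _ = fun n => series u n + series v n).
  by apply: cvgD; [exact: geo_cvg uq|exact: geo_cvg vr].
by apply/funext => n; rewrite /series/= big_split.
Qed.

Lemma vsum_single m u : (forall n, n != m -> u n = 0) -> vsum u = u m.
Proof.
move=> um; apply: vsum_eq; apply/cvg_nrmP => e e0.
exists m.+1 => // n /= mn; rewrite /series/= (big_cat_nat _ mn)//= big_nat_recr//=.
rewrite big1_seq ?add0r; last first.
  by move=> i /=; rewrite mem_index_iota => im; rewrite um// ltn_eqF.
rewrite big1_seq ?addr0 ?subrr ?nrm0 ?ltW// => i /=.
by rewrite mem_index_iota => /andP[im _]; rewrite um// gtn_eqF.
Qed.

Lemma vsum0 : vsum (fun=> 0) = 0.
Proof. by rewrite (@vsum_single 0%N). Qed.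

End GeometricSeries.

(** * Bounded linear maps *)

Definition linear_bounded (R : realType) (V W : normedModType R[i]) (g : V -> W) :=
  linear g /\ exists2 M : R, 0 <= M & forall x, nrm (g x) <= M * nrm x.

Section LinearBounded.
Variable R : realType.
Implicit Types V W U : normedModType R[i].

Lemma lbD V W (g : V -> W) u v : linear_bounded g -> g (u + v) = g u + g v.
Proof. by move=> [gl _]; rewrite -[u]scale1r gl !scale1r. Qed.

Lemma lb0 V W (g : V -> W) : linear_bounded g -> g 0 = 0.
Proof. by move=> gb; apply/(@addrI _ (g 0)); rewrite -lbD// !addr0. Qed.

Lemma lbZ V W (g : V -> W) c u : linear_bounded g -> g (c *: u) = c *: g u.
Proof. by move=> gb; rewrite -[c *: u]addr0 gb.1 lb0// addr0. Qed.

Lemma lbN V W (g : V -> W) u : linear_bounded g -> g (- u) = - g u.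
Proof. by move=> gb; rewrite -scaleN1r lbZ// scaleN1r. Qed.

Lemma lbB V W (g : V -> W) u v : linear_bounded g -> g (u - v) = g u - g v.
Proof. by move=> gb; rewrite lbD// lbN. Qed.

Lemma lb_sum V W (g : V -> W) (I : Type) (r : seq I) (P : pred I) (F : I -> V) :
  linear_bounded g ->
  g (\sum_(i <- r | P i) F i) = \sum_(i <- r | P i) g (F i).
Proof.
move=> gb; elim/big_rec2 : _ => [|i x y _ <-]; first exact: lb0.
exact: lbD.
Qed.

Lemma lb_id V : linear_bounded (@idfun V).
Proof. by split=> //; exists 1 => // x; rewrite mul1r. Qed.

Lemma lb_comp V W U (g : V -> W) (h : U -> V) :
  linear_bounded g -> linear_bounded h -> linear_bounded (g \o h).
Proof.
move=> [gl [M M0 gM]] [hl [N N0 hN]]; split.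
  by move=> c u v /=; rewrite hl gl.
exists (M * N); first exact: mulr_ge0.
by move=> x /=; rewrite (le_trans (gM _))// -mulrA ler_wpM2l.
Qed.

Lemma lb_iter V (g : V -> V) n : linear_bounded g -> linear_bounded (iter n g).
Proof.
by move=> gb; elim: n => [|n IH]; [exact: lb_id|exact: (lb_comp gb IH)].
Qed.

Lemma lb_add V W (g h : V -> W) : linear_bounded g -> linear_bounded h ->
  linear_bounded (fun x => g x + h x).
Proof.
move=> [gl [M M0 gM]] [hl [N N0 hN]]; split.
  by move=> c u v; rewrite gl hl scalerDr addrACA.
exists (M + N); first exact: addr_ge0.
by move=> x; rewrite (le_trans (nrmD _ _))// mulrDl lerD.
Qed.

Lemma lb_scale V W c (g : V -> W) : linear_bounded g ->
  linear_bounded (fun x => c *: g x).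
Proof.
move=> [gl [M M0 gM]]; split.
  by move=> d u v; rewrite gl scalerDr !scalerA mulrC.
exists (normc c * M); first by rewrite mulr_ge0 ?normc_ge0.
by move=> x; rewrite nrmZ -mulrA ler_wpM2l ?normc_ge0.
Qed.

Lemma lb_sub V W (g h : V -> W) : linear_bounded g -> linear_bounded h ->
  linear_bounded (fun x => g x - h x).
Proof.
move=> gb hb; rewrite (_ : (fun x => _) = fun x => g x + (-1) *: h x).
  by apply: lb_add gb _; exact: lb_scale.
by apply/funext => x; rewrite scaleN1r.
Qed.

Lemma lb_cvg V W (g : V -> W) (T : Type) (F : set_system T) (FF : Filter F)
    (f : T -> V) (l : V) :
  linear_bounded g -> f @ F --> l -> (g \o f) @ F --> g l.
Proof.
move=> gb /cvg_nrmP fl; apply/cvg_nrmP => e e0.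
have [M M0 gM] := gb.2; have M1 : 0 < M + 1 by rewrite ltr_wpDl.
have e1 : 0 < e / (M + 1) by rewrite divr_gt0.
apply: filterS (fl _ e1) => x xl /=; rewrite -lbB// (le_trans (gM _))//.
rewrite (@le_trans _ _ ((M + 1) * nrm (l - f x)))//.
  by rewrite ler_wpM2r ?nrm_ge0// lerDl.
by rewrite mulrC -ler_pdivlMr.
Qed.

Lemma lb_vsum (V W : completeNormedModType R[i]) (g : V -> W) C q u :
  linear_bounded g -> 0 <= C -> 0 <= q < 1 -> geo_le C q u ->
  g (vsum u) = vsum (g \o u).
Proof.
move=> gb C0 q01 uq; apply/esym/vsum_eq.
rewrite (_ : series _ = g \o series u); first exact: lb_cvg (geo_cvg C0 q01 uq).
by apply/funext => n; rewrite /series/= lb_sum.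
Qed.

End LinearBounded.

(** * Unconditional summation of double series *)

Section SquareSums.

Definition square_fset n : {fset nat * nat} :=
  [fset p in allpairs pair (iota 0 n) (iota 0 n)]%fset.

Lemma in_square_fset n p : (p \in square_fset n) = (p.1 < n)%N && (p.2 < n)%N.
Proof.
rewrite !inE/=; apply/allpairsP/andP => [[[i j] /= [+ + ->]]|[p1 p2]].
  by rewrite !mem_iota.
by exists p; rewrite !mem_iota/= p1 p2; split => //; case: p {p1 p2}.
Qed.

Lemma big_square_fset (V : nmodType) (F : nat * nat -> V) n :
  \sum_(p <- square_fset n) F p = \sum_(0 <= i < n) \sum_(0 <= j < n) F (i, j).
Proof.
rewrite (@perm_big _ _ _ _ _ (allpairs pair (iota 0 n) (iota 0 n))).
  by rewrite big_allpairs /index_iota subn0.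
apply: uniq_perm; first exact: fset_uniq.
  by apply: allpairs_uniq; rewrite ?iota_uniq// => -[? ?] [? ?] _ _ [-> ->].
by move=> p; rewrite !inE.
Qed.

(** Squares are cofinal among finite index sets, so a sum over any finite set can be tested against
    an iterated partial sum. *)
Lemma square_fset_sub (J : {fset nat * nat}) n :
  exists2 N, (n <= N)%N & (J `<=` square_fset N)%fset.
Proof.
set m := (\max_(p <- J) (p.1 + p.2).+1)%N; exists (maxn n m).
  exact: leq_maxl.
apply/fsubsetP => p pJ; have pm : ((p.1 + p.2).+1 <= m)%N.
  exact: (@leq_bigmax_seq _ _ xpredT (fun p => (p.1 + p.2).+1)%N p pJ isT).
by rewrite in_square_fset; lia.
Qed.

Lemma fsubset_split (V : nmodType) (I : choiceType) (F : I -> V)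
    (J K : {fset I}) : (J `<=` K)%fset ->
  \sum_(p <- K) F p = \sum_(p <- J) F p + \sum_(p <- (K `\` J)%fset) F p.
Proof.
move=> /fsubsetP JK; rewrite (big_fsetID _ (mem J) K)/=; congr (_ + _).
  apply: eq_fbigl => p; rewrite !inE/=.
  by apply/andP/idP => [[]//|pJ]; split=> //; exact: JK.
by apply: eq_fbigl => p; rewrite !inE/= andbC.
Qed.

End SquareSums.

Section BlockSum.
Variables (R : realType) (V : completeNormedModType R[i]).
Variables (a d : nat -> V -> V) (C q : R).
Hypotheses (C0 : 0 <= C) (q01 : 0 <= q < 1).
Hypothesis a_lin : forall i, linear_bounded (a i).
Hypothesis a_le : forall i x, nrm (a i x) <= C * q ^+ i * nrm x.

(** A larger square [square_fset N] containing [J] is the intermediary: its sum is an iterated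
    partial sum, close to the limit, and its terms beyond [J] lie outside [square_fset n], hence are
    small. Each comparison contributes half of the constant 4. *)
Lemma block_sum_tail (e : V) : (forall j, nrm (d j e) <= C * q ^+ j * nrm e) ->
  forall n (J : {fset nat * nat}), (square_fset n `<=` J)%fset ->
  nrm (\sum_(p <- J) a p.1 (d p.2 e) -
       vsum (fun i => a i (vsum (fun j => d j e)))) <=
  4 * (C / (1 - q)) ^+ 2 * q ^+ n * nrm e.
Proof.
move=> d_le n J nJ; have /andP[q0 q1] := q01.
have q1' : 0 < 1 - q by rewrite subr_gt0.
set g := (1 - q)^-1; have g0 : 0 <= g by rewrite invr_ge0 ltW.
have Ce0 : 0 <= C * nrm e by rewrite mulr_ge0 ?nrm_ge0.
have dgeo : geo_le (C * nrm e) q (fun j => d j e).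
  by move=> j; rewrite mulrAC.
have ageo x : geo_le (C * nrm x) q (fun i => a i x).
  by move=> i; rewrite mulrAC.
have [N nN JN] := square_fset_sub J n.
set v := vsum (fun j => d j e); set s := vsum (fun i => a i v).
pose vN := series (fun j => d j e) N.
have vvN : nrm (v - vN) <= C * nrm e * q ^+ N * g := vsum_tail N Ce0 q01 dgeo.
have vle : nrm v <= C * nrm e * g := nrm_vsum Ce0 q01 dgeo.
have qNn : q ^+ N <= q ^+ n by rewrite ler_wiXn2l// ltW.
have bnd x : nrm (\sum_(0 <= i < N) a i x) <= C * g * nrm x.
  have := geo_sum_le 0 N (mulr_ge0 C0 (nrm_ge0 x)) q01 (ageo x).
  by rewrite expr0 mulr1 mulrAC.
have rectE : \sum_(p <- square_fset N) a p.1 (d p.2 e) =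
    \sum_(0 <= i < N) a i vN.
  rewrite big_square_fset; apply: eq_bigr => i _.
  by rewrite /vN /series/= lb_sum.
(* Two errors of equal size: cutting the outer series at [v], and replacing [v] by its partial sum
   [vN]. *)
have h1 : nrm (\sum_(p <- square_fset N) a p.1 (d p.2 e) - s) <=
    2 * (C * g) ^+ 2 * q ^+ n * nrm e.
  rewrite rectE; have -> : \sum_(0 <= i < N) a i vN - s =
      - (s - series (fun i => a i v) N) - \sum_(0 <= i < N) a i (v - vN).
    rewrite /series/=.
    have -> : \sum_(0 <= i < N) a i (v - vN) =
        \sum_(0 <= i < N) a i v - \sum_(0 <= i < N) a i vN.
      by rewrite -sumrB; apply: eq_bigr => i _; rewrite lbB.
    by rewrite !opprB [RHS]addrC subrKA.
  apply: le_trans (nrmB _ _) _; rewrite nrmN.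
  have := vsum_tail N (mulr_ge0 C0 (nrm_ge0 v)) q01 (ageo v).
  rewrite -/s -/g => sv.
  have h2 : C * nrm v * q ^+ N * g <= C * (C * nrm e * g) * q ^+ n * g.
    by rewrite ler_wpM2r// ler_pM ?mulr_ge0 ?nrm_ge0 ?exprn_ge0// ler_wpM2l.
  have h3 : C * g * nrm (v - vN) <= C * g * (C * nrm e * q ^+ n * g).
    rewrite ler_wpM2l ?mulr_ge0// (le_trans vvN)// ler_wpM2r// ler_wpM2l//.
  have := bnd (v - vN); lra.
have h4 : nrm (\sum_(p <- (square_fset N `\` J)%fset) a p.1 (d p.2 e)) <=
    2 * (C * g) ^+ 2 * q ^+ n * nrm e.
  apply: le_trans (nrm_sum _ _ _) _.
  (* The scalar majorant has product form: its sum over a square is the square of a geometric sum up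
     to a constant, and the excess is a difference of two such squares. *)
  pose c (p : nat * nat) := C ^+ 2 * nrm e * (q ^+ p.1 * q ^+ p.2).
  have c0 p : 0 <= c p by rewrite !mulr_ge0 ?exprn_ge0 ?nrm_ge0.
  have cs k : \sum_(p <- square_fset k) c p =
      C ^+ 2 * nrm e * (\sum_(0 <= i < k) q ^+ i) ^+ 2.
    rewrite big_square_fset (expr2 (\sum_(0 <= i < k) _)) mulr_suml mulr_sumr.
    apply: eq_bigr => i _; rewrite mulr_sumr mulr_sumr.
    by apply: eq_bigr => j _.
  apply: (@le_trans _ _ (\sum_(p <- (square_fset N `\` J)%fset) c p)).
    apply: ler_sum => p _; rewrite (le_trans (a_le _ _))//.
    rewrite (le_trans (ler_wpM2l _ (d_le _))) ?mulr_ge0 ?exprn_ge0//.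
    by rewrite le_eqVlt /c; apply/orP; left; apply/eqP; ring.
  have e1 := fsubset_split c JN; have e2 := fsubset_split c nJ.
  have r0 : 0 <= \sum_(p <- (J `\` square_fset n)%fset) c p by exact: sumr_ge0.
  have e3 : \sum_(p <- (square_fset N `\` J)%fset) c p <=
     C ^+ 2 * nrm e * ((\sum_(0 <= i < N) q ^+ i) ^+ 2 -
                       (\sum_(0 <= i < n) q ^+ i) ^+ 2).
    by rewrite mulrBr -!cs; lra.
  apply: le_trans e3 _.
  set GN := \sum_(0 <= i < N) q ^+ i; set Gn := \sum_(0 <= i < n) q ^+ i.
  have GE : GN = Gn + \sum_(n <= i < N) q ^+ i by rewrite -big_cat_nat.
  have t1 : \sum_(n <= i < N) q ^+ i <= q ^+ n * g := geometric_sum_le n N q01.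
  have GN1 : GN <= g.
    by have := geometric_sum_le 0 N q01; rewrite expr0 div1r.
  have Gn1 : Gn <= g.
    by have := geometric_sum_le 0 n q01; rewrite expr0 div1r.
  have Gn0 : 0 <= Gn by apply: sumr_ge0 => i _; exact: exprn_ge0.
  have t0 : 0 <= \sum_(n <= i < N) q ^+ i.
    by apply: sumr_ge0 => i _; exact: exprn_ge0.
  rewrite subr_sqr; have -> : GN - Gn = \sum_(n <= i < N) q ^+ i.
    by rewrite GE addrAC subrr add0r.
  have : (\sum_(n <= i < N) q ^+ i) * (GN + Gn) <= (q ^+ n * g) * (g + g).
    by rewrite ler_pM ?lerD// addr_ge0// GE addr_ge0.
  move=> /(ler_wpM2l (_ : 0 <= C ^+ 2 * nrm e)).
  rewrite mulr_ge0 ?sqr_ge0 ?nrm_ge0// => /(_ isT) h; apply: le_trans h _.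
  by rewrite le_eqVlt; apply/orP; left; apply/eqP; ring.
have e1 := fsubset_split (fun p => a p.1 (d p.2 e)) JN.
have -> : \sum_(p <- J) a p.1 (d p.2 e) - s =
  (\sum_(p <- square_fset N) a p.1 (d p.2 e) - s) -
  \sum_(p <- (square_fset N `\` J)%fset) a p.1 (d p.2 e).
  by rewrite e1 addrAC addrK.
by apply: le_trans (nrmB _ _) _; lra.
Qed.

End BlockSum.

(** The tail bound is proportional to [nrm e], so one finite set serves all [e] at once. *)
Lemma op_sum_block (R : realType) (V : hilbertType R) (E : set V)
    (a d : nat -> V -> V) (C q : R) : 0 <= C -> 0 <= q < 1 ->
  (forall i, linear_bounded (a i)) ->
  (forall i x, nrm (a i x) <= C * q ^+ i * nrm x) ->
  (forall j e, nrm (d j e) <= C * q ^+ j * nrm e) ->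
  op_sum E (fun p e => a p.1 (d p.2 e))
    (fun e => vsum (fun i => a i (vsum (fun j => d j e)))).
Proof.
move=> C0 q01 al aq dq eps eps0; have /andP[q0 q1] := q01.
have q1' : 0 < 1 - q by rewrite subr_gt0.
have [|N NP] := @exprn_small _ q (eps / (4 * (C / (1 - q)) ^+ 2 + 1)) q01.
  by rewrite divr_gt0// ltr_wpDl// mulr_ge0// sqr_ge0.
exists (square_fset N) => // J /= NJ e _.
rewrite partial_sumE !nrmE -rmorphM lecR.
apply: le_trans (block_sum_tail C0 q01 al aq (fun j => dq j e) NJ) _.
rewrite ler_wpM2r ?nrm_ge0//.
have := NP N (leqnn _); rewrite ler_pdivlMr; last first.
  by rewrite ltr_wpDl// mulr_ge0// sqr_ge0.
apply: le_trans; rewrite mulrC ler_wpM2l ?exprn_ge0// lerDl//.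
Qed.

(** * Uniqueness and holomorphy of vector-valued Laurent series *)

(** ['X^n - 1] splits and is separable, so it has [n] distinct roots, and [n] distinct [n]-th roots
    of unity in a field include a primitive one. *)
Lemma exists_prim_root (F : closedFieldType) n : n%:R != 0 :> F ->
  exists z : F, n.-primitive_root z.
Proof.
move=> n0; have n_gt0 : (0 < n)%N.
  by rewrite lt0n; apply: contraNneq n0 => ->.
have [rs rsE] := closed_field_poly_normal ('X^n - 1 : {poly F}).
move: rsE; rewrite (monicP (monic_Xn_sub_1 _ n_gt0)) scale1r => rsE.
have : has n.-primitive_root rs.
  apply: cyclic.has_prim_root => //.
  - by apply/allP => z zrs; rewrite /root_of_unity rsE root_prod_XsubC.
  - by rewrite -separable.separable_prod_XsubC -rsE cyclotomic.separable_Xn_sub_1.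
  - by have := size_Xn_sub_1 F n_gt0; rewrite rsE size_prod_XsubC => -[->].
by move=> /hasP[z _ zn]; exists z.
Qed.

Lemma normc_unity_root (R : realType) (z : R[i]) n : (0 < n)%N ->
  z ^+ n = 1 -> normc z = 1.
Proof.
move=> n0 zn; have /(congr1 (@normc R)) := zn.
rewrite normcX normc1 => /eqP; rewrite pexpr_eq1 ?normc_ge0//.
by move/eqP.
Qed.

Lemma sum_exprn_unity (F : fieldType) (x : F) n : x ^+ n = 1 ->
  \sum_(j < n) x ^+ j = if x == 1 then n%:R else 0.
Proof.
move=> xn; have [->|x1] := eqVneq x 1.
  by under eq_bigr do rewrite expr1n; rewrite sumr_const card_ord.
have /eqP := subrX1 x n; rewrite xn subrr eq_sym mulf_eq0 subr_eq0.
by rewrite (negPf x1) => /eqP.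
Qed.

Section LaurentUniqueness.
Variables (R : realType) (V : completeNormedModType R[i]).
Implicit Types (u v : nat -> V) (C q : R).

Lemma geo_le_unit C q u (z : R[i]) (k : nat -> nat) : normc z = 1 ->
  geo_le C q u -> geo_le C q (fun n => z ^+ k n *: u n).
Proof. by move=> z1 uq n; rewrite nrmZ normcX z1 expr1n mul1r. Qed.

(* Averaging [z ^ (- m) F(z)] over the [N]-th roots of unity isolates the
   [m]-th coefficient among those of index at most [N - m - 1]. *)
Lemma laurent_coef_eq0 C q u v : 0 <= C -> 0 <= q < 1 ->
  geo_le C q u -> geo_le C q v ->
  (forall z : R[i], normc z = 1 ->
    vsum (fun n => z ^+ n *: u n) + vsum (fun n => z^-1 ^+ n.+1 *: v n) = 0) ->
  forall m, u m = 0.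
Proof.
move=> C0 q01 uq vq F0 m; apply: nrm0_eq0; apply/eqP.
rewrite eq_le nrm_ge0 andbT; apply/ler_addgt0Pr => e e0; rewrite add0r.
have [N0 NP] := geo_small C0 q01 (divr_gt0 e0 (ltr0n _ 2)).
(* [M] makes both tails at most [e / 2]. With [N = M + m + 1], the index [m] is the only one from
   [-M] to [M - 1] congruent to [m] modulo [N], so no other coefficient survives the average. *)
pose M := (maxn N0 m.+1); pose N := (M + m.+1)%N.
have {NP}Me : C * q ^+ M / (1 - q) <= e / 2 by apply: NP; exact: leq_maxl.
have mM : (m < M)%N by exact: leq_maxr.
have N0' : (0 < N)%N by rewrite /N addnS.
have NR : N%:R != 0 :> R[i] by rewrite pnatr_eq0 -lt0n.
have [z zN] := exists_prim_root NR.
have zN1 : z ^+ N = 1 := prim_expr_order zN.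
have nz : normc z = 1 := normc_unity_root N0' zN1.
have z0 : z != 0 by apply: contra_eq_neq nz => ->; rewrite normc0 eq_sym oner_eq0.
have nzX k : normc (z ^+ k) = 1 by rewrite normcX nz expr1n.
pose FM x := \sum_(0 <= n < M) x ^+ n *: u n +
             \sum_(0 <= n < M) x^-1 ^+ n.+1 *: v n.
(* The full series vanishes, so the truncation is minus the sum of the two tails. *)
have FMle x : normc x = 1 -> nrm (FM x) <= e.
  move=> x1; have x1' : normc x^-1 = 1 by rewrite normcV x1 invr1.
  have -> : FM x = - ((vsum (fun n => x ^+ n *: u n) -
      \sum_(0 <= n < M) x ^+ n *: u n) +
    (vsum (fun n => x^-1 ^+ n.+1 *: v n) -
      \sum_(0 <= n < M) x^-1 ^+ n.+1 *: v n)).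
    by rewrite addrACA F0// add0r !opprD !opprK.
  rewrite nrmN (le_trans (nrmD _ _))// [leRHS]splitr lerD//.
    by apply: le_trans Me; apply: (vsum_tail M C0 q01); exact: (geo_le_unit id).
  apply: le_trans Me; apply: (vsum_tail M C0 q01).
  exact: (geo_le_unit succn).
have avg : \sum_(j < N) (z ^+ m)^-1 ^+ j *: FM (z ^+ j) = N%:R *: u m.
  have swap (k : nat -> R[i]) (x : nat -> V) :
      (forall n, k n ^+ N = 1) ->
      \sum_(j < N) (z ^+ m)^-1 ^+ j *: \sum_(0 <= n < M) (k n) ^+ j *: x n =
      \sum_(0 <= n < M) (if k n == z ^+ m then N%:R else 0) *: x n.
    move=> kN; under eq_bigr do rewrite scaler_sumr.
    rewrite exchange_big/=; apply: eq_bigr => n _.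
    under eq_bigr do rewrite scalerA -exprMn mulrC.
    rewrite -scaler_suml sum_exprn_unity.
      by rewrite -(inj_eq (mulIf (expf_neq0 m z0))) mulfVK ?expf_neq0// mul1r.
    by rewrite exprMn kN exprVn -exprM mulnC exprM zN1 expr1n invr1 mulr1.
  rewrite /FM; under eq_bigr do rewrite scalerDr.
  rewrite big_split/=.
  under eq_bigr do under eq_bigr do rewrite -exprM mulnC exprM.
  rewrite (swap (fun n => z ^+ n)); last first.
    by move=> n; rewrite -exprM mulnC exprM zN1 expr1n.
  under [X in _ + X]eq_bigr do
    under eq_bigr do rewrite -exprVn -exprM mulnC exprM.
  rewrite (swap (fun n => z^-1 ^+ n.+1)); last first.
    by move=> n; rewrite -exprM mulnC exprM exprVn zN1 invr1 expr1n.
  rewrite [X in _ + X]big1_seq ?addr0 => [|n /=]; last first.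
    rewrite mem_index_iota => nM; case: eqP => [zz|]; last by rewrite scale0r.
    have : z ^+ (n.+1 + m) = 1.
      by rewrite exprD -zz -exprMn mulfV// expr1n.
    move/eqP; rewrite -(prim_order_dvd zN) => /dvdn_leq.
    by rewrite /N; lia.
  rewrite (bigD1_seq m) ?iota_uniq ?mem_index_iota//= eqxx.
  rewrite big1_seq ?addr0// => n /andP[nm].
  rewrite mem_index_iota => nM.
  rewrite (eq_prim_root_expr zN) !modn_small; first last.
  - by rewrite /N; lia.
  - by rewrite /N; lia.
  by rewrite (negPf nm) scale0r.
have : nrm (N%:R *: u m) <= N%:R * e.
  rewrite -avg (le_trans (nrm_sum _ _ _))//.
  have -> : N%:R * e = \sum_(j < N) e by rewrite sumr_const card_ord mulr_natl.
  apply: ler_sum => j _; rewrite nrmZ normcX normcV nzX invr1 expr1n mul1r.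
  exact: FMle.
rewrite nrmZ (_ : normc N%:R = N%:R) ?ler_pM2l ?ltr0n//.
by apply: complexI; rewrite -normC_normc normr_nat rmorph_nat.
Qed.

End LaurentUniqueness.

Lemma normcN (R : realType) (z : R[i]) : normc (- z) = normc z.
Proof. by apply: complexI; rewrite -!normC_normc normrN. Qed.

Lemma normcD_le (R : realType) (z t : R[i]) : normc (z + t) <= normc z + normc t.
Proof. by rewrite -lecR rmorphD/= -!normC_normc ler_normD. Qed.

Lemma normc_nat (R : realType) n : normc (n%:R : R[i]) = n%:R.
Proof. by apply: complexI; rewrite -normC_normc normr_nat rmorph_nat. Qed.

(** * First-order expansions and holomorphy *)

Section Taylor.
Variables (R : realType).
Implicit Types (z h : R[i]) (d : R).

(** For [n > 0] the left side is a single term of the binomial expansion of the right side. *)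
Lemma deriv_exprn_le (x d : R) n : 0 <= x -> 0 <= d ->
  d * (n%:R * x ^+ n.-1) <= (x + d) ^+ n.
Proof.
move=> x0 d0; elim: n => [|n IH]; first by rewrite mul0r mulr0 expr0.
rewrite exprS mulrDl -natr1/=.
have -> : d * ((n%:R + 1) * x ^+ n) = x * (d * (n%:R * x ^+ n.-1)) + d * x ^+ n.
  by case: n {IH} => [|n] /=; rewrite ?exprS; ring.
rewrite lerD ?ler_wpM2l// lerXn2r ?nnegrE ?addr_ge0// lerDl.
exact: d0.
Qed.

(** The remainders satisfy [R_(n+1) = (z + h) R_n + n h^2 z^(n-1)]. The factor 2 closes the
    induction since [2 (x + d / 2) + d = 2 (x + d)] for [x = normc z]. *)
Lemma exprn_taylor_le z h d n : 0 < d -> normc h <= d / 2 ->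
  normc ((z + h) ^+ n - z ^+ n - h * (n%:R * z ^+ n.-1)) <=
  2 * (normc h / d) ^+ 2 * (normc z + d) ^+ n.
Proof.
move=> d0 hd; elim: n => [|n IH].
  by rewrite subrr mul0r mulr0 subr0 normc0 expr0 mulr1 mulr_ge0// sqr_ge0.
have -> : (z + h) ^+ n.+1 - z ^+ n.+1 - h * (n.+1%:R * z ^+ n.+1.-1) =
    (z + h) * ((z + h) ^+ n - z ^+ n - h * (n%:R * z ^+ n.-1)) +
    h ^+ 2 * (n%:R * z ^+ n.-1).
  by case: n {IH} => [|n] /=; rewrite !exprS -!natr1; ring.
apply: le_trans (normcD_le _ _) _; rewrite !normcM !normcX normc_nat.
set x := normc z in IH *; set t := normc h in hd IH *.
have x0 : 0 <= x := normc_ge0 _; have t0 : 0 <= t := normc_ge0 _.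
have e1 := deriv_exprn_le n x0 (ltW d0).
have e2 : normc (z + h) <= x + d / 2 by rewrite (le_trans (normcD_le _ _))// lerD2l.
set D := normc (_ - _ - _) in IH *.
apply: (@le_trans _ _ ((x + d / 2) * (2 * (t / d) ^+ 2 * (x + d) ^+ n) +
   (t / d) ^+ 2 * (d * (x + d) ^+ n))).
  apply: lerD; first by rewrite ler_pM ?normc_ge0.
  have -> : t ^+ 2 * (n%:R * x ^+ n.-1) =
      (t / d) ^+ 2 * (d * (d * (n%:R * x ^+ n.-1))).
    by field; rewrite gt_eqF.
  by rewrite ler_wpM2l ?sqr_ge0// ler_wpM2l// ltW.
rewrite (exprS (x + d)) le_eqVlt; apply/orP; left; apply/eqP.
by set y := (x + d) ^+ n; field; rewrite gt_eqF.
Qed.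

End Taylor.

Section StrongDerivative.
Variables (R : realType) (V : normedModType R[i]).
Implicit Types (f g : R[i] -> V) (a : R[i]) (l : V).

(* A first-order expansion with quadratic remainder; this is stable under the
   operations below without any further limit argument. *)
Definition taylor1 f a l := exists K d : R, [/\ 0 <= K, 0 < d &
  forall h, normc h <= d -> nrm (f (a + h) - f a - h *: l) <= K * normc h ^+ 2].

Lemma taylor1_derivable f a l : taylor1 f a l -> derivable f a 1.
Proof.
move=> [K [d [K0 d0 fd]]]; apply/cvg_ex; exists l; apply/cvgrPdist_le => e e0.
have eR : (complex.Re e)%:C = e by rewrite RRe_real// gtr0_real.
have e'0 : 0 < complex.Re e by rewrite -ltcR eR.
have K1 : 0 < K + 1 by rewrite ltr_wpDl.
pose m : R := Num.min d (complex.Re e / (K + 1)).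
have m0 : 0 < m by rewrite lt_min d0 divr_gt0.
have mC : 0 < m%:C :> R[i] by rewrite ltcR.
apply/nbhs_ballP; exists m%:C => // h /ball_nrm; rewrite sub0r nrmN => hm h0.
have hE : nrm h = normc h by apply: complexI; rewrite -nrmE normC_normc.
rewrite hE in hm; have nh0 : 0 < normc h.
  by rewrite lt_def normc_ge0 andbT; apply: contra_neq h0 => /eq0_normc.
rewrite nrmE -eR lecR.
have e1 : (h *: 1 : R[i]) + a = a + h by rewrite addrC; congr (_ + _); exact: mulr1.
rewrite /= e1.
have -> : l - h^-1 *: (f (a + h) - f a) = - (h^-1 *: (f (a + h) - f a - h *: l)).
  by rewrite [in RHS]scalerBr scalerA mulVf// scale1r opprB.
rewrite nrmN nrmZ normcV ler_pdivrMl//.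
have hd : normc h <= d by rewrite ltW// (lt_le_trans hm)// ge_min lexx.
apply: le_trans (fd h hd) _; rewrite expr2 mulrCA ler_wpM2l ?normc_ge0//.
have : normc h <= complex.Re e / (K + 1).
  by rewrite ltW// (lt_le_trans hm)// ge_min lexx orbT.
rewrite ler_pdivlMr// mulrC; apply: le_trans.
by rewrite ler_wpM2r ?normc_ge0// lerDl.
Qed.

Lemma taylor1D f g a l m : taylor1 f a l -> taylor1 g a m ->
  taylor1 (fun z => f z + g z) a (l + m).
Proof.
move=> [K [d [K0 d0 fd]]] [L [r [L0 r0 gr]]].
exists (K + L), (Num.min d r); split; [exact: addr_ge0|by rewrite lt_min d0|].
move=> h; rewrite le_min => /andP[hd hr]; rewrite scalerDr.
have -> : f (a + h) + g (a + h) - (f a + g a) - (h *: l + h *: m) =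
    (f (a + h) - f a - h *: l) + (g (a + h) - g a - h *: m).
  by rewrite !opprD (addrACA (f _)) [LHS]addrACA.
by rewrite (le_trans (nrmD _ _))// mulrDl lerD ?fd ?gr.
Qed.

(** Write [1 / (a + h) = 1 / a + k] with [k = - h / (a (a + h))]. The radius keeps [normc (a + h)]
    above half of [normc a] and [normc k] below [d]; besides the remainder of [f], the difference
    between [k] and [- h / a^2] leaves the quadratic term [h^2 / (a^2 (a + h))]. *)
Lemma taylor1_inv f a l : a != 0 -> taylor1 f a^-1 l ->
  taylor1 (fun z => f z^-1) a (- a ^- 2 *: l).
Proof.
move=> a0 [K [d [K0 d0 fd]]]; set x := normc a.
have x0 : 0 < x.
  by rewrite lt_def normc_ge0 andbT; apply: contra_neq a0 => /eq0_normc.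
pose r := Num.min (x / 2) (d * x ^+ 2 / 2).
have r0 : 0 < r by rewrite lt_min !divr_gt0 ?mulr_gt0 ?exprn_gt0.
exists (K * (2 / x ^+ 2) ^+ 2 + 2 / x ^+ 3 * nrm l), r; split => //.
  apply: addr_ge0; apply: mulr_ge0 => //; [exact: sqr_ge0| |exact: nrm_ge0].
  by rewrite divr_ge0// exprn_ge0// ltW.
move=> h; rewrite /r le_min => /andP[hx hd]; set t := normc h in hx hd *.
have t0 : 0 <= t := normc_ge0 _.
have ahx : x / 2 <= normc (a + h).
  have : x <= normc (a + h) + t.
    by rewrite /x -{1}(addrK h a) (le_trans (normcD_le _ _))// normcN.
  by lra.
have ahx0 : 0 < normc (a + h) by rewrite (lt_le_trans _ ahx)// divr_gt0.
have ah0 : a + h != 0.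
  by apply: contraTneq ahx0 => ->; rewrite normc0 ltxx.
pose k := - h / (a * (a + h)).
have kE : (a + h)^-1 = a^-1 + k by rewrite /k; field; rewrite a0 ah0.
have ahV : (normc (a + h))^-1 <= 2 / x.
  by rewrite -[leRHS]invrK invf_div lef_pV2// posrE// divr_gt0.
have kt : normc k <= 2 / x ^+ 2 * t.
  rewrite /k normcM normcN normcV normcM invfM -/t -/x.
  have -> : 2 / x ^+ 2 * t = t * (x^-1 * (2 / x)) by field; rewrite gt_eqF.
  by rewrite ler_wpM2l// ler_wpM2l// invr_ge0 ltW.
have kd : normc k <= d.
  apply: le_trans kt _; rewrite mulrAC ler_pdivrMr ?exprn_gt0//; lra.
have -> : f (a + h)^-1 - f a^-1 - h *: (- a ^- 2 *: l) =
    (f (a^-1 + k) - f a^-1 - k *: l) + (h ^+ 2 / (a ^+ 2 * (a + h))) *: l.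
  rewrite kE -[RHS]addrA scalerA; congr (_ + _).
  rewrite -[LHS]scaleNr -[X in X + _]scaleNr -scalerDl; congr (_ *: _).
  by rewrite /k; field; rewrite a0 ah0.
apply: le_trans (nrmD _ _) _; rewrite mulrDl lerD//.
  apply: le_trans (fd k kd) _; rewrite -mulrA ler_wpM2l// -exprMn.
  by rewrite lerXn2r ?nnegrE ?normc_ge0// mulr_ge0// divr_ge0 ?exprn_ge0 ?ltW.
rewrite nrmZ normcM normcX normcV normcM normcX -/t -/x [leRHS]mulrAC ler_wpM2r ?nrm_ge0//.
rewrite [leRHS]mulrC ler_wpM2l ?sqr_ge0// invfM.
have -> : 2 / x ^+ 3 = (x ^+ 2)^-1 * (2 / x) by field; rewrite gt_eqF.
by rewrite ler_wpM2l// invr_ge0 exprn_ge0 ?ltW.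
Qed.

End StrongDerivative.

Section PowerSeries.
Variables (R : realType) (V : completeNormedModType R[i]).
Implicit Types (u v : nat -> V) (C q r s : R) (z : R[i]).

Lemma vsumZ C q u c : 0 <= C -> 0 <= q < 1 -> geo_le C q u ->
  vsum (fun n => c *: u n) = c *: vsum u.
Proof.
move=> C0 q01 uq; have := lb_vsum (lb_scale c (lb_id V)) C0 q01 uq.
by move=> /= ->.
Qed.

Lemma geo_leZ C q u c : geo_le C q u -> geo_le (normc c * C) q (fun n => c *: u n).
Proof. by move=> uq n; rewrite nrmZ -mulrA ler_wpM2l ?normc_ge0. Qed.

Lemma vsum_shift C q u : 0 <= C -> 0 <= q < 1 -> geo_le C q u ->
  vsum u = u 0%N + vsum (fun n => u n.+1).
Proof.
move=> C0 q01 uq; have /andP[q0 q1] := q01.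
have vq : geo_le C q (fun n => u n.+1).
  by move=> n; rewrite (le_trans (uq _))// ler_wpM2l// ler_wiXn2l ?leqnSn// ltW.
apply: vsum_eq; rewrite -(cvg_shiftS (series u)).
rewrite (_ : (fun n => _) = fun n => u 0%N + series (fun n => u n.+1) n).
  by apply: cvgD; [exact: cvg_cst|exact: geo_cvg vq].
by apply/funext => n; rewrite /series/= big_nat_recl.
Qed.

Lemma geo_le_pser C r u z : 0 <= C -> 0 < r -> geo_le C r^-1 u ->
  forall x, normc z <= x -> geo_le C (x / r) (fun n => z ^+ n *: u n).
Proof.
move=> C0 r0 ur x zx n; rewrite nrmZ normcX exprMn mulrCA.
by rewrite ler_pM ?exprn_ge0 ?normc_ge0 ?nrm_ge0// lerXn2r// nnegrE
  ?normc_ge0// (le_trans (normc_ge0 _) zx).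
Qed.

Definition pser u z := vsum (fun n => z ^+ n *: u n).

(** With [normc z + d < r], the remainders of the monomials are at most
    [2 (normc h / d)^2 (normc z + d)^n]. Against coefficients of size [C r^-n] they sum
    geometrically, with ratio [q = (normc z + d) / r]. *)
Lemma pser_taylor1 C r u z : 0 <= C -> 0 < r -> geo_le C r^-1 u ->
  normc z < r ->
  taylor1 (pser u) z (vsum (fun n => (n%:R * z ^+ n.-1) *: u n)).
Proof.
move=> C0 r0 ur zr; have x0 := normc_ge0 z; set x := normc z in zr x0.
have [d [d0 xdr]] : exists d, 0 < d /\ x + d < r.
  by exists ((r - x) / 2); split; lra.
pose q := (x + d) / r.
have xd0 : 0 <= x + d by rewrite addr_ge0// ltW.
have q01 : 0 <= q < 1.
  by rewrite /q divr_ge0 ?(ltW r0)//= ltr_pdivrMr// mul1r.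
have /andP[q0 q1] := q01.
have zq : geo_le C q (fun n => z ^+ n *: u n).
  by apply: geo_le_pser => //; rewrite lerDl ltW.
have dq : geo_le (C / d) q (fun n => (n%:R * z ^+ n.-1) *: u n).
  move=> n; rewrite nrmZ normcM normc_nat normcX -/x [leRHS]mulrAC.
  rewrite ler_pdivlMr// mulrC mulrA /q exprMn [leRHS]mulrCA ler_pM//.
  - by rewrite mulr_ge0 ?(ltW d0)// mulr_ge0// exprn_ge0.
  - exact: nrm_ge0.
  - by rewrite deriv_exprn_le// ltW.
exists (2 / d ^+ 2 * C / (1 - q)), (d / 2); split.
- by rewrite divr_ge0 ?subr_ge0 ?(ltW q1)// mulr_ge0// divr_ge0 ?sqr_ge0.
- exact: divr_gt0.
move=> h hd.
have hq : geo_le C q (fun n => (z + h) ^+ n *: u n).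
  apply: geo_le_pser => //; rewrite (le_trans (normcD_le _ _))// lerD2l.
  by rewrite (le_trans hd)// ler_pdivrMr// ler_peMr ?ltW// ltr1n.
have Cd0 : 0 <= C / d := divr_ge0 C0 (ltW d0).
pose t n := ((z + h) ^+ n - z ^+ n - h * (n%:R * z ^+ n.-1)) *: u n.
have -> : pser u (z + h) - pser u z -
    h *: vsum (fun n => (n%:R * z ^+ n.-1) *: u n) = vsum t.
  apply/esym/vsum_eq.
  rewrite (_ : series t = fun N => series (fun n => (z + h) ^+ n *: u n) N -
     series (fun n => z ^+ n *: u n) N -
     h *: series (fun n => (n%:R * z ^+ n.-1) *: u n) N).
    apply: cvgB; first by apply: cvgB; [exact: geo_cvg hq|exact: geo_cvg zq].
    by apply: cvgZr; exact: geo_cvg dq.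
  apply/funext => N; rewrite /series/= scaler_sumr -!sumrB.
  by apply: eq_bigr => n _; rewrite /t !scalerBl scalerA.
have tq : geo_le (2 / d ^+ 2 * C * normc h ^+ 2) q t.
  move=> n; rewrite nrmZ.
  apply: le_trans (ler_pM (normc_ge0 _) (nrm_ge0 _)
    (exprn_taylor_le z n d0 hd) (ur n)) _.
  rewrite /q -/x !exprMn !exprVn le_eqVlt; apply/orP; left; apply/eqP.
  set a := (x + d) ^+ n; have := expf_neq0 n (lt0r_neq0 r0).
  set b := r ^+ n => b0.
  by field; rewrite b0 gt_eqF.
apply: le_trans (nrm_vsum _ q01 tq) _; last by rewrite mulrAC.
by rewrite mulr_ge0 ?sqr_ge0// mulr_ge0// divr_ge0 ?sqr_ge0.
Qed.

Definition laurent u v z :=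
  vsum (fun n => z ^+ n *: u n) + vsum (fun n => z^-1 ^+ n.+1 *: v n).

Lemma geo_le_laurent_neg C s v z : 0 <= C -> 0 < s -> geo_le C s v ->
  s < normc z -> geo_le (C / s) (s / normc z) (fun n => z^-1 ^+ n.+1 *: v n).
Proof.
move=> C0 s0 vs sz n; have z0 : 0 < normc z := lt_trans s0 sz.
rewrite nrmZ normcX normcV exprS exprMn -mulrA.
rewrite [leRHS](_ : _ = s^-1 * ((normc z)^-1 ^+ n * (C * s ^+ n))); last by ring.
apply: ler_pM; rewrite ?invr_ge0 ?mulr_ge0 ?exprn_ge0 ?invr_ge0 ?nrm_ge0 ?normc_ge0//.
  by rewrite lef_pV2 ?posrE// ltW.
by rewrite ler_wpM2l ?exprn_ge0 ?invr_ge0 ?normc_ge0.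
Qed.

Lemma laurent_derivable C r s u v z : 0 <= C -> 0 < r -> 0 < s ->
  geo_le C r^-1 u -> geo_le C s v -> s < normc z < r ->
  derivable (laurent u v) z 1.
Proof.
move=> C0 r0 s0 ur vs /andP[sz zr].
have nz0 : 0 < normc z := lt_trans s0 sz.
have z0 : z != 0 by apply: contraTneq nz0 => ->; rewrite normc0 ltxx.
(* The principal part becomes a power series in [z^-1] without constant term, with radius [s^-1]. *)
pose v' n := if n is m.+1 then v m else 0.
have Cs0 : 0 <= C / s := divr_ge0 C0 (ltW s0).
have v's : geo_le (C / s) s^-1^-1 v'.
  move=> [|n]; first by rewrite nrm0 expr0 mulr1.
  by rewrite invrK exprS mulrA divfK ?gt_eqF//; exact: vs.
have sV0 : 0 < s^-1 by rewrite invr_gt0.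
have zV : normc z^-1 < s^-1 by rewrite normcV ltf_pV2 ?posrE.
have := taylor1D (pser_taylor1 C0 r0 ur zr)
  (taylor1_inv z0 (pser_taylor1 Cs0 sV0 v's zV)).
move=> [K [d [K0 d0 td]]].
(* Half the distance to the inner circle keeps [z + h] where the two-series formula [lE] is
   valid. *)
pose d' := Num.min d ((normc z - s) / 2).
apply: taylor1_derivable.
exists K, d'; split => //; first by rewrite lt_min d0 divr_gt0// subr_gt0.
have lE y : s < normc y -> laurent u v y = pser u y + pser v' y^-1.
  move=> sy; congr (_ + _).
  have y0 : 0 < normc y := lt_trans s0 sy.
  have q01 : 0 <= normc y^-1 / s^-1 < 1.
    rewrite divr_ge0 ?normc_ge0 ?(ltW sV0)//= ltr_pdivrMr// mul1r normcV.
    by rewrite ltf_pV2 ?posrE.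
  have := vsum_shift Cs0 q01 (geo_le_pser Cs0 sV0 v's (lexx (normc y^-1))).
  by rewrite /pser => ->; rewrite scaler0 add0r.
move=> h; rewrite le_min => /andP[hd hs].
rewrite !lE//; first exact: td.
have := normcD_le (z + h) (- h); rewrite addrK normcN.
by move: hs sz; set a := normc (z + h); lra.
Qed.

End PowerSeries.

(** * Hilbert spaces and l^2 *)

Section HilbertDot.
Variables (R : realType) (V : hilbertType R).
Implicit Types (u v e : V) (c : R[i]).

Lemma hdot_linl c u v e : hdot (c *: u + v) e = c * hdot u e + hdot v e.
Proof. by rewrite linearPl. Qed.

Lemma hdotC u v : hdot u v = (hdot v u)^*.
Proof. by rewrite hermC expr0 mul1r. Qed.

Lemma hdot0l e : hdot 0 e = 0.
Proof. by rewrite linear0l. Qed.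

Lemma hdotZl c u e : hdot (c *: u) e = c * hdot u e.
Proof. by rewrite linearZl_LR. Qed.

Lemma hdotDl u v e : hdot (u + v) e = hdot u e + hdot v e.
Proof. by rewrite linearDl. Qed.

Lemma hdotBl u v e : hdot (u - v) e = hdot u e - hdot v e.
Proof. by rewrite linearBl. Qed.

Lemma hdot0r e : hdot e 0 = 0.
Proof. by rewrite hdotC hdot0l rmorph0. Qed.

Lemma hdotZr c u e : hdot e (c *: u) = c^* * hdot e u.
Proof. by rewrite hdotC hdotZl rmorphM/= -hdotC. Qed.

Lemma hdotDr u v e : hdot e (u + v) = hdot e u + hdot e v.
Proof. by rewrite hdotC hdotDl rmorphD/= -!hdotC. Qed.

Lemma hdotBr u v e : hdot e (u - v) = hdot e u - hdot e v.
Proof. by rewrite hdotC hdotBl rmorphB/= -!hdotC. Qed.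

Lemma hdot_suml (I : Type) (r : seq I) (F : I -> V) e :
  hdot (\sum_(i <- r) F i) e = \sum_(i <- r) hdot (F i) e.
Proof.
elim/big_rec2 : _ => [|i x y _ <-]; first exact: hdot0l.
exact: hdotDl.
Qed.

Lemma hdot_sumr (I : Type) (r : seq I) (F : I -> V) e :
  hdot e (\sum_(i <- r) F i) = \sum_(i <- r) hdot e (F i).
Proof.
elim/big_rec2 : _ => [|i x y _ <-]; first exact: hdot0r.
exact: hdotDr.
Qed.

Lemma hdot_sqr u : hdot u u = (nrm u ^+ 2)%:C.
Proof. by rewrite hdot_norm nrmE rmorphXn. Qed.

(** Cauchy-Schwarz, by expanding the square norm of [u] minus its projection on the line of [v]. *)
Lemma hdot_le u v : normc (hdot u v) <= nrm u * nrm v.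
Proof.
have [->|v0] := eqVneq v 0.
  by rewrite hdot0r normc0 mulr_ge0 ?nrm_ge0.
have nv0 : 0 < nrm v.
  by rewrite lt_def nrm_ge0 andbT; apply: contra_neq v0 => /nrm0_eq0.
set a := hdot u v; pose c := a / ((nrm v ^+ 2)%:C).
have nC0 : ((nrm v ^+ 2)%:C : R[i]) != 0.
  by rewrite (inj_eq (@complexI R)) expf_eq0/= gt_eqF.
have h : hdot (u - c *: v) (u - c *: v) = ((nrm u ^+ 2)%:C) - a * a^* / (nrm v ^+ 2)%:C.
  rewrite hdotBl !hdotBr !hdotZl !hdotZr !hdot_sqr -/a (hdotC v u) -/a.
  have cv : c * (nrm v ^+ 2)%:C = a by rewrite /c divfK.
  have -> : c * (c^* * (nrm v ^+ 2)%:C) = c^* * a by rewrite mulrCA cv.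
  have -> : c * a^* = a * a^* / (nrm v ^+ 2)%:C by rewrite /c mulrAC.
  ring.
have : 0 <= hdot (u - c *: v) (u - c *: v).
  by rewrite hdot_sqr lecR sqr_ge0.
rewrite h -normCK normC_normc -rmorphXn -fmorphV -rmorphM -rmorphB/= lecR.
rewrite subr_ge0 ler_pdivrMr ?exprn_gt0// -exprMn.
by rewrite ler_pXn2r ?nnegrE ?normc_ge0 ?mulr_ge0 ?nrm_ge0.
Qed.

Lemma hdot_eq0 u : (forall v, hdot u v = 0) -> u = 0.
Proof.
move=> /(_ u)/eqP; rewrite hdot_sqr (inj_eq (@complexI R) _ 0) expf_eq0/=.
by move=> /eqP/nrm0_eq0.
Qed.

Lemma hdot_bounded e : exists2 M : R, 0 <= M & forall u, normc (hdot u e) <= M * nrm u.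
Proof.
by exists (nrm e) => [|u]; rewrite ?nrm_ge0// mulrC hdot_le.
Qed.

(** Carries an adjunction between coefficients over to the sums of the series, by continuity of the
    inner product in each argument. *)
Lemma hdot_vsum_eq C q D r (u v : nat -> V) a b :
  0 <= C -> 0 <= q < 1 -> geo_le C q u -> 0 <= D -> 0 <= r < 1 -> geo_le D r v ->
  (forall n, hdot (u n) a = hdot b (v n)) -> hdot (vsum u) a = hdot b (vsum v).
Proof.
move=> C0 q01 uq D0 r01 vr uv.
apply/eqP; rewrite -subr_eq0 -normr_eq0; apply/eqP.
have /cvg_nrmP u1 := geo_cvg C0 q01 uq; have /cvg_nrmP v1 := geo_cvg D0 r01 vr.
have e0 : forall e : R, 0 < e -> normc (hdot (vsum u) a - hdot b (vsum v)) <= e.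
  move=> e e0; pose m := nrm a + nrm b + 1.
  have m0 : 0 < m by rewrite ltr_wpDl// addr_ge0 ?nrm_ge0.
  have [N _ NP] := filterI (u1 _ (divr_gt0 e0 m0)) (v1 _ (divr_gt0 e0 m0)).
  have [uN vN] := NP N (leqnn N).
  have -> : hdot (vsum u) a - hdot b (vsum v) =
      hdot (vsum u - series u N) a - hdot b (vsum v - series v N).
    rewrite hdotBl hdotBr /series/= hdot_suml hdot_sumr.
    by under eq_bigr do rewrite uv; ring.
  apply: le_trans (normcD_le _ _) _; rewrite normcN.
  have h3 := hdot_le (vsum u - series u N) a.
  have h4 := hdot_le b (vsum v - series v N).
  have h5 := ler_wpM2r (nrm_ge0 a) uN; have h6 := ler_wpM2r (nrm_ge0 b) vN.
  have h7 : e = e / m * nrm a + e / m * nrm b + e / m.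
    by rewrite /m; field; rewrite gt_eqF.
  have : 0 < e / m by exact: divr_gt0.
  lra.
rewrite normC_normc; congr (_%:C); apply/eqP; rewrite eq_le normc_ge0 andbT.
by apply/ler_addgt0Pr => e ep; rewrite add0r e0.
Qed.

Lemma closed_span_sub (A : set V) v : A v -> closed_span A v.
Proof.
move=> Av; apply: subset_closure; exists 1%N, (fun=> 1), (fun=> v).
by split => //; rewrite big_ord1 scale1r.
Qed.

Lemma closed_span_min (A S : set V) : S 0 ->
  (forall (c : R[i]) u v, S u -> S v -> S (c *: u + v)) -> closed S ->
  A `<=` S -> closed_span A `<=` S.
Proof.
move=> S0 SP Sc AS; apply: subset_trans Sc; apply: closure_subset.
move=> _ [n [c [u [uA ->]]]]; elim/big_rec : _ => // i x _ xS.
by apply: SP => //; exact/AS/uA.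
Qed.

Lemma closed_span_lin (A : set V) (c : R[i]) u v :
  closed_span A u -> closed_span A v -> closed_span A (c *: u + v).
Proof.
move=> /closure_nrmP uA /closure_nrmP vA; apply/closure_nrmP => e e0.
have c1 : 0 < normc c + 1 by rewrite ltr_wpDl ?normc_ge0.
have e2 : 0 < e / 2 by rewrite divr_gt0.
have [x [n [a [s [sA ->]]]] xe] := uA _ (divr_gt0 e2 c1).
have [y [m [b [t [tA ->]]]] ye] := vA _ e2.
exists (c *: (\sum_i a i *: s i) + \sum_i b i *: t i).
  exists (n + m)%N.
  exists (fun i => match fintype.split i with inl j => c * a j | inr j => b j end).
  exists (fun i => match fintype.split i with inl j => s j | inr j => t j end).
  split=> [i|]; first by case: fintype.split => j; [exact: sA|exact: tA].
  rewrite big_split_ord/= scaler_sumr; congr (_ + _); apply: eq_bigr => i _.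
    by rewrite (unsplitK (inl _ i)) scalerA.
  by rewrite (unsplitK (inr _ i)).
rewrite opprD addrACA -scalerBr (le_lt_trans (nrmD _ _))// [ltRHS]splitr.
apply: ler_ltD => //; rewrite nrmZ.
rewrite ltr_pdivlMr// in xe; apply: le_trans (ltW xe); rewrite mulrC.
by rewrite ler_wpM2l ?nrm_ge0// lerDl.
Qed.

Lemma closed_span0 (A : set V) : closed_span A 0.
Proof.
apply: subset_closure; exists 0%N, (fun=> 0), (fun=> 0).
by rewrite big_ord0; split => // -[].
Qed.

Lemma closed_span_closed (A : set V) : closed (closed_span A).
Proof. exact: closed_closure. Qed.

Lemma closed_span_orth (A : set V) u v :
  (forall a, A a -> hdot u a = 0) -> closed_span A v -> hdot u v = 0.
Proof.
move=> uA Av; suff : [set v | hdot u v = 0] v by [].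
apply: (closed_span_min _ _ _ _ Av) => //=.
- exact: hdot0r.
- by move=> c x y xu yu; rewrite hdotDr hdotZr xu yu mulr0 addr0.
move=> x /closure_nrmP xu; apply: eq0_normc; apply/eqP.
rewrite eq_le normc_ge0 andbT; apply/ler_addgt0Pr => e e0; rewrite add0r.
have u1 : 0 < nrm u + 1 by rewrite ltr_wpDl ?nrm_ge0.
have [y yu xy] := xu _ (divr_gt0 e0 u1).
have -> : hdot u x = hdot u (x - y) by rewrite hdotBr yu subr0.
rewrite (le_trans (hdot_le _ _))// -[e](divfK (lt0r_neq0 u1)).
by rewrite mulrC ler_pM ?nrm_ge0 ?(ltW xy)// lerDl.
Qed.

End HilbertDot.

Lemma closed_fixpoints (R : realType) (V : normedModType R[i]) (P : V -> V) :
  linear_bounded P -> closed [set f | P f = f].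
Proof.
move=> Pb f /closure_nrmP fP /=; have [M M0 PM] := Pb.2.
apply/eqP; rewrite -subr_eq0; apply/eqP/nrm0_eq0/eqP.
rewrite eq_le nrm_ge0 andbT; apply/ler_addgt0Pr => e e0; rewrite add0r.
have M1 : 0 < M + 1 by rewrite ltr_wpDl.
have [g gP fg] := fP _ (divr_gt0 e0 M1).
have -> : P f - f = P (f - g) - (f - g) by rewrite lbB// gP opprB addrA subrK.
rewrite (le_trans (nrmB _ _))// -[e](divfK (lt0r_neq0 M1)).
rewrite mulrDr mulr1 lerD ?(ltW fg)// (le_trans (PM _))// mulrC.
by rewrite ler_wpM2r// ltW.
Qed.

(** * Coordinates, multiplications and restrictions in l^2 *)

Section L2Facts.
Variables (R : realType) (X : choiceType).
Local Notation l2 := (l2 R X).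
Local Notation e_ := (l2_basis R).
Implicit Types (f g : l2) (x y : X).

Lemma l2_ext f g : (forall x, f x = g x) -> f = g.
Proof. by move=> fg; apply/val_inj/funext. Qed.

Lemma l2_sumE (I : Type) (r : seq I) (F : I -> l2) x :
  (\sum_(i <- r) F i) x = \sum_(i <- r) F i x.
Proof. by elim/big_rec2 : _ => // i y z _ <-. Qed.

Lemma normc_le_nrm f x : normc (f x) <= nrm f.
Proof. exact: normc_le_l2_norm (l2_funP f). Qed.

Lemma l2_dot_congr f g f' g' :
  (forall x, f x * (g x)^* = f' x * (g' x)^*) -> hdot f g = hdot f' g'.
Proof.
move=> fg; apply: l2_dotP; have := @l2_dot_cvg R X f' g'.
by apply: cvg_partial_sum_eq => x.
Qed.

Lemma hdot_basisr f x : hdot f (e_ x) = f x.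
Proof.
apply: l2_dotP; apply/cvgrPdist_le => e e0; exists [fset x]%fset => // J /= xJ.
rewrite partial_sumE (big_fsetD1 x)/= -?fsub1set// eqxx rmorph1 mulr1.
rewrite big_seq big1 ?addr0 ?subrr ?normr0 ?ltW// => y.
by rewrite !inE => /andP[/negPf -> _]; rewrite rmorph0 mulr0.
Qed.

Lemma hdot_basisl f x : hdot (e_ x) f = (f x)^*.
Proof. by rewrite hdotC hdot_basisr. Qed.

Lemma l2_basisE x y : e_ x y = (y == x)%:R.
Proof. by []. Qed.

Lemma nrm_basis x : nrm (e_ x) = 1.
Proof.
apply/eqP; rewrite -(@pexpr_eq1 _ _ 2) ?nrm_ge0//.
by rewrite -(inj_eq (@complexI R)) -hdot_sqr hdot_basisr l2_basisE eqxx.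
Qed.

Lemma nrm_truncation f (J : {fset X}) :
  nrm (f - \sum_(x <- J) f x *: e_ x) ^+ 2 =
  nrm f ^+ 2 - \sum_(x <- J) normc (f x) ^+ 2.
Proof.
apply: complexI; rewrite rmorphB rmorph_sum /= -!hdot_sqr.
set g := \sum_(x <- J) _.
have gJ x : x \in J -> g x = f x.
  move=> xJ; rewrite l2_sumE (big_fsetD1 x)// l2_scaleE l2_basisE eqxx mulr1.
  rewrite big_seq big1; first exact: addr0.
  move=> y; rewrite !inE => /andP[yx _].
  by rewrite l2_scaleE l2_basisE eq_sym (negPf yx) mulr0.
have sq (h : l2) : (forall x, x \in J -> h x = f x) ->
    hdot h g = \sum_(x <- J) (normc (f x) ^+ 2)%:C.
  move=> hJ; rewrite hdot_sumr big_seq [RHS]big_seq; apply: eq_bigr => x xJ.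
  by rewrite hdotZr hdot_basisr hJ// mulrC -normCK normC_normc rmorphXn.
have gf : hdot g f = \sum_(x <- J) (normc (f x) ^+ 2)%:C.
  rewrite hdotC (sq f)// rmorph_sum; apply: eq_bigr => x _.
  exact: conjc_real.
by rewrite hdotBl !hdotBr gf (sq f)// (sq g)// subrr subr0.
Qed.

Lemma l2_truncation f (e : R) : 0 < e ->
  exists J : {fset X}, nrm (f - \sum_(x <- J) f x *: e_ x) <= e.
Proof.
move=> e0; have := @l2_sqr_cvg R X f.
move=> /cvgrPdist_le/(_ (e ^+ 2)%:C)[|J _ /(_ J (fsubset_refl J))].
  by rewrite ltcR exprn_gt0.
rewrite partial_sumE -rmorph_sum (nrmE f) -rmorphXn -rmorphB normC_normc lecR /=.
rewrite expr0n addr0 sqrtr_sqr => h.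
exists J; rewrite -(@ler_pXn2r _ 2)// ?nnegrE ?nrm_ge0 ?(ltW e0)//.
by rewrite nrm_truncation (le_trans (ler_norm _)).
Qed.

(** An induction principle: a vector is the limit of its finite truncations, which only involve
    basis vectors in its support. *)
Lemma l2_span_basis (S : set l2) : S 0 ->
  (forall (c : R[i]) u v, S u -> S v -> S (c *: u + v)) -> closed S ->
  forall f, (forall x, f x != 0 -> S (e_ x)) -> S f.
Proof.
move=> S0 SP Sc f fS; apply: Sc; apply/closure_nrmP => e e0.
have [J fJ] := l2_truncation f (divr_gt0 e0 (ltr0n R 2)).
exists (\sum_(x <- J) f x *: e_ x).
  elim/big_rec : _ => // x g _ gS; have [->|fx] := eqVneq (f x) 0.
    by rewrite scale0r add0r.
  by apply: SP => //; exact: fS.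
by rewrite (le_lt_trans fJ)// ltr_pdivrMr// ltr_pMr// ltr1n.
Qed.

(** Turns the closed span into a condition on supports: one direction is orthogonality to [e_ x] for
    [x] off [Y], the other is truncation. *)
Lemma l2_onP (Y : set X) f : l2_on Y f <-> forall x, ~ Y x -> f x = 0.
Proof.
split=> [Yf x Yx|f0].
  have := closed_span_orth (u := e_ x) _ Yf; rewrite hdot_basisl => h.
  apply/eqP; rewrite -conjc_eq0; apply/eqP; apply: h => _ [y Yy <-].
  rewrite hdot_basisr l2_basisE; case: eqP => // xy.
  by rewrite -xy in Yx.
apply: l2_span_basis; [exact: closed_span0| |exact: closed_span_closed|].
  by move=> c u v; exact: closed_span_lin.
move=> x fx; apply: closed_span_sub; exists x => //.
by apply: contrapT => /f0 fx0; rewrite fx0 eqxx in fx.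
Qed.

Lemma linear_bounded_ext (V : normedModType R[i]) (g h : l2 -> V) :
  linear_bounded g -> linear_bounded h -> (forall x, g (e_ x) = h (e_ x)) ->
  forall f, g f = h f.
Proof.
move=> gb hb gh f; have kb := lb_sub gb hb; have [M M0 kM] := kb.2.
apply/eqP; rewrite -subr_eq0; apply/eqP/nrm0_eq0/eqP.
rewrite eq_le nrm_ge0 andbT; apply/ler_addgt0Pr => e e0; rewrite add0r.
have M1 : 0 < M + 1 by rewrite ltr_wpDl.
have [J fJ] := l2_truncation f (divr_gt0 e0 M1).
set t := \sum_(x <- J) _ in fJ.
have t0 : g t - h t = 0.
  rewrite /t (lb_sum _ _ _ kb).
  by rewrite big1// => x _; rewrite (lbZ (f x) (e_ x) kb) gh subrr scaler0.
rewrite -[X in nrm X]subr0 -t0 -(lbB f t kb).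
rewrite (le_trans (kM _))// -[e](divfK (lt0r_neq0 M1)) mulrC.
by rewrite ler_pM ?nrm_ge0// lerDl.
Qed.

Lemma l2_of_bounded (h : X -> R[i]) (M : R) : 0 <= M ->
  (forall J : {fset X}, \sum_(x <- J) normc (h x) ^+ 2 <= M ^+ 2) ->
  exists2 f : l2, (forall x, f x = h x) & nrm f <= M.
Proof.
by move=> M0 hM; have [hl hn] := l2_predP M0 hM; exists (L2 hl).
Qed.

(** The value is the junk vector 0 when [h] is not square summable; [to_l2E] applies once
    summability is known. *)
Definition to_l2 (h : X -> R[i]) : l2 := insubd (0 : l2) h.

Lemma to_l2E (h : X -> R[i]) (f : l2) : (forall x, f x = h x) -> to_l2 h = f.
Proof.
move=> fh; rewrite /to_l2; have -> : h = l2_fun f by apply/funext => x.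
by apply: val_inj; rewrite val_insubd (l2_funP f).
Qed.

Definition mul_op (m : X -> R[i]) (f : l2) : l2 := to_l2 (fun x => m x * f x).

Section MulOp.
Variables (m : X -> R[i]) (M : R).
Hypothesis mM : forall x, normc (m x) <= M.

Let M0 (x : X) : 0 <= M. Proof. exact: le_trans (normc_ge0 _) (mM x). Qed.

Lemma mul_op_spec f : (forall x, mul_op m f x = m x * f x) /\
  nrm (mul_op m f) <= `|M| * nrm f.
Proof.
have [||g gE gn] := @l2_of_bounded (fun x => m x * f x) (`|M| * nrm f).
- by rewrite mulr_ge0 ?nrm_ge0.
- move=> J; apply: le_trans (_ : \sum_(x <- J) `|M| ^+ 2 * normc (f x) ^+ 2 <= _).
    apply: ler_sum => x _; rewrite -exprMn lerXn2r ?nnegrE ?normc_ge0//.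
      by rewrite mulr_ge0 ?normc_ge0.
    by rewrite normcM ler_wpM2r ?normc_ge0// (le_trans (mM x))// ler_norm.
  by rewrite -mulr_sumr exprMn ler_wpM2l ?sqr_ge0// (fsum_le_l2_norm _ (l2_funP f)).
by rewrite /mul_op (to_l2E gE).
Qed.

Lemma mul_opE f x : mul_op m f x = m x * f x.
Proof. exact: (mul_op_spec f).1. Qed.

Lemma mul_op_lb : linear_bounded (mul_op m).
Proof.
split.
  by move=> c f g; apply: l2_ext => x; rewrite !(mul_opE, l2_addE, l2_scaleE)
    mulrDr mulrCA.
by exists `|M| => // f; exact: (mul_op_spec f).2.
Qed.

End MulOp.

(* Without the locks on [restr], [adj] and [fiber_scale], unification unfolds
   them down to the arithmetic of [R[i]]. *)
Fact restr_key : unit. Proof. by []. Qed.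

Definition restr (Y : set X) : l2 -> l2 :=
  locked_with restr_key (mul_op (fun x => (`[< Y x >])%:R)).

Lemma restr_mul_op Y : restr Y = mul_op (fun x => (`[< Y x >])%:R).
Proof. exact: locked_withE. Qed.

Lemma restr_le (Y : set X) x : normc ((`[< Y x >])%:R : R[i]) <= 1.
Proof. by rewrite normc_nat; case: asboolP. Qed.

Lemma restrE Y f x : restr Y f x = if `[< Y x >] then f x else 0.
Proof.
rewrite restr_mul_op (mul_opE (restr_le Y)).
by case: asboolP => _; rewrite ?mul1r ?mul0r.
Qed.

Lemma restr_lb Y : linear_bounded (restr Y).
Proof. by rewrite restr_mul_op; exact: mul_op_lb (restr_le Y). Qed.

Lemma hdot_restr Y f g : hdot (restr Y f) g = hdot f (restr Y g).
Proof.
apply: l2_dot_congr => x; rewrite !restrE; case: asboolP => // _.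
by rewrite rmorph0 mul0r mulr0.
Qed.

End L2Facts.

(** * Adjoints in l^2 *)

Section Adjoint.
Variables (R : realType) (X : choiceType).
Local Notation l2 := (l2 R X).
Local Notation e_ := (l2_basis R).
Variable T : l2 -> l2.
Hypothesis Tb : linear_bounded T.

Fact adj_key : unit. Proof. by []. Qed.

(** The adjoint given by its coordinates; [adjointE] identifies it with [adjoint T], which is
    defined by choice. *)
Definition adj : l2 -> l2 :=
  locked_with adj_key (fun f => to_l2 (fun y => hdot f (T (e_ y)))).

(** Square summability by testing on the truncation [g] of the candidate to [J]: the partial sum [S]
    equals both [nrm g ^+ 2] and [hdot f (T g)], so [nrm g] is at most [M * nrm f]. *)
Lemma adj_spec (M : R) : 0 <= M -> (forall f, nrm (T f) <= M * nrm f) ->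
  forall f, (forall y, adj f y = hdot f (T (e_ y))) /\ nrm (adj f) <= M * nrm f.
Proof.
move=> M0 TM f; have [||g gE gn] :=
    @l2_of_bounded R X (fun y => hdot f (T (e_ y))) (M * nrm f).
- by rewrite mulr_ge0 ?nrm_ge0.
- move=> J; pose g : l2 := \sum_(y <- J) hdot f (T (e_ y)) *: e_ y.
  set S := \sum_(y <- J) _.
  have S0 : 0 <= S by apply: sumr_ge0 => y _; exact: sqr_ge0.
  have gJ y : y \in J -> g y = hdot f (T (e_ y)).
    move=> yJ; rewrite l2_sumE (big_fsetD1 y)// l2_scaleE l2_basisE eqxx mulr1.
    rewrite big_seq big1; first exact: addr0.
    move=> z; rewrite !inE => /andP[zy _].
    by rewrite l2_scaleE l2_basisE eq_sym (negPf zy) mulr0.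
  have ffg : hdot f (T g) = S%:C.
    rewrite lb_sum// hdot_sumr rmorph_sum/=; apply: eq_bigr => y _.
    by rewrite lbZ// hdotZr mulrC -normCK normC_normc rmorphXn.
  have gg : nrm g ^+ 2 = S.
    apply: complexI; rewrite -hdot_sqr {2}/g hdot_sumr rmorph_sum/=.
    rewrite big_seq [RHS]big_seq; apply: eq_bigr => y yJ.
    by rewrite hdotZr hdot_basisr gJ// mulrC -normCK normC_normc rmorphXn.
  have SE : S <= nrm f * (M * nrm g).
    have : normc (hdot f (T g)) = S by rewrite ffg /= expr0n addr0 sqrtr_sqr ger0_norm.
    move=> <-; apply: le_trans (hdot_le _ _) _.
    by rewrite ler_wpM2l ?nrm_ge0 ?TM.
  have [g0|g0] := eqVneq (nrm g) 0; first by rewrite -gg g0 expr0n sqr_ge0.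
  have gp : 0 < nrm g by rewrite lt_def g0 nrm_ge0.
  rewrite -gg lerXn2r ?nnegrE ?nrm_ge0 ?mulr_ge0 ?nrm_ge0//.
  by rewrite -(ler_pM2r gp) -expr2 gg mulrAC mulrC.
by rewrite /adj locked_withE (to_l2E gE).
Qed.

Lemma adj_basis f y : adj f y = hdot f (T (e_ y)).
Proof. by have [M M0 TM] := Tb.2; exact: (adj_spec M0 TM f).1. Qed.

Lemma adj_lb : linear_bounded adj.
Proof.
split.
  by move=> c f g; apply: l2_ext => y; rewrite l2_addE l2_scaleE !adj_basis hdot_linl.
by have [M M0 TM] := Tb.2; exists M => // f; exact: (adj_spec M0 TM f).2.
Qed.

Lemma adjE f g : hdot (T f) g = hdot f (adj g).
Proof.
have hb (e : l2) : @linear_bounded R l2 R[i]^o (fun u => hdot u e).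
  split=> [c u v|]; first exact: hdot_linl.
  exact: hdot_bounded.
apply: (linear_bounded_ext (lb_comp (hb g) Tb) (hb (adj g))) => x /=.
by rewrite hdot_basisl adj_basis -hdotC.
Qed.

Lemma adjEr f g : hdot f (T g) = hdot (adj f) g.
Proof. by rewrite hdotC adjE -hdotC. Qed.

Lemma adjointE : adjoint T = adj.
Proof.
apply/funext => f; rewrite /adjoint /adjoint_on.
apply: xget_unique; first by split=> // x _; exact: adjE.
move=> z [_ zP]; apply/eqP; rewrite -subr_eq0; apply/eqP.
apply: hdot_eq0 => v; rewrite hdotBl (hdotC z) (hdotC (adj f)).
by rewrite -zP// adjE subrr.
Qed.

End Adjoint.

(** * Weighted composition operators *)

Section WeightedComposition.
Variables (R : realType) (X : choiceType).
Local Notation l2 := (l2 R X).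
Local Notation e_ := (l2_basis R).
Implicit Types (f g : l2) (x y : X).
Variables (phi : X -> X) (w : X -> R[i]) (T : l2 -> l2).
Hypothesis TE : is_wcomp phi w T.
Hypothesis Tb : linear_bounded T.
Variable c : R.
Hypothesis c0 : 0 < c.
Hypothesis Tc : forall f : l2, c * nrm f <= nrm (T f).

Local Notation Ta := (adj T).

Lemma wcomp_basis x y : T (e_ x) y = w y * (phi y == x)%:R.
Proof. by rewrite TE. Qed.

Lemma iter_wcomp n f x :
  iter n T f x = (\prod_(i < n) w (iter i phi x)) * f (iter n phi x).
Proof.
elim: n x => [|n IH] x; first by rewrite big_ord0 mul1r.
rewrite iterS TE IH big_ord_recl/= mulrA -iterSr; congr (_ * _ * _).
by apply: eq_bigr => i _; rewrite /bump/= -iterSr.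
Qed.

Lemma wcomp_vanish (Y : set X) f : (forall x, Y x -> Y (phi x)) ->
  (forall x, Y x -> f x = 0) -> forall x, Y x -> T f x = 0.
Proof. by move=> Yphi f0 x Yx; rewrite TE f0 ?mulr0//; exact: Yphi. Qed.

(** The sum of [|w|^2] over the fibre of [y] ([fiber_normE]), which is also the diagonal entry of
    [T* T] at [y] ([adj_wcomp]). *)
Definition fiber_norm y : R := nrm (T (e_ y)) ^+ 2.

Lemma fiber_norm_ge y : c ^+ 2 <= fiber_norm y.
Proof.
rewrite /fiber_norm lerXn2r ?nnegrE ?nrm_ge0 ?(ltW c0)//.
by have := Tc (e_ y); rewrite nrm_basis mulr1.
Qed.

Lemma fiber_norm_gt0 y : 0 < fiber_norm y.
Proof. by rewrite (lt_le_trans _ (fiber_norm_ge y))// exprn_gt0. Qed.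

Lemma fiber_normC0 y : (fiber_norm y)%:C != 0 :> R[i].
Proof. by rewrite (inj_eq (@complexI R) _ 0) gt_eqF// fiber_norm_gt0. Qed.

(** [T (e_ y)] is supported on the fibre of [y] and is nonzero because [T] is bounded below. *)
Lemma phi_surj y : exists2 x, phi x = y & w x != 0.
Proof.
apply: contrapT => no; have := fiber_norm_gt0 y; rewrite /fiber_norm.
suff -> : T (e_ y) = 0 by rewrite nrm0 expr0n ltxx.
apply: l2_ext => x; rewrite wcomp_basis; case: eqP => [xy|]; last by rewrite mulr0.
rewrite mulr1; apply: contrapT => /eqP wx; apply: no.
by exists x.
Qed.

(* In coordinates, [Ta f y] is the sum of [w u ^* f u] over the fibre of [y],
   so it only depends on the values of [f] there. *)
Lemma adj_local f y (Y : set X) : (forall x, phi x = y -> Y x) ->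
  adj T f y = adj T (restr Y f) y.
Proof.
move=> yY; rewrite !adj_basis//; apply: l2_dot_congr => x.
rewrite wcomp_basis restrE; case: eqP => [xy|]; last first.
  by rewrite mulr0 rmorph0 !mulr0.
by case: asboolP => // nY; case: nY; exact: yY.
Qed.

Lemma adj_vanish f y : (forall x, phi x = y -> f x = 0) -> adj T f y = 0.
Proof.
move=> f0; rewrite (@adj_local f y (phi @^-1` [set y]))//.
rewrite (_ : restr _ f = 0) ?(lb0 (adj_lb Tb))//.
by apply: l2_ext => x; rewrite restrE; case: asboolP => // /f0 ->.
Qed.

Lemma adj_basis_basis x : adj T (e_ x) = (w x)^* *: e_ (phi x).
Proof.
apply: l2_ext => y; rewrite l2_scaleE adj_basis// hdot_basisl wcomp_basis.
rewrite rmorphM l2_basisE eq_sym.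
by congr (_ * _); case: eqP; rewrite ?rmorph1 ?rmorph0.
Qed.

Lemma adj_single f x : (forall u, phi u = phi x -> u = x) ->
  adj T f (phi x) = (w x)^* * f x.
Proof.
move=> ux; rewrite adj_basis// (_ : T (e_ (phi x)) = w x *: e_ x).
  by rewrite hdotZr hdot_basisr.
apply: l2_ext => y; rewrite wcomp_basis l2_scaleE l2_basisE.
have [->|yx] := eqVneq y x; first by rewrite eqxx.
case: eqP => [/ux yx'|]; last by rewrite !mulr0.
by rewrite yx' eqxx in yx.
Qed.

(** The vectors [T (e_ y)] have disjoint supports, the fibres, so [T* T] is diagonal. *)
Lemma adj_wcomp f y : adj T (T f) y = (fiber_norm y)%:C * f y.
Proof.
rewrite adj_basis//.
have -> : hdot (T f) (T (e_ y)) = hdot (f y *: T (e_ y)) (T (e_ y)).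
  apply: l2_dot_congr => x; rewrite l2_scaleE wcomp_basis TE.
  case: eqP => [<-|]; last by rewrite mulr0 rmorph0 !mulr0.
  by rewrite mulr1 [f _ * _]mulrC.
by rewrite hdotZl hdot_sqr mulrC.
Qed.

Fact fiber_scale_key : unit. Proof. by []. Qed.

(** The inverse of the diagonal operator [T* T]. *)
Definition fiber_scale : l2 -> l2 :=
  locked_with fiber_scale_key (mul_op (fun y => ((fiber_norm y)^-1)%:C)).

Lemma fiber_scale_le y : normc (((fiber_norm y)^-1)%:C : R[i]) <= (c ^+ 2)^-1.
Proof.
rewrite /= expr0n addr0 sqrtr_sqr ger0_norm ?invr_ge0 ?(ltW (fiber_norm_gt0 y))//.
by rewrite lef_pV2 ?fiber_norm_ge// posrE ?fiber_norm_gt0 ?exprn_gt0.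
Qed.

Lemma fiber_scaleC f y : fiber_scale f y = ((fiber_norm y)^-1)%:C * f y.
Proof.
rewrite /fiber_scale locked_withE.
exact: (mul_opE fiber_scale_le).
Qed.

Lemma fiber_scaleE f y : fiber_scale f y = ((fiber_norm y)%:C)^-1 * f y.
Proof. by rewrite fiber_scaleC -fmorphV. Qed.

Lemma fiber_scale_lb : linear_bounded fiber_scale.
Proof.
rewrite /fiber_scale locked_withE.
exact: mul_op_lb fiber_scale_le.
Qed.

Lemma hdot_fiber_scale f g : hdot (fiber_scale f) g = hdot f (fiber_scale g).
Proof.
apply: l2_dot_congr => x; rewrite !fiber_scaleC rmorphM.
by rewrite -[LHS]mulrA mulrCA; congr (_ * (_ * _)); exact/esym/conjc_real.
Qed.

Definition linv : l2 -> l2 := fiber_scale \o adj T.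
Definition cdual : l2 -> l2 := T \o fiber_scale.

Lemma linv_lb : linear_bounded linv.
Proof. exact: lb_comp fiber_scale_lb (adj_lb Tb). Qed.

Lemma cdual_lb : linear_bounded cdual.
Proof. exact: lb_comp Tb fiber_scale_lb. Qed.

Lemma linvE f y : linv f y = ((fiber_norm y)%:C)^-1 * adj T f y.
Proof. by rewrite /linv /= fiber_scaleE. Qed.

Lemma linvK : cancel T linv.
Proof.
by move=> f; apply: l2_ext => y; rewrite linvE adj_wcomp mulKf// fiber_normC0.
Qed.

Lemma hdot_cdual f g : hdot (cdual f) g = hdot f (linv g).
Proof. by rewrite /cdual /= (adjE Tb) hdot_fiber_scale. Qed.

Lemma hdot_linv f g : hdot (linv f) g = hdot f (cdual g).
Proof. by rewrite hdotC -hdot_cdual -hdotC. Qed.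

Lemma adj_cdual f : adj T (cdual f) = f.
Proof.
apply: l2_ext => y; rewrite /cdual /= adj_wcomp fiber_scaleE mulVKf//.
exact: fiber_normC0.
Qed.

Lemma fiber_normE y :
  fine (\esum_(u in phi @^-1` [set y]) (normc (w u) ^+ 2)%:E)%E = fiber_norm y.
Proof.
rewrite esum_mkcond -[RHS]/(fine (fiber_norm y)%:E); congr fine.
rewrite /fiber_norm -sqsumE ?l2_funP// /sqsum; apply: eq_esum => x _.
rewrite wcomp_basis; case: ifPn => [/set_mem/= ->|xy].
  by rewrite eqxx mulr1.
case: eqP => [xy'|_]; last by rewrite mulr0 normc0 expr0n.
by rewrite (mem_set (xy' : (phi @^-1` [set y]) x)) in xy.
Qed.

Lemma dual_weightE x : dual_weight phi w x = w x / (fiber_norm (phi x))%:C.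
Proof. by rewrite /dual_weight fiber_normE. Qed.

Lemma cdual_wcomp : is_wcomp phi (dual_weight phi w) cdual.
Proof.
by move=> f x; rewrite /cdual /= TE fiber_scaleE dual_weightE mulrA.
Qed.

Lemma cauchy_dualE : cauchy_dual T = cdual.
Proof.
apply/funext => f; rewrite /cauchy_dual /cdual /=; congr T.
rewrite /op_inv (adjointE Tb); apply: xget_unique => /=.
  by apply: l2_ext => y; rewrite adj_wcomp fiber_scaleE mulVKf// fiber_normC0.
move=> g <-; apply: l2_ext => y.
by rewrite fiber_scaleE adj_wcomp mulKf// fiber_normC0.
Qed.

End WeightedComposition.

(** * The wandering projection off a set stable under [phi] *)

Section Wandering.
Variables (R : realType) (X : choiceType).
Local Notation l2 := (l2 R X).
Local Notation e_ := (l2_basis R).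
Implicit Types (f g : l2) (x y : X).
Variables (phi : X -> X) (w : X -> R[i]) (T : l2 -> l2).
Hypothesis TE : is_wcomp phi w T.
Hypothesis Tb : linear_bounded T.
Variable c : R.
Hypothesis c0 : 0 < c.
Hypothesis Tc : forall f : l2, c * nrm f <= nrm (T f).
Variable B : set X.
Hypothesis Bphi : forall x, B x -> B (phi x).

Local Notation Ta := (adj T).
Local Notation T' := (cdual T).
Local Notation L := (linv T).
Local Notation Q := (restr (~` B)).

(* The orthogonal projection onto the wandering subspace of the restriction of
   [T] to l^2(~` B). For [B] the set of points of level at most 0 its range is
   the space E of the theorem, with or without a cycle. *)
Definition wproj (f : l2) : l2 := Q f - T' (Q (Ta f)).
Local Notation P := wproj.

Lemma wproj_lb : linear_bounded P.
Proof.
apply: lb_sub; first exact: restr_lb.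
apply: (lb_comp (cdual_lb Tb c0 Tc)).
exact: (lb_comp (@restr_lb R X _) (adj_lb Tb)).
Qed.

(** The adjoint of [T' Q T*] is [T Q L], and the two agree because the diagonal inverse of [T* T]
    commutes with the restriction [Q]. *)
Lemma hdot_wproj f g : hdot (P f) g = hdot f (P g).
Proof.
have TQL : T (Q (L g)) = T' (Q (Ta g)).
  rewrite /cdual /=; apply: (congr1 T); apply: l2_ext => x.
  rewrite (fiber_scaleE c0 Tc (Q (Ta g)) x) (restrE _ (L g)) (restrE _ (Ta g)).
  case: asboolP; rewrite ?mulr0// => _.
  exact: (linvE c0 Tc).
rewrite /wproj hdotBl hdotBr hdot_restr (hdot_cdual Tb c0 Tc) hdot_restr.
by rewrite -(adjEr Tb) TQL.
Qed.

Lemma wproj_vanish f x : B x -> P f x = 0.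
Proof.
move=> Bx; rewrite /wproj l2_addE l2_oppE restrE asboolF; last by move=> /(_ Bx).
rewrite (cdual_wcomp TE c0 Tc) restrE asboolF ?mulr0 ?subr0//.
by move=> /(_ (Bphi Bx)).
Qed.

(** Fibres over points off [B] lie off [B], so [T* Q f] and [T* f] agree there; the second term of
    [P f] cancels them since [T* T'] is the identity. *)
Lemma adj_wproj_vanish f y : ~ B y -> Ta (P f) y = 0.
Proof.
move=> By; rewrite /wproj (lbB _ _ (adj_lb Tb)) l2_addE l2_oppE.
rewrite (adj_cdual TE Tb c0 Tc) restrE asboolT//.
rewrite -(@adj_local _ _ _ _ _ TE Tb f y (~` B)) ?subrr// => x xy Bx.
by apply: By; rewrite -xy; exact: Bphi.
Qed.

Lemma wproj_id f : (forall x, B x -> f x = 0) ->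
  (forall y, ~ B y -> Ta f y = 0) -> P f = f.
Proof.
move=> fB Tf; rewrite /wproj; have -> : Q (Ta f) = 0 :> l2.
  by apply: l2_ext => x; rewrite restrE; case: asboolP => // /Tf.
rewrite -[f in RHS]subr0 (lb0 (cdual_lb Tb c0 Tc)); congr (_ - _).
by apply: l2_ext => x; rewrite restrE; case: asboolP => // /contrapT /fB.
Qed.

Lemma wprojP f : P f = f <->
  (forall x, B x -> f x = 0) /\ (forall y, ~ B y -> Ta f y = 0).
Proof.
split=> [<-|[fB Tf]]; last exact: wproj_id.
by split=> x; [exact: wproj_vanish|exact: adj_wproj_vanish].
Qed.

Lemma wproj_idem f : P (P f) = P f.
Proof.
by apply: wproj_id => x; [exact: wproj_vanish|exact: adj_wproj_vanish].
Qed.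

(** Since [T' Q T* T = T Q], one has [P T g = Q T g - T Q g]: only the edges leading from [B] out of
    [B] contribute. *)
Lemma wproj_wcomp g x :
  P (T g) x = if `[< ~ B x /\ B (phi x) >] then w x * g (phi x) else 0.
Proof.
rewrite /wproj l2_addE l2_oppE (cdual_wcomp TE c0 Tc) !restrE.
rewrite (adj_wcomp TE Tb) (dual_weightE TE) TE.
have [Bx|nBx] := pselect (B x).
  rewrite asboolF; last by move=> /(_ Bx).
  rewrite asboolF; last by move=> /(_ (Bphi Bx)).
  by rewrite mulr0 subr0 asboolF// => -[].
rewrite (asboolT nBx); have [Bpx|nBpx] := pselect (B (phi x)).
  rewrite asboolF; last by move=> /(_ Bpx).
  by rewrite mulr0 subr0 asboolT.
rewrite (asboolT nBpx) [X in if X then _ else _]asboolF; last by case.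
by rewrite mulrA divfK ?subrr// (fiber_normC0 c0 Tc).
Qed.

(** [T] preserves vanishing on [B], and [P T] only sees the values on [B]. So vectors living off [B]
    have no negative Laurent coefficients. *)
Lemma wproj_iter_off n f : (forall x, B x -> f x = 0) -> P (iter n.+1 T f) = 0.
Proof.
move=> fB; apply: l2_ext => x; rewrite iterS wproj_wcomp.
case: asboolP => // -[_ Bx]; suff -> : iter n T f (phi x) = 0 by rewrite mulr0.
elim: n (phi x) Bx => [|n IH] y By /=; first exact: fB.
exact: (wcomp_vanish TE Bphi IH).
Qed.

Lemma linv_on f : (forall x, ~ B x -> f x = 0) -> forall y, ~ B y -> L f y = 0.
Proof.
move=> fB y By; rewrite (linvE c0 Tc) (adj_vanish TE Tb) ?mulr0// => x xy.
by apply: fB => Bx; apply: By; rewrite -xy; exact: Bphi.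
Qed.

Lemma wproj_on f : (forall x, ~ B x -> f x = 0) -> P f = 0.
Proof.
move=> fB; have Q0 (g : l2) : (forall x, ~ B x -> g x = 0) -> Q g = 0 :> l2.
  by move=> g0; apply: l2_ext => x; rewrite restrE; case: asboolP => // /g0.
rewrite /wproj !Q0//; first by rewrite (lb0 (cdual_lb Tb c0 Tc)) subr0.
move=> y By; apply: (adj_vanish TE Tb) => x xy; apply: fB => Bx; apply: By.
by rewrite -xy; exact: Bphi.
Qed.

Lemma wproj_linv_on n f : (forall x, ~ B x -> f x = 0) -> P (iter n L f) = 0.
Proof.
move=> fB; apply: wproj_on; elim: n => [|n IH]//=.
exact: linv_on.
Qed.

(** For [f] in the range of [P], [L f] is supported in [B]; [L] preserves such supports and [P]
    annihilates them. *)
Lemma wproj_linv n f : P f = f -> P (iter n.+1 L f) = 0.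
Proof.
move=> /wprojP[_ Tf]; rewrite iterSr; apply: wproj_linv_on => y By.
by rewrite (linvE c0 Tc) Tf// mulr0.
Qed.

(** When [phi x] is off [B], [P] removes from [e_ x] exactly its orthogonal projection on the line
    of [T (e_ (phi x))]; otherwise [e_ x] is fixed. *)
Lemma basis_wproj x : ~ B x -> e_ x = P (e_ x) +
  (if `[< B (phi x) >] then 0
   else ((w x)^* / (fiber_norm T (phi x))%:C) *: T (e_ (phi x))).
Proof.
move=> Bx; have Qe y : Q (e_ y) = if `[< B y >] then 0 else e_ y.
  apply: l2_ext => z; rewrite restrE.
  have [->|zy] := eqVneq z y.
    by case: (asboolP (B y)) => By; case: asboolP => // nB; exfalso; apply: nB.
  have e0 : e_ y z = 0 by rewrite l2_basisE (negPf zy).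
  by case: (asboolP (B y)) => By; rewrite e0 if_same.
rewrite /wproj Qe (asboolF Bx) (adj_basis_basis TE Tb).
rewrite (lbZ _ _ (@restr_lb R X _)) Qe (lbZ _ _ (cdual_lb Tb c0 Tc)).
case: asboolP => _; first by rewrite (lb0 (cdual_lb Tb c0 Tc)) scaler0 subr0 addr0.
rewrite -[LHS]addr0 -[in LHS](subrr ((w x)^* *: T' (e_ (phi x)))) addrA addrAC.
congr (_ + _); rewrite -scalerA; congr (_ *: _).
rewrite /cdual /= -(lbZ _ _ Tb); congr T; apply: l2_ext => y.
rewrite (fiber_scaleE c0 Tc) l2_scaleE l2_basisE.
by case: eqP => [->//|]; rewrite !mulr0.
Qed.

End Wandering.

(** * Level functions *)

Section Levels.
Variables (X : choiceType) (phi : X -> X).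
Local Notation periodic := Defs.periodic.
Implicit Types (x y p : X) (l : X -> int).

Lemma periodic_iter n x : periodic phi x -> periodic phi (iter n phi x).
Proof.
by move=> [i i0 ix]; exists i => //; rewrite -iterD addnC iterD ix.
Qed.

Lemma cycle_setE x : cycle_set phi x <-> periodic phi x.
Proof.
split=> [[p pp [i _ <-]]|px]; first exact: periodic_iter.
by exists x => //; exists 0%N.
Qed.

Lemma iter_period i k x : iter i phi x = x -> iter (k * i) phi x = x.
Proof. by move=> ix; elim: k => // k IH; rewrite mulSn iterD IH. Qed.

Lemma acyclic_inj x : ~ has_cycle phi -> injective (fun n => iter n phi x).
Proof.
move=> nc; suff le m n : (m < n)%N -> iter m phi x <> iter n phi x.
  move=> m n /= mn; have [/le|/le|//] := ltngtP m n; first by rewrite mn.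
  by rewrite mn.
move=> mn e; apply: nc; exists (iter m phi x), (n - m)%N; first by rewrite subn_gt0.
by rewrite -iterD subnK ?(ltnW mn).
Qed.

Hypothesis orb : single_orbit phi.

Lemma orbit_merge x y : exists i j, iter i phi x = iter j phi y.
Proof.
have [x0 x0T] := orb.
have [a [b ab]] : orbit_of phi x0 x by rewrite x0T.
have [c [d cd]] : orbit_of phi x0 y by rewrite x0T.
exists (c + b)%N, (a + d)%N.
by rewrite iterD -ab -iterD addnC iterD cd -iterD.
Qed.

Lemma reach_cycle x : has_cycle phi -> exists n, periodic phi (iter n phi x).
Proof.
move=> [p pp]; have [i [j ij]] := orbit_merge x p.
by exists i; rewrite ij; exact: periodic_iter.
Qed.

(** With a cycle the level is the number of steps needed to reach it. Without one it is [i - j]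
    whenever [phi^i x = phi^j xs]; this is well defined because the iterates of [xs] are pairwise
    distinct. *)
Lemma is_level_exists xs : exists l, is_level phi xs l.
Proof.
have [hc|nc] := pselect (has_cycle phi).
  have rc x : exists n, `[< periodic phi (iter n phi x) >].
    by have [n] := reach_cycle x hc; exists n; apply/asboolP.
  exists (fun x => (ex_minn (rc x))%:Z); split => //.
    move=> x /cycle_setE px; case: ex_minnP => n _ /(_ 0%N).
    by move=> /(_ (asboolT px)); rewrite leqn0 => /eqP ->.
  move=> x npx; case: ex_minnP => n /asboolP pn n_min.
  case: ex_minnP => -[|m] /asboolP pm m_min.
    by case: npx; apply/cycle_setE.
  have nm : (n <= m)%N by apply: n_min; apply/asboolP; rewrite -iterSr.
  have mn : (m.+1 <= n.+1)%N by apply: m_min; apply/asboolP; rewrite iterSr.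
  have -> : n = m by lia.
  lia.
pose r x (v : int) := exists i j, iter i phi x = iter j phi xs /\ v = i%:Z - j%:Z.
have rex x : exists v, r x v.
  by have [i [j ij]] := orbit_merge x xs; exists (i%:Z - j%:Z), i, j.
have runiq x v v' : r x v -> r x v' -> v = v'.
  move=> [i [j [ij ->]]] [i' [j' [ij' ->]]].
  have : iter (i' + j) phi xs = iter (i + j') phi xs.
    by rewrite !iterD -ij -ij' -!iterD addnC.
  move/(acyclic_inj nc); lia.
exists (fun x => xget 0 (r x)); split => [x /cycle_setE px|_|x _].
- by case: nc; exists x.
- have r0 : r xs 0 by exists 0%N, 0%N.
  by apply: xget_unique => // v /runiq; exact.
- have [i [j [ij vE]]] : r x (xget 0 (r x)) by apply: xgetPex; exact: rex.
  have r1 : r (phi x) (xget 0 (r x) - 1).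
    exists i, j.+1; rewrite -iterSr iterS ij; split=> //.
    by rewrite vE; lia.
  by apply: xget_unique => // v /runiq; exact.
Qed.

Lemma levelP xs : is_level phi xs (level phi xs).
Proof. by apply: xgetPex; exact: is_level_exists. Qed.

Section OneLevel.
Variables (xs : X) (l : X -> int).
Hypothesis lP : is_level phi xs l.

Lemma level_periodic x : periodic phi x -> l x = 0.
Proof. by case: lP => l0 _ _ /cycle_setE; exact: l0. Qed.

Lemma level_phi x : ~ periodic phi x -> l (phi x) = l x - 1.
Proof. by case: lP => _ _ l1 npx; apply: l1 => /cycle_setE. Qed.

(** Induction on the number of steps to the cycle: a step from a point off the cycle lowers the
    level by exactly one, so such a point has level at least 1. *)
Lemma level_cycle x n : periodic phi (iter n phi x) ->
  0 <= l x /\ (l x <= 0 -> periodic phi x).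
Proof.
elim: n x => [|n IH] x px; first by rewrite (level_periodic px).
have [px'|npx] := pselect (periodic phi x); first by rewrite (level_periodic px').
by have := IH (phi x); rewrite -iterSr => /(_ px); rewrite level_phi//; lia.
Qed.

Lemma level_le0_periodic x : has_cycle phi -> l x <= 0 -> periodic phi x.
Proof. by move=> /(reach_cycle x)[n /level_cycle[]]. Qed.

Lemma level_phi_pos x : 0 < l x -> l (phi x) = l x - 1.
Proof. by move=> lx; apply: level_phi => /level_periodic lx0; rewrite lx0 in lx. Qed.

Lemma level_phi_le0 x : l x <= 0 -> l (phi x) <= 0.
Proof.
move=> lx; have [px|npx] := pselect (periodic phi x).
  by rewrite level_periodic//; exact: (periodic_iter 1).
by rewrite level_phi//; lia.
Qed.

Lemma level_acyclic n x : ~ has_cycle phi -> l (iter n phi x) = l x - n%:Z.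
Proof.
move=> nc; elim: n => [|n IH]; first by rewrite subr0.
rewrite iterS level_phi; first by rewrite IH; lia.
by move=> px; apply: nc; exists (iter n phi x).
Qed.

Lemma level_reach (k : int) x : 0 <= k <= l x ->
  exists n, l (iter n phi x) = k.
Proof.
elim: `|l x - k|%N {-2}x (erefl `|l x - k|%N) => [|n IH] y yn yk.
  by exists 0%N => /=; lia.
have [m ym] : exists m, l (iter m phi (phi y)) = k.
  by apply: IH; rewrite level_phi_pos; lia.
by exists m.+1; rewrite iterSr.
Qed.

End OneLevel.

(** Carries the bound on branching levels from the unspecified base point of the finite branching
    index to the normalization at [phi om]. *)
Lemma level_diff xs l xs' l' : is_level phi xs l -> is_level phi xs' l' ->
  exists d, forall x, l' x = l x + d.
Proof.
move=> lP lP'; have [hc|nc] := pselect (has_cycle phi).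
  exists 0 => x; rewrite addr0; have [n] := reach_cycle x hc.
  elim: n x => [|n IH] x px.
    by rewrite (level_periodic lP px) (level_periodic lP' px).
  have [px'|npx] := pselect (periodic phi x).
    by rewrite (level_periodic lP px') (level_periodic lP' px').
  have := IH (phi x); rewrite -iterSr => /(_ px).
  by rewrite (level_phi lP)// (level_phi lP')//; lia.
exists (l' xs - l xs) => x; have [i [j ij]] := orbit_merge x xs.
have := level_acyclic lP i x nc; have := level_acyclic lP' i x nc.
by rewrite ij !(level_acyclic lP)// !(level_acyclic lP')//; lia.
Qed.

Section GeneralizedRoot.
Variable om : X.
Hypothesis omP : ~ has_cycle phi -> generalized_root phi om.
Local Notation l := (level phi (phi om)).
Local Notation lP := (levelP (phi om)).

Lemma level_root : ~ has_cycle phi -> l om = 1.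
Proof.
move=> nc; have := level_acyclic lP 1 om nc; have [_ /(_ nc) + _] := lP.
by rewrite /= => ->; lia.
Qed.

(** If [x] and [om] merge after [i] and [j] steps, the levels give [j = i + n]; uniqueness of the
    preimages of the proper iterates of [om] then undoes the [i] steps one by one. *)
Lemma level_le1 x : ~ has_cycle phi -> l x <= 1 ->
  exists2 n, x = iter n phi om & l x = 1 - n%:Z.
Proof.
move=> nc lx; have [ou _] := omP nc.
have [n nE] : exists n : nat, l x = 1 - n%:Z by exists `|1 - l x|%N; lia.
exists n => //; have [i [j ij]] := orbit_merge x om.
have jE : j = (i + n)%N.
  have := level_acyclic lP i x nc; have := level_acyclic lP j om nc.
  by rewrite ij level_root// nE; lia.
rewrite {}jE in ij; elim: i ij => [//|i IH] e; apply: IH.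
have [y [_ yu]] := ou (i.+1 + n)%N isT.
by transitivity y; [apply/esym/yu|apply: yu].
Qed.

Lemma acyclic_unbranched x y : ~ has_cycle phi -> l y <= 0 -> phi x = y ->
  forall u, phi u = y -> u = x.
Proof.
move=> nc ly xy u uy; have [ou _] := omP nc.
have [n yE nE] : exists2 n, y = iter n phi om & l y = 1 - n%:Z.
  by apply: level_le1 => //; lia.
have n0 : (0 < n)%N by lia.
have [z [_ zu]] := ou n n0; rewrite -yE in zu.
by transitivity z; [apply/esym/zu|apply: zu].
Qed.

Lemma branching_bound : finite_branching_index phi ->
  exists n : nat, forall x, branching phi x -> l x <= n%:Z.
Proof.
move=> [xs [n nP]]; have [d dP] := level_diff (levelP xs) lP.
exists (n + `|d|)%N => x /nP; rewrite dP; lia.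
Qed.

End GeneralizedRoot.

Lemma cycle_cardE (s : seq X) : uniq s -> cycle_set phi = [set` s] ->
  cycle_card phi = size s.
Proof.
move=> us cs; rewrite /cycle_card cs; apply/esym/perm_size/uniq_perm => // x.
rewrite in_fset_set; last exact: finite_seq.
by apply/idP/idP => [xs|/set_mem//]; exact/mem_set.
Qed.

(** [t] is the least period of [p], which makes the enumeration duplicate free. *)
Lemma cycle_enum : has_cycle phi -> exists (p : X) (t : nat),
  let s := mkseq (fun i => iter i phi p) t in
  [/\ (0 < t)%N, iter t phi p = p, uniq s & cycle_set phi = [set` s]].
Proof.
move=> [p pp]; have ex : exists i, (0 < i)%N && (iter i phi p == p).
  by have [i i0 /eqP ip] := pp; exists i; rewrite i0.
have [t /andP[t0 /eqP tp] tmin] := ex_minnP ex.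
exists p, t; split => //.
  apply/mkseq_uniqP => a b; rewrite !inE.
  suff le m n : (m < n)%N -> (n < t)%N -> iter m phi p <> iter n phi p.
    have [/le h|/le h|//] := ltngtP a b; first by move=> _ /h h' /h'.
    by move=> /h h' _ /esym/h'.
  move=> mn nt e; have : (t <= t - n + m)%N.
    apply: tmin; apply/andP; split; first by lia.
    by rewrite iterD e -iterD subnK ?(ltnW nt)// tp.
  lia.
apply/seteqP; split=> x /=.
  move=> /cycle_setE[c c0 cx]; have [i [j ij]] := orbit_merge x p.
  (* [x] has period [c]: after the [i] steps to the merging point, [i * c - i] more complete [i]
     full periods. *)
  have xE : x = iter (i * c - i + j) phi p.
    by rewrite iterD -ij -iterD subnK ?leq_pmulr// iter_period.
  have pm a : iter a phi p = iter (a %% t) phi p.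
    by rewrite {1}(divn_eq a t) addnC iterD iter_period.
  rewrite xE pm; apply/mapP; exists ((i * c - i + j) %% t)%N => //.
  by rewrite mem_iota/= add0n ltn_mod.
move=> /mapP[i _ ->]; apply/cycle_setE; apply: periodic_iter.
by exists t.
Qed.

(* The points of level 0: the cycle, or the parent of the generalized root. *)
Lemma level0_finite om : (~ has_cycle phi -> generalized_root phi om) ->
  exists s : seq X, forall x, level phi (phi om) x = 0 <-> x \in s.
Proof.
move=> omP; have lP := levelP (phi om); have [hc|nc] := pselect (has_cycle phi).
  have [p [t [_ _ _ /seteqP[cs sc]]]] := cycle_enum hc.
  exists (mkseq (fun i => iter i phi p) t) => x; split.
    move=> lx; apply: cs; apply/cycle_setE.
    by apply: (level_le0_periodic lP) => //; rewrite lx.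
  by move=> /sc/cycle_setE/(level_periodic lP).
exists [:: phi om] => x; rewrite inE; have lom := level_root om nc.
have lph : level phi (phi om) (phi om) = 0.
  by have := level_acyclic lP 1 om nc; rewrite lom.
split=> [lx|/eqP -> //]; apply/eqP.
have [|[|[|n]]] := @level_le1 om omP x nc; first by rewrite lx.
- by rewrite lx.
- by [].
- by rewrite lx => _; lia.
Qed.

End Levels.

(** * The space E and the radii of convergence *)

Lemma closed_preimage_lb (R : realType) (V W : normedModType R[i]) (P : V -> W)
    (S : set W) : linear_bounded P -> closed S -> closed (P @^-1` S).
Proof.
move=> Pb Sc f /closure_nrmP fP /=; have [M M0 PM] := Pb.2.
apply: Sc; apply/closure_nrmP => e e0.
have M1 : 0 < M + 1 by rewrite ltr_wpDl.
have [g gP fg] := fP _ (divr_gt0 e0 M1); exists (P g) => //.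
rewrite -(lbB _ _ Pb) (le_lt_trans (PM _))// -[e](divfK (lt0r_neq0 M1)) mulrC.
rewrite (@le_lt_trans _ _ (nrm (f - g) * (M + 1)))//.
  by rewrite ler_wpM2l ?nrm_ge0// lerDl.
by rewrite ltr_pM2r.
Qed.

Lemma bounded_op_lb (R : realType) (V W : hilbertType R) (T : V -> W) :
  bounded_op setT setT T -> linear_bounded T.
Proof.
move=> [_ Tl [M TM]]; split; first by move=> c x y; exact: Tl.
exists `|M| => // x; rewrite -lecR rmorphM/= -!nrmE.
by rewrite (le_trans (TM x I))// ler_wpM2r// lecR ler_norm.
Qed.

Lemma lb_bounded_op (R : realType) (V : hilbertType R) (E : set V) (T : V -> V) :
  linear_bounded T -> (forall x, E (T x)) -> bounded_op E E T.
Proof.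
move=> [Tl [M M0 TM]] TE; split => [//|c x y _ _|]; first exact: Tl.
by exists M => x _; rewrite !nrmE -rmorphM lecR.
Qed.

Lemma left_invertible_below (R : realType) (V : hilbertType R) (T : V -> V) :
  left_invertible T -> exists2 c : R, 0 < c & forall f, c * nrm f <= nrm (T f).
Proof.
move=> [L /bounded_op_lb[_ [M M0 LM]] LT].
have M1 : 0 < M + 1 by rewrite ltr_wpDl.
exists (M + 1)^-1; first by rewrite invr_gt0.
move=> f; rewrite ler_pdivrMl// -{1}(LT f) (le_trans (LM _))//.
by rewrite ler_wpM2r ?nrm_ge0// lerDl.
Qed.

Section SpaceE.
Variables (R : realType) (X : choiceType).
Local Notation l2 := (l2 R X).
Local Notation e_ := (l2_basis R).
Implicit Types (f g : l2) (x y : X).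
Variables (phi : X -> X) (w : X -> R[i]) (T : l2 -> l2) (om : X).
Hypothesis orb : single_orbit phi.
Hypothesis fin_branch : finite_branching_index phi.
Hypothesis omP : ~ has_cycle phi -> generalized_root phi om.
Hypothesis TE : is_wcomp phi w T.
Hypothesis Tb : linear_bounded T.
Variable c : R.
Hypothesis c0 : 0 < c.
Hypothesis Tc : forall f : l2, c * nrm f <= nrm (T f).

Local Notation l := (level phi (phi om)).
Local Notation lP := (levelP orb (phi om)).

(** This is the cycle itself or, without a cycle, the set of the proper iterates of [om]. *)
Definition lower : set X := [set x | l x <= 0].
Local Notation B := lower.
Local Notation P := (wproj T B).

Lemma lower_phi x : B x -> B (phi x).
Proof. exact: (level_phi_le0 lP). Qed.

Lemma not_lower x : ~ B x -> 1 <= l x.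
Proof. by move=> /negP; rewrite -ltNge gtz0_ge1. Qed.

Local Notation Pb := (wproj_lb Tb c0 Tc B).

Lemma unbranched_weight_neq0 x : (forall u, phi u = phi x -> u = x) -> w x != 0.
Proof. by move=> ux; have [u /ux ->] := phi_surj TE c0 Tc (phi x). Qed.

(** The adjoint of a restriction is the compression of the adjoint; uniqueness of the representing
    vector settles the choice made in [adjoint_on]. *)
Lemma adjoint_onE (M : set X) f :
  adjoint_on (l2_on M) T f = restr M (adj T f).
Proof.
have rM g : l2_on M (restr M g).
  by apply/l2_onP => x Mx; rewrite restrE asboolF.
have rid g : l2_on M g -> restr M g = g.
  move=> /l2_onP gM; apply: l2_ext => x; rewrite restrE.
  by case: asboolP => // /gM ->.
apply: xget_unique.
  by split=> // g gM; rewrite (adjE Tb) -hdot_restr rid.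
move=> z [zM zP]; apply/eqP; rewrite -subr_eq0; apply/eqP; apply: hdot_eq0 => v.
have zr : z - restr M (adj T f) = restr M (z - restr M (adj T f)).
  by rewrite (lbB _ _ (@restr_lb R X M)) (rid z zM) (rid (restr M (adj T f))).
rewrite zr hdot_restr hdotBl (hdotC z) -zP// (adjE Tb).
by rewrite (hdot_restr M (adj T f)) (rid (restr M v))// (hdotC (adj T f)) subrr.
Qed.

(** The generators of E are fixed by [P], since [Des x] avoids the cycle and contains the fibres
    over its points. Conversely the vectors [P (e_ x)] generate the range of [P]: each is 0, or
    [e_ x] at level 1, or, at higher level, lies in the kernel attached to the ancestor of [x] at
    level 1. *)
Lemma spaceE_cycle : has_cycle phi ->
  spaceE phi om T = [set f | P f = f].
Proof.
move=> hc; rewrite /spaceE asboolT//; set G := (G in closed_span G).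
have DesB x : l x = 1 -> forall y, Des phi x y -> ~ B y.
  move=> lx y [n _ /= yn] By.
  suff : B (iter n phi y) by rewrite yn /lower /= lx.
  by elim: n {yn} => //= n; exact: lower_phi.
apply/seteqP; split.
  apply: closed_span_min.
  - by rewrite /= (lb0 Pb).
  - by move=> a u v /= uP vP; rewrite Pb.1 uP vP.
  - exact: closed_fixpoints Pb.
  move=> f [[x /= x1 <-]|[x /= x1 [fD]]].
    have lx : l x = 1 by move: x1; rewrite /Gen /=; lia.
    have nBx : ~ B x by rewrite /lower /= lx.
    have := basis_wproj TE Tb c0 Tc nBx; rewrite asboolT ?addr0 => [<-//|].
    by rewrite /lower /= (level_phi_pos lP) lx.
  have lx : l x = 1 by move: x1; rewrite /Gen /=; lia.
  rewrite adjoint_onE => /(congr1 (fun g : l2 => l2_fun g)) af.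
  rewrite /=; apply: (wproj_id Tb c0 Tc) => [y By|y nBy].
    by move/l2_onP : fD; apply => /(DesB x lx).
  have [Dy|nDy] := pselect (Des phi x y).
    by have := congr1 (@^~ y) af; rewrite /= restrE asboolT.
  apply: (adj_vanish TE Tb) => u uy; move/l2_onP : fD; apply => -[[|n] _ /= un].
    by apply: nBy; rewrite -uy un /lower /= (level_phi_pos lP) lx.
  by apply: nDy; exists n => //=; rewrite -uy -iterSr.
(* Writing [f] as [P f] reduces the claim to the vectors [P (e_ x)]. *)
move=> f /= fP; rewrite -fP.
suff : [set g | closed_span G (P g)] f by [].
apply: l2_span_basis => /=.
- by rewrite (lb0 Pb); exact: closed_span0.
- by move=> a u v uP vP; rewrite Pb.1; exact: closed_span_lin.
- exact: (closed_preimage_lb Pb (@closed_span_closed R l2 G)).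
move=> x _; have [Bx|nBx] := pselect (B x).
  rewrite (wproj_on TE Tb c0 Tc lower_phi); first exact: closed_span0.
  move=> y nBy; by rewrite l2_basisE; case: eqP => // yx; rewrite yx in nBy.
have lx := not_lower nBx; have lpx := level_phi_pos lP (lx : 0 < l x).
have := basis_wproj TE Tb c0 Tc nBx; have [Bpx|nBpx] := pselect (B (phi x)).
  rewrite asboolT// addr0 => <-; apply: closed_span_sub; left.
  by exists x => //; move: Bpx; rewrite /lower /Gen /= lpx; lia.
rewrite asboolF// => ex; have [|n xn] := level_reach lP (k := 1) (x := x).
  by rewrite lx.
have Dx : Des phi (iter n phi x) x by exists n.
have n0 : (0 < n)%N.
  rewrite lt0n; apply/eqP => nz; rewrite nz /= in xn; apply: nBpx.
  by rewrite /lower /= lpx xn.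
have Dpx u : phi u = phi x -> Des phi (iter n phi x) u.
  by move=> ux; exists n => //=; rewrite -(prednK n0) !iterSr ux.
apply: closed_span_sub; right; exists (iter n phi x); first by rewrite /Gen /= xn.
split.
  apply/l2_onP => y Dy; have -> : P (e_ x) = e_ x -
      ((w x)^* / (fiber_norm T (phi x))%:C) *: T (e_ (phi x)).
    by rewrite [X in _ = X - _]ex addrK.
  rewrite l2_addE l2_oppE l2_scaleE (wcomp_basis TE) l2_basisE.
  case: eqP => [yx|_]; first by case: Dy; apply: Dpx; rewrite yx.
  case: eqP => [/Dpx//|_]; by rewrite !mulr0 subr0.
rewrite adjoint_onE; apply: l2_ext => y; rewrite restrE; case: asboolP => // Dy.
by apply: (adj_wproj_vanish TE Tb c0 Tc lower_phi); exact: DesB Dy.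
Qed.

(** Over points of [B] the fibres are single points with nonzero weight. So [T* g = 0] forces [g] to
    vanish on [B], and for [f] in the range of [P] the only obstruction to [T* f = 0] is the value
    at [om], removed by subtracting [f om *: e_ om]. *)
Lemma spaceE_acyclic : ~ has_cycle phi ->
  spaceE phi om T = [set f | P f = f].
Proof.
move=> nc; rewrite /spaceE asboolF//; have lom := level_root orb om nc.
have lph x : l (phi x) = l x - 1 by exact: (level_acyclic lP 1 x nc).
have eom y : l y <> 1 -> e_ om y = 0 :> R[i].
  by move=> ly; rewrite l2_basisE; case: eqP => // yom; rewrite yom in ly.
have aeom y : ~ B y -> adj T (e_ om) y = 0.
  move=> nBy; rewrite (adj_basis_basis TE Tb) l2_scaleE l2_basisE.
  case: eqP => [yom|_]; last by rewrite mulr0.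
  by case: nBy; rewrite yom /lower /= lph lom.
apply/seteqP; split=> [f [a [g [ag ->]]]|f /= fP].
  rewrite (adjointE Tb) in ag.
  rewrite /=; apply: (wproj_id Tb c0 Tc) => [x Bx|y nBy]; last first.
    by rewrite (adj_lb Tb).1 ag addr0 l2_scaleE aeom ?mulr0.
  rewrite l2_addE l2_scaleE eom ?mulr0 ?add0r; last first.
    by move=> lx; move: Bx; rewrite /lower /= lx.
  have ux : forall u, phi u = phi x -> u = x.
    apply: (acyclic_unbranched orb omP nc) => //.
    by move: Bx; rewrite /lower /= lph; lia.
  have := adj_single TE Tb g ux; rewrite ag => /esym/eqP.
  by rewrite mulf_eq0 conjc_eq0 (negPf (unbranched_weight_neq0 ux)) => /eqP.
move: fP => /(wprojP TE Tb c0 Tc lower_phi)[fB af].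
exists (f om), (f - f om *: e_ om); split; last by rewrite addrC subrK.
rewrite (adjointE Tb); apply: l2_ext => y; have [By|nBy] := pselect (B y).
  apply: (adj_vanish TE Tb) => u uy.
  have lu : l u <= 1 by move: By; rewrite /lower /= -uy lph; lia.
  rewrite l2_addE l2_oppE l2_scaleE.
  have [n un un'] := level_le1 orb omP nc lu.
  case: n un un' => [->|n _ lu'].
    by rewrite l2_basisE eqxx mulr1 subrr.
  rewrite eom ?mulr0 ?subr0 ?fB// /lower /=; lia.
by rewrite (lbB _ _ (adj_lb Tb)) (lbZ _ _ (adj_lb Tb)) l2_addE l2_oppE l2_scaleE
  aeom// mulr0 subr0 af.
Qed.

Lemma spaceE_wproj : spaceE phi om T = [set f | P f = f].
Proof.
by have [hc|nc] := pselect (has_cycle phi);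
  [exact: spaceE_cycle|exact: spaceE_acyclic].
Qed.

(** Above the last branching level each fibre is a single point with nonzero weight, so [T* f = 0]
    kills [f] there. The bound is [n.+1] because the children of a vertex of level [n] have level
    [n + 1]. This makes the minimum defining k exist. *)
Lemma wproj_supp : exists n : nat, forall f, P f = f -> l2_on (Gen phi om 1 n%:Z) f.
Proof.
have [n nP] := branching_bound orb om fin_branch; exists n.+1 => f.
move=> /(wprojP TE Tb c0 Tc lower_phi)[fB af]; apply/l2_onP => x nG.
have [Bx|nBx] := pselect (B x); first exact: fB.
have lx := not_lower nBx.
have lxn : n.+1%:Z < l x by rewrite ltNge; apply/negP => h; apply: nG; rewrite /Gen /= lx.
have lpx := level_phi_pos lP (lx : 0 < l x).
have ux u : phi u = phi x -> u = x.
  move=> ux; apply: contrapT => nux; have : branching phi (phi x) by exists u, x.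
  by move=> /nP; rewrite lpx; lia.
have := adj_single TE Tb f ux; rewrite af; last by rewrite /lower /= lpx; lia.
by move/esym/eqP; rewrite mulf_eq0 conjc_eq0 (negPf (unbranched_weight_neq0 ux)) => /eqP.
Qed.

Lemma indexE_supp f : P f = f -> l2_on (Gen phi om 1 (indexE phi om T)%:Z) f.
Proof.
have [n nP] := wproj_supp.
have ex : exists n, `[< spaceE phi om T `<=` l2_on (Gen phi om 1 n%:Z) >].
  by exists n; apply/asboolP; rewrite spaceE_wproj.
have [k /asboolP kP kmin] := ex_minnP ex.
have [] : [set n : nat | spaceE phi om T `<=` l2_on (Gen phi om 1 n%:Z) /\
    forall m : nat, spaceE phi om T `<=` l2_on (Gen phi om 1 m%:Z) -> (n <= m)%N]
    (indexE phi om T).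
  apply: xgetPex; exists k; split=> // m mP; apply: kmin; exact/asboolP.
by rewrite spaceE_wproj => + _ fP; exact.
Qed.

End SpaceE.

(** * From radii to geometric bounds *)

Section EventualBounds.
Variable R : realType.

Lemma limn_esup_lt (u : (\bar R)^nat) y : (limn_esup u < y)%E ->
  exists N, forall n, (N <= n)%N -> (u n < y)%E.
Proof.
move=> /ereal_inf_lt[_ [V [N _ NV] <-] Vy]; exists N => n Nn.
by apply: le_lt_trans Vy; apply: ereal_sup_ubound; exists n => //; exact: NV.
Qed.

Lemma limn_einf_gt (u : (\bar R)^nat) y : (y < limn_einf u)%E ->
  exists N, forall n, (N <= n)%N -> (y < u n)%E.
Proof.
rewrite /limn_einf lteNr => /limn_esup_lt[N NP].
by exists N => n /NP; rewrite lteN2.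
Qed.

Lemma eventual_geometric_bound (a : nat -> R) (s : R) N : 0 < s ->
  (forall n, 0 <= a n) ->
  (forall n, (N <= n)%N -> a n <= s ^+ n) ->
  exists2 C, 0 <= C & forall n, a n <= C * s ^+ n.
Proof.
move=> s0 a0 aN; exists (1 + \sum_(i < N) a i / s ^+ i).
  by rewrite addr_ge0// sumr_ge0// => i _; rewrite divr_ge0// exprn_ge0// ltW.
move=> n; have sn0 : 0 < s ^+ n by exact: exprn_gt0.
have S0 (P : pred 'I_N) : 0 <= \sum_(i < N | P i) a i / s ^+ i.
  by rewrite sumr_ge0// => i _; rewrite divr_ge0// exprn_ge0// ltW.
rewrite mulrDl mul1r; have [nN|Nn] := ltnP n N; last first.
  by rewrite (le_trans (aN _ Nn))// lerDl mulr_ge0// ltW.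
rewrite -[leLHS]add0r lerD ?(ltW sn0)// -ler_pdivrMr// (bigD1 (Ordinal nN))//= lerDl.
exact: S0.
Qed.

(** The constant covers one period of indices; larger indices descend by steps of [t]. *)
Lemma periodic_geometric_bound (a : nat -> R) (s : R) t : 0 < s -> (0 < t)%N ->
  (forall n, 0 <= a n) ->
  (forall n, a (n + t)%N <= a n * s ^+ t) ->
  exists2 C, 0 <= C & forall n, a n <= C * s ^+ n.
Proof.
move=> s0 t0 a0 at_; exists (\sum_(i < t) a i / s ^+ i).
  by rewrite sumr_ge0// => i _; rewrite divr_ge0// exprn_ge0// ltW.
elim/ltn_ind => n IH; have [nt|tn] := ltnP n t.
  rewrite -ler_pdivrMr ?exprn_gt0// (bigD1 (Ordinal nt))//= lerDl.
  by rewrite sumr_ge0// => i _; rewrite divr_ge0// exprn_ge0// ltW.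
rewrite -(subnK tn) (le_trans (at_ _))// exprD mulrA.
rewrite ler_wpM2r ?exprn_ge0 ?(ltW s0)// IH// ltn_subLR//.
by rewrite -{1}[n]add0n ltn_add2r.
Qed.

Lemma powR_root_le (a s : R) n : (0 < n)%N -> 0 <= a ->
  a `^ n%:R^-1 <= s -> a <= s ^+ n.
Proof.
move=> n0 a0 h; have n0' : n%:R != 0 :> R by rewrite pnatr_eq0 -lt0n.
rewrite -[a]powRr1// -(mulVf n0') powRrM powR_mulrn ?powR_ge0//.
by rewrite lerXn2r// nnegrE ?powR_ge0// (le_trans (powR_ge0 _ _) h).
Qed.

(** An infinite [S] would have an infinite root, whose inverse 0 cannot exceed [r]; so [S] is finite
    and real powers apply. *)
Lemma poweR_root_inv_le (S : \bar R) (r : R) n : (0 < n)%N -> 0 < r ->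
  (0 <= S)%E -> (r%:E < (S `^ n%:R^-1)^-1)%E -> (S <= (r^-1 ^+ n)%:E)%E.
Proof.
move=> n0 r0 S0; rewrite inve_pgt ?inE ?lee_fin ?(ltW r0) ?poweR_ge0//.
rewrite inver gt_eqF// => h.
have n0' : n%:R^-1 != 0 :> R by rewrite invr_eq0 pnatr_eq0 -lt0n.
have : (S < +oo)%E by apply: (lty_poweRy n0'); exact: lt_trans h (ltry _).
move: S S0 h => [a|//|//]; rewrite lee_fin poweR_EFin lte_fin => a0 h _.
by rewrite lee_fin powR_root_le// ltW.
Qed.

End EventualBounds.

Lemma lb_iter_norm (R : realType) (V : normedModType R[i]) (T : V -> V) (M : R) :
  0 <= M -> (forall x, nrm (T x) <= M * nrm x) ->
  forall n x, nrm (iter n T x) <= M ^+ n * nrm x.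
Proof.
move=> M0 TM n x; elim: n => [|n IH]; first by rewrite expr0 mul1r.
by rewrite iterS (le_trans (TM _))// exprS -mulrA ler_wpM2l.
Qed.

(** Test on [h = A' g]: [nrm h ^+ 2 = hdot (A h) g] is at most [K * nrm h * nrm g]. *)
Lemma adjoint_norm_le (R : realType) (V : hilbertType R) (A A' : V -> V) (K : R) :
  0 <= K -> (forall f g, hdot (A f) g = hdot f (A' g)) ->
  (forall f, nrm (A f) <= K * nrm f) -> forall g, nrm (A' g) <= K * nrm g.
Proof.
move=> K0 AA' AK g; set h := A' g.
have [->|h0] := eqVneq (nrm h) 0; first by rewrite mulr_ge0 ?nrm_ge0.
have hp : 0 < nrm h by rewrite lt_def h0 nrm_ge0.
rewrite -(ler_pM2l hp) -expr2 -lecR -hdot_sqr -AA'.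
have : normc (hdot (A h) g) <= nrm (A h) * nrm g := hdot_le _ _.
have -> : hdot (A h) g = (nrm h ^+ 2)%:C by rewrite AA' hdot_sqr.
rewrite lecR /= expr0n addr0 sqrtr_sqr ger0_norm ?sqr_ge0// => H.
by apply: le_trans H _; rewrite [leRHS]mulrCA mulrA ler_wpM2r ?nrm_ge0.
Qed.

Lemma iter_hdot (R : realType) (V : hilbertType R) (A A' : V -> V) n :
  (forall f g, hdot (A f) g = hdot f (A' g)) ->
  forall f g, hdot (iter n A f) g = hdot f (iter n A' g).
Proof. by move=> AA' f; elim: n => // n IH g; rewrite iterS AA' IH -iterSr. Qed.

Section Radii.
Variables (R : realType) (X : choiceType).
Local Notation l2 := (l2 R X).
Local Notation e_ := (l2_basis R).
Implicit Types (f g : l2) (x y : X).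
Variables (phi : X -> X) (w : X -> R[i]) (T : l2 -> l2) (om : X).
Hypothesis orb : single_orbit phi.
Hypothesis fin_branch : finite_branching_index phi.
Hypothesis omP : ~ has_cycle phi -> generalized_root phi om.
Hypothesis TE : is_wcomp phi w T.
Hypothesis Tb : linear_bounded T.
Variable c : R.
Hypothesis c0 : 0 < c.
Hypothesis Tc : forall f : l2, c * nrm f <= nrm (T f).

Local Notation l := (level phi (phi om)).
Local Notation lP := (levelP orb (phi om)).
Local Notation B := (lower phi om).
Local Notation P := (wproj T B).
Local Notation Pb := (wproj_lb Tb c0 Tc B).
Local Notation T' := (cdual T).
Local Notation L := (linv T).
Local Notation Bphi := (lower_phi orb).

(** [T'^n g] at [x] is a product of [n] dual weights times [g (phi^n x)]. The support of [g]
    confines [x] to [W_n], and each value of [g] is at most its norm. *)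
Lemma nrm_iter_cdual_le n (s : R) g : 0 <= s ->
  (\esum_(x in Wset phi om T n)
      (normc (\prod_(i < n) dual_weight phi w (iter i phi x)) ^+ 2)%:E <= (s ^+ 2)%:E)%E ->
  l2_on (Gen phi om 1 (indexE phi om T)%:Z) g ->
  nrm (iter n T' g) <= s * nrm g.
Proof.
move=> s0 Ss /l2_onP gG.
have T'E x : iter n T' g x =
    (\prod_(i < n) dual_weight phi w (iter i phi x)) * g (iter n phi x).
  exact: (iter_wcomp (cdual_wcomp TE c0 Tc)).
have [||h hE hn] := @l2_of_bounded R X (iter n T' g) (s * nrm g).
- by rewrite mulr_ge0 ?nrm_ge0.
- move=> J; rewrite esum_mkcond in Ss.
  pose a x := if x \in Wset phi om T n then
    normc (\prod_(i < n) dual_weight phi w (iter i phi x)) ^+ 2 else 0.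
  have a0 x : 0 <= a x by rewrite /a; case: ifP => // _; exact: sqr_ge0.
  have aJ : \sum_(x <- J) a x <= s ^+ 2.
    rewrite -lee_fin; apply: le_trans (fsum_le_esum J a0) _.
    by under eq_esum do rewrite /a (fun_if EFin).
  apply: (@le_trans _ _ (\sum_(x <- J) a x * nrm g ^+ 2)); last first.
    by rewrite -mulr_suml exprMn ler_wpM2r ?sqr_ge0.
  apply: ler_sum => x _; rewrite T'E normcM exprMn /a.
  case: ifPn => [_|xW].
    rewrite ler_wpM2l ?sqr_ge0// lerXn2r ?nnegrE ?nrm_ge0 ?normc_ge0//.
    exact: normc_le_nrm.
  rewrite gG ?normc0 ?expr0n ?mulr0 ?mul0r// => xG.
  by move/negP: xW; apply; exact/mem_set.
by rewrite -(l2_ext hE).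
Qed.

Lemma outer_bound (r : R) : 0 < r -> (r%:E < outer_radius phi om w T)%E ->
  exists2 C, 0 <= C & forall n f, nrm (iter n T' (P f)) <= C * r^-1 ^+ n * nrm f.
Proof.
move=> r0 /limn_einf_gt[N NP]; have rV0 : 0 < r^-1 by rewrite invr_gt0.
have [M M0 TM] := (cdual_lb Tb c0 Tc).2; have [K K0 PK] := Pb.2.
(* Excludes the index 0, for which there is no root of order [2 n]; the finitely many remaining
   indices are covered by powers of [M]. *)
pose N' := N.+1.
have big n f : (N' <= n)%N -> P f = f -> nrm (iter n T' f) <= r^-1 ^+ n * nrm f.
  move=> Nn fP; have n0 : (0 < n)%N by apply: leq_trans Nn.
  apply: nrm_iter_cdual_le.
  - by rewrite exprn_ge0// ltW.
  - rewrite -exprM; apply: poweR_root_inv_le => //.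
    + by rewrite muln_gt0 n0.
    + by apply: esum_ge0 => x _; rewrite lee_fin sqr_ge0.
    + by rewrite mulnC natrM; apply: NP; apply: leq_trans Nn.
  - exact: (indexE_supp orb fin_branch omP TE Tb c0 Tc).
have [|n|C C0 CP] := @eventual_geometric_bound R
    (fun n => if (N' <= n)%N then r^-1 ^+ n else M ^+ n) r^-1 N' rV0.
- by move=> n; case: ifP => _; rewrite exprn_ge0// ltW.
- by move=> ->.
exists (C * K); first exact: mulr_ge0.
move=> n f; have PP := wproj_idem TE Tb c0 Tc Bphi f.
have : nrm (iter n T' (P f)) <= C * r^-1 ^+ n * nrm (P f).
  apply: le_trans (_ : _ <= (if (N' <= n)%N then r^-1 ^+ n else M ^+ n) * nrm (P f)) _.
    by case: ifPn => [Nn|_]; [exact: big|exact: lb_iter_norm].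
  by rewrite ler_wpM2r ?nrm_ge0.
move/le_trans; apply.
have -> : C * K * r^-1 ^+ n * nrm f = C * r^-1 ^+ n * (K * nrm f) by ring.
by rewrite ler_wpM2l// mulr_ge0// exprn_ge0// ltW.
Qed.

Lemma hdot_iter_linv n f g : hdot (P (iter n L f)) g = hdot f (iter n T' (P g)).
Proof.
rewrite (hdot_wproj Tb c0 Tc); apply: iter_hdot => {}f {}g.
exact: (hdot_linv Tb c0 Tc).
Qed.

Lemma hdot_iter_wcomp n f g :
  hdot (P (iter n T f)) g = hdot f (iter n (adj T) (P g)).
Proof.
by rewrite (hdot_wproj Tb c0 Tc); apply: iter_hdot => {}f {}g; exact: adjE.
Qed.

Lemma restr_seq_le (s : seq X) g :
  nrm (restr [set` s] g) <= \sum_(x <- undup s) normc (g x).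
Proof.
have -> : restr [set` s] g = \sum_(x <- undup s) g x *: e_ x.
  apply: l2_ext => y; rewrite restrE l2_sumE.
  have single x : x != y -> (g x *: e_ x) y = 0.
    by move=> xy; rewrite l2_scaleE l2_basisE eq_sym (negPf xy) mulr0.
  case: asboolP => ys; last first.
    rewrite big_seq big1// => x; rewrite mem_undup => xs; apply: single.
    by apply: contra_notN ys => /eqP <-.
  rewrite (bigD1_seq y) ?mem_undup ?undup_uniq// l2_scaleE l2_basisE eqxx mulr1.
  by rewrite big1; [exact/esym/addr0|exact: single].
apply: le_trans (nrm_sum _ _ _) _; apply: ler_sum => x _.
by rewrite nrmZ nrm_basis mulr1.
Qed.

(** An edge leading out of [B] joins a point of level 0 to one of level 1. *)
Lemma wproj_wcomp_level0 g : P (T g) = P (T (restr [set x | l x = 0] g)).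
Proof.
apply: l2_ext => x; rewrite !(wproj_wcomp TE Tb c0 Tc Bphi).
case: asboolP => // -[nBx Bpx]; rewrite restrE asboolT//=.
move: Bpx; rewrite /lower /= (level_phi_pos lP).
  by have := not_lower nBx; lia.
by have := not_lower nBx; lia.
Qed.

Lemma inner_radius_ge0 : (0 <= inner_radius phi om w)%E.
Proof.
rewrite /inner_radius; case: ifP => _; first by rewrite lee_fin powR_ge0.
rewrite leNgt; apply/negP => /limn_esup_lt[N /(_ N (leqnn N))].
by rewrite lte_fin ltNge powR_ge0.
Qed.

(** Moving the starting point one step along the cycle only moves one factor from the front to the
    end. *)
Lemma cycle_prod (F : X -> R[i]) p t : iter t phi p = p ->
  forall j, \prod_(i < t) F (iter i phi (iter j phi p)) =
            \prod_(i < t) F (iter i phi p).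
Proof.
move=> tp; elim=> // j <-; set z := iter j phi p.
have tz : iter t phi z = z by rewrite /z -iterD addnC iterD tp.
rewrite -[iter j.+1 phi p]/(phi z).
case: t tz {tp} => [|t] tz; first by rewrite !big_ord0.
rewrite big_ord_recr big_ord_recl [LHS]mulrC; congr (_ * _).
  by rewrite -[LHS]/(F (iter t phi (phi z))) -iterSr tz.
by apply: eq_bigr => i _; rewrite -iterSr lift0.
Qed.

(** With a cycle, a full turn multiplies the product by the modulus of Lambda, which is at most
    [s^t]. Without one, [z] is [phi om] and the limit superior applies. *)
Lemma level0_prod_bound (s : R) z : (inner_radius phi om w < s%:E)%E -> l z = 0 ->
  exists2 C, 0 <= C &
    forall n, normc (\prod_(i < n) w (iter i phi z)) <= C * s ^+ n.
Proof.
move=> ws lz; have s0 : 0 < s by rewrite -lte_fin (le_lt_trans inner_radius_ge0).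
move: ws; rewrite /inner_radius; case: asboolP => [hc|nc].
  have [p [t [t0 tp us cs]]] := cycle_enum orb hc.
  have zp : cycle_set phi z.
    by apply/cycle_setE/(level_le0_periodic orb lP) => //; rewrite lz.
  have {zp}[j zE] : exists j, z = iter j phi p.
    by move: zp; rewrite cs/= => /mapP[j _ ->]; exists j.
  have -> : cycle_card phi = t by rewrite (cycle_cardE us cs) size_mkseq.
  rewrite cs -fsbig_seq// big_map (_ : iota 0 t = index_iota 0 t) ?big_mkord ?lte_fin;
    last by rewrite /index_iota subn0.
  move=> /ltW.
  move=> /(powR_root_le t0 (prodr_ge0 _ (fun i _ => normc_ge0 _))) h.
  apply: (periodic_geometric_bound s0 t0) => [n|n]; first exact: normc_ge0.
  rewrite addnC big_split_ord/= normcM mulrC ler_pM ?normc_ge0//.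
    rewrite le_eqVlt; apply/orP; left; apply/eqP; congr normc.
    apply: eq_bigr => i _; congr w; rewrite addnC iterD; congr (iter _ _ _).
    by rewrite zE -iterD addnC iterD tp.
  rewrite zE (cycle_prod w tp); apply: le_trans h.
  rewrite le_eqVlt; apply/orP; left; apply/eqP.
  by elim/big_rec2 : _ => [|i x y _ <-]; rewrite ?normc1// normcM.
move=> /limn_esup_lt[N NP].
apply: (@eventual_geometric_bound _ _ _ N.+1 s0) => [n|n Nn]; first exact: normc_ge0.
(* From [phi om], the factors with [i < n] are those indexed 1 to [n] from [om] in the radius. *)
have zE : z = phi om.
  have [|m zm] := @level_le1 _ _ orb _ omP z nc; rewrite lz//.
  by case: m zm => [|[|m]] zm //; lia.
have n0 : (0 < n)%N by apply: leq_trans Nn.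
have := NP n (ltnW Nn); rewrite lte_fin => /ltW.
move=> /(powR_root_le n0 (prodr_ge0 _ (fun i _ => normc_ge0 _))); apply: le_trans.
rewrite big_add1/= big_mkord zE le_eqVlt; apply/orP; left; apply/eqP.
elim/big_rec2 : _ => [|i x y _ <-]; first by rewrite normc1.
by rewrite normcM -iterSr.
Qed.

(** Only the values of [T^n f] at the finitely many points of level 0 matter, and each is a weight
    product times a value of [f]. The last application of [T] goes into the constant, whence the
    exponent [n]. *)
Lemma inner_bound (s : R) : (inner_radius phi om w < s%:E)%E ->
  exists2 C, 0 <= C & forall n f, nrm (P (iter n.+1 T f)) <= C * s ^+ n * nrm f.
Proof.
move=> ws; have s0 : 0 < s by rewrite -lte_fin (le_lt_trans inner_radius_ge0).
have [zs zsP] := level0_finite orb omP.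
have [K K0 PK] := (lb_comp Pb Tb).2.
have [C C0 CP] : exists2 C : R, 0 <= C & forall n f,
    \sum_(z <- undup zs) normc (iter n T f z) <= C * s ^+ n * nrm f.
  have : forall z, z \in undup zs -> l z = 0 by move=> z; rewrite mem_undup => /zsP.
  elim: (undup zs) => [|z r IH] rP.
    by exists 0 => // n f; rewrite big_nil mul0r mul0r.
  have [|D D0 DP] := IH; first by move=> y yr; apply: rP; rewrite inE yr orbT.
  have [E E0 EP] := level0_prod_bound ws (rP z (mem_head z r)).
  exists (E + D); first exact: addr_ge0.
  move=> n f; rewrite big_cons !mulrDl lerD// (iter_wcomp TE) normcM.
  by rewrite ler_pM ?normc_ge0// normc_le_nrm.
exists (K * C); first exact: mulr_ge0.
move=> n f; rewrite iterS wproj_wcomp_level0 (le_trans (PK _))// -!mulrA.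
rewrite ler_wpM2l// mulrA (le_trans _ (CP n f))//.
rewrite (_ : [set x | l x = 0] = [set` zs]); first exact: restr_seq_le.
by apply/seteqP; split=> x /zsP.
Qed.

End Radii.

(** * The Laurent model *)

Section OperatorFamilies.
Variables (R : realType) (V : hilbertType R).
Implicit Types (g h : nat -> V -> V).

Definition geo_dominated g := exists C q : R, [/\ 0 <= C, 0 <= q < 1 &
  forall n x, nrm (g n x) <= C * q ^+ n * nrm x].

Lemma geo_dominated_geo g x : geo_dominated g -> exists C q : R,
  [/\ 0 <= C, 0 <= q < 1 & geo_le C q (fun n => g n x)].
Proof.
move=> [C [q [C0 q01 gq]]]; exists (C * nrm x), q; split => //.
  by rewrite mulr_ge0 ?nrm_ge0.
by move=> n; rewrite mulrAC.
Qed.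

Lemma geo_dominated_common g h : geo_dominated g -> geo_dominated h -> exists C q : R,
  [/\ 0 <= C, 0 <= q < 1, forall n x, nrm (g n x) <= C * q ^+ n * nrm x &
      forall n x, nrm (h n x) <= C * q ^+ n * nrm x].
Proof.
move=> [C [q [C0 /andP[q0 q1] gq]]] [D [r [D0 /andP[r0 r1] hr]]].
exists (Num.max C D), (Num.max q r); rewrite !le_max C0 q0/= gt_max q1 r1.
split=> // n x; rewrite (le_trans (gq _ _), le_trans (hr _ _))//.
  by rewrite ler_wpM2r ?nrm_ge0// ler_pM ?exprn_ge0// ?le_max ?lexx//
    lerXn2r ?nnegrE ?le_max ?q0 ?lexx.
by rewrite ler_wpM2r ?nrm_ge0// ler_pM ?exprn_ge0// ?le_max ?lexx ?orbT//
  lerXn2r ?nnegrE ?le_max ?r0 ?lexx ?orbT.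
Qed.

Lemma geo_dominated_op_sum (E : set V) g h : geo_dominated g -> geo_dominated h ->
  (forall i, linear_bounded (g i)) ->
  op_sum E (fun p e => g p.1 (h p.2 e))
    (fun e => vsum (fun i => g i (vsum (fun j => h j e)))).
Proof.
move=> gg hg gb; have [C [q [C0 q01 gC hC]]] := geo_dominated_common gg hg.
exact: (op_sum_block E C0 q01).
Qed.

Lemma geo_dominated_lb g : geo_dominated g -> (forall i, linear_bounded (g i)) ->
  linear_bounded (fun x => vsum (fun i => g i x)).
Proof.
move=> gg gb; split.
  move=> c x y; have [C [q [C0 q01 xq]]] := geo_dominated_geo x gg.
  have [D [r [D0 r01 yr]]] := geo_dominated_geo y gg.
  rewrite (_ : (fun i => _) = (fun i => c *: g i x + g i y)); last first.
    by apply/funext => i; rewrite (gb i).1.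
  rewrite (vsumD _ q01 (geo_leZ c xq) D0 r01 yr) ?mulr_ge0 ?normc_ge0//.
  by rewrite (vsumZ c C0 q01 xq).
have [C [q [C0 q01 gC]]] := gg; have /andP[_ q1] := q01.
exists (C / (1 - q)); first by rewrite divr_ge0// subr_ge0 ltW.
move=> x; rewrite mulrAC; apply: nrm_vsum => //.
  by rewrite mulr_ge0 ?nrm_ge0.
by move=> n; rewrite mulrAC.
Qed.

End OperatorFamilies.

Lemma normc_conjc (R : realType) (z : R[i]) : normc z^* = normc z.
Proof. by case: z => a b /=; rewrite sqrrN. Qed.

Lemma conjc_exprK (R : realType) (z : R[i]) n : (z^* ^+ n)^* = z ^+ n.
Proof. by rewrite rmorphXn /= conjcK. Qed.

Lemma conjc_exprVK (R : realType) (z : R[i]) n : (z^*^-1 ^+ n)^* = z^-1 ^+ n.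
Proof. by rewrite rmorphXn fmorphV /= conjcK. Qed.

Lemma ereal_between (R : realType) (x y : \bar R) : (0 <= x)%E -> (x < y)%E ->
  exists2 r : R, (x < r%:E)%E & (r%:E < y)%E.
Proof.
move: x y => [x| |] [y| |]//; rewrite ?lee_fin ?lte_fin => x0 xy.
  by exists ((x + y) / 2); rewrite lte_fin midf_lt.
by exists (x + 1); rewrite ?ltry// lte_fin ltrDl.
Qed.

Section LaurentModel.
Variables (R : realType) (V : hilbertType R).
Variables (rm rp : \bar R).
Variables (a b a' b' : nat -> V -> V).
Hypothesis rm0 : (0 <= rm)%E.
Hypothesis rmp : (rm < rp)%E.
Hypothesis a_lb : forall n, linear_bounded (a n).
Hypothesis b_lb : forall n, linear_bounded (b n).
Hypothesis a'_lb : forall n, linear_bounded (a' n).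
Hypothesis b'_lb : forall n, linear_bounded (b' n).
Hypothesis aE : forall n f e, hdot (a n f) e = hdot f (a' n e).
Hypothesis bE : forall n f e, hdot (b n f) e = hdot f (b' n e).
Hypothesis a'_bound : forall r : R, 0 < r -> (r%:E < rp)%E ->
  exists2 C, 0 <= C & forall n f, nrm (a' n f) <= C * r^-1 ^+ n * nrm f.
Hypothesis b_bound : forall s : R, (rm < s%:E)%E ->
  exists2 C, 0 <= C & forall n f, nrm (b n f) <= C * s ^+ n * nrm f.

Local Notation Om := (annulus rm rp).

Definition model_eval f z : V := laurent (fun n => a n f) (fun n => b n f) z.
(** The adjoint of evaluation at [l], applied to [e]. *)
Definition model_ker (l : R[i]) e : V :=
  laurent (fun n => a' n e) (fun n => b' n e) l^*.

(** The growth hypotheses concern only [a'] and [b]; [a] and [b'] inherit the same bounds as their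
    adjoints. The radii are chosen strictly between [normc z] and the two ends of the annulus. *)
Lemma annulus_radii z : Om z -> exists s r C : R,
  [/\ [/\ 0 <= C, 0 < s, 0 < r & s < normc z < r],
      forall n f, nrm (a n f) <= C * r^-1 ^+ n * nrm f,
      forall n f, nrm (b n f) <= C * s ^+ n * nrm f,
      forall n f, nrm (a' n f) <= C * r^-1 ^+ n * nrm f &
      forall n f, nrm (b' n f) <= C * s ^+ n * nrm f].
Proof.
move=> /andP[zm zp].
have [s sm sz] := ereal_between rm0 zm.
have z0 : (0 <= (normc z)%:E)%E by rewrite lee_fin normc_ge0.
have [r zr rr] := ereal_between z0 zp.
rewrite lte_fin in sz; rewrite lte_fin in zr.
have s0 : 0 < s by rewrite -lte_fin (le_lt_trans rm0).
have r0 : 0 < r by rewrite (lt_trans _ zr)// (lt_trans s0).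
have [C C0 CP] := a'_bound r0 rr; have [D D0 DP] := b_bound sm.
have up (x y t : R) f : 0 <= t -> x <= y -> x * t * nrm f <= y * t * nrm f :> R.
  by move=> t0 xy; rewrite ler_wpM2r ?nrm_ge0// ler_wpM2r.
have rn n : 0 <= r^-1 ^+ n by rewrite exprn_ge0// invr_ge0 ltW.
have sn n : 0 <= s ^+ n by rewrite exprn_ge0// ltW.
have CD : C <= C + D by rewrite lerDl.
have DC : D <= C + D by rewrite lerDr.
have CD0 : 0 <= C + D by rewrite addr_ge0.
have CP' n f : nrm (a' n f) <= (C + D) * r^-1 ^+ n * nrm f.
  by rewrite (le_trans (CP n f))// up.
have DP' n f : nrm (b n f) <= (C + D) * s ^+ n * nrm f.
  by rewrite (le_trans (DP n f))// up.
exists s, r, (C + D); split => //.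
- by rewrite sz zr.
- move=> n; apply: (@adjoint_norm_le R V (a' n)) => //; first by rewrite mulr_ge0.
  by move=> f g; rewrite hdotC -aE -hdotC.
- move=> n; apply: (@adjoint_norm_le R V (b n)) => //; first by rewrite mulr_ge0.
Qed.

Lemma pos_geo_dominated z : Om z ->
  geo_dominated (fun n f => z ^+ n *: a n f) /\
  geo_dominated (fun n f => (z^*) ^+ n *: a' n f).
Proof.
move=> /annulus_radii[s [r [C [[C0 s0 r0 /andP[sz zr]] aC _ a'C _]]]].
have q01 : 0 <= normc z / r < 1.
  by rewrite divr_ge0 ?normc_ge0 ?(ltW r0)//= ltr_pdivrMr// mul1r.
split; exists C, (normc z / r); split => // n f; rewrite mulrAC.
  apply: (geo_le_pser (u := fun n => a n f)) => //.
    by rewrite mulr_ge0 ?nrm_ge0.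
  by move=> m; rewrite mulrAC.
apply: (geo_le_pser (u := fun n => a' n f)) => //.
- by rewrite mulr_ge0 ?nrm_ge0.
- by move=> m; rewrite mulrAC.
- by rewrite normc_conjc.
Qed.

Lemma neg_geo_dominated z : Om z ->
  geo_dominated (fun n f => z^-1 ^+ n.+1 *: b n f) /\
  geo_dominated (fun n f => (z^*)^-1 ^+ n.+1 *: b' n f).
Proof.
move=> /annulus_radii[s [r [C [[C0 s0 r0 /andP[sz zr]] _ bC _ b'C]]]].
have z0 : 0 < normc z := lt_trans s0 sz.
have q01 : 0 <= s / normc z < 1.
  by rewrite divr_ge0 ?normc_ge0 ?(ltW s0)//= ltr_pdivrMr// mul1r.
have Cs0 : 0 <= C / s := divr_ge0 C0 (ltW s0).
split; exists (C / s), (s / normc z); split => // n f.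
  rewrite mulrAC [C / s * _]mulrAC.
  apply: (geo_le_laurent_neg (v := fun n => b n f)) => //.
    by rewrite mulr_ge0 ?nrm_ge0.
  by move=> m; rewrite mulrAC.
rewrite -(normc_conjc z) mulrAC [C / s * _]mulrAC.
apply: (geo_le_laurent_neg (v := fun n => b' n f)) => //.
- by rewrite mulr_ge0 ?nrm_ge0.
- by move=> m; rewrite mulrAC.
- by rewrite normc_conjc.
Qed.

Lemma annulus_neq0 z : Om z -> z != 0.
Proof.
move=> /annulus_radii[s [r [C [[_ s0 _ /andP[sz _]] _ _ _ _]]]].
by apply: contraTneq (lt_trans s0 sz) => ->; rewrite normc0 ltxx.
Qed.

Lemma model_eval_lb z : Om z -> linear_bounded (model_eval^~ z).
Proof.
move=> Oz; apply: lb_add.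
  by apply: geo_dominated_lb (pos_geo_dominated Oz).1 _ => i; exact: lb_scale.
by apply: geo_dominated_lb (neg_geo_dominated Oz).1 _ => i; exact: lb_scale.
Qed.

Lemma model_ker_lb z : Om z -> linear_bounded (model_ker z).
Proof.
move=> Oz; apply: lb_add.
  by apply: geo_dominated_lb (pos_geo_dominated Oz).2 _ => i; exact: lb_scale.
by apply: geo_dominated_lb (neg_geo_dominated Oz).2 _ => i; exact: lb_scale.
Qed.

Lemma model_eval_derivable f z : Om z -> derivable (model_eval f) z 1.
Proof.
move=> /annulus_radii[s [r [C [[C0 s0 r0 szr] aC bC _ _]]]].
apply: (@laurent_derivable _ _ (C * nrm f) r s) => //.
- by rewrite mulr_ge0 ?nrm_ge0.
- by move=> n; rewrite mulrAC.
- by move=> n; rewrite mulrAC.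
Qed.

Lemma model_reproducing f e l : Om l ->
  hdot (model_eval f l) e = hdot f (model_ker l e).
Proof.
move=> Ol; rewrite hdotDl hdotDr; congr (_ + _).
  have [C [q [C0 q01 fq]]] := geo_dominated_geo f (pos_geo_dominated Ol).1.
  have [D [r [D0 r01 er]]] := geo_dominated_geo e (pos_geo_dominated Ol).2.
  apply: (hdot_vsum_eq C0 q01 fq D0 r01 er) => n.
  by rewrite hdotZl hdotZr aE; congr (_ * _); exact/esym/conjc_exprK.
have [C [q [C0 q01 fq]]] := geo_dominated_geo f (neg_geo_dominated Ol).1.
have [D [r [D0 r01 er]]] := geo_dominated_geo e (neg_geo_dominated Ol).2.
apply: (hdot_vsum_eq C0 q01 fq D0 r01 er) => n.
by rewrite hdotZl hdotZr bE; congr (_ * _); exact/esym/conjc_exprVK.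
Qed.

(** Rescaling by some radius [p] inside the annulus brings the circle of radius [p] to the unit
    circle, where the averaging argument applies. *)
Lemma model_coef_eq0 f : (forall z, Om z -> model_eval f z = 0) ->
  forall n, a n f = 0.
Proof.
move=> f0 n; have [p mp pp] := ereal_between rm0 rmp.
have p0 : 0 < p by rewrite -lte_fin (le_lt_trans rm0).
have np : normc (p%:C : R[i]) = p.
  by rewrite /= expr0n addr0 sqrtr_sqr ger0_norm// ltW.
have OmE z : Om z = (rm < (normc z)%:E < rp)%E :> Prop by [].
have Op : Om p%:C by rewrite OmE np mp pp.
have pC0 : p%:C != 0 :> R[i] := annulus_neq0 Op.
have [C [q [C0 q01 pos neg]]] :=
  geo_dominated_common (pos_geo_dominated Op).1 (neg_geo_dominated Op).1.
have := @laurent_coef_eq0 R V (C * nrm f) q (fun n => p%:C ^+ n *: a n f)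
  (fun n => p%:C^-1 ^+ n.+1 *: b n f) _ q01 _ _ _ n.
rewrite mulr_ge0 ?nrm_ge0// => /(_ isT) h.
suff : p%:C ^+ n *: a n f = 0.
  by move/eqP; rewrite scaler_eq0 expf_eq0 (negPf pC0) andbF => /eqP.
apply: h => [m|m|z z1]; [by rewrite mulrAC|by rewrite mulrAC|].
rewrite -(f0 (p%:C * z)); last first.
  by rewrite OmE normcM np z1 mulr1 mp pp.
congr (vsum _ + vsum _); apply/funext => m.
  by rewrite scalerA mulrC -exprMn.
by rewrite scalerA mulrC -exprMn -invfM.
Qed.

(** Evaluation and its adjoint each split into a positive and a negative half; each of the four
    products is a geometrically dominated double series. *)
Lemma model_kernel_blocks (E : set V) z l : Om z -> Om l ->
  exists SA SB SC SD : V -> V,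
    [/\ op_sum E (fun p e => (z ^- p.1.+1 * l^* ^- p.2.+1) *: b p.1 (b' p.2 e)) SA,
        op_sum E (fun p e => (z ^- p.1.+1 * l^* ^+ p.2) *: b p.1 (a' p.2 e)) SB,
        op_sum E (fun p e => (z ^+ p.1 * l^* ^- p.2.+1) *: a p.1 (b' p.2 e)) SC,
        op_sum E (fun p e => (z ^+ p.1 * l^* ^+ p.2) *: a p.1 (a' p.2 e)) SD &
        forall e, model_eval (model_ker l e) z = SA e + SB e + SC e + SD e].
Proof.
move=> Oz Ol; have [zp _] := pos_geo_dominated Oz; have [_ lp] := pos_geo_dominated Ol.
have [zn _] := neg_geo_dominated Oz; have [_ ln] := neg_geo_dominated Ol.
have zpb n : linear_bounded (fun f => z ^+ n *: a n f) by exact: lb_scale.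
have znb n : linear_bounded (fun f => z^-1 ^+ n.+1 *: b n f) by exact: lb_scale.
have h1 := geo_dominated_op_sum E zn ln znb; have h2 := geo_dominated_op_sum E zn lp znb.
have h3 := geo_dominated_op_sum E zp ln zpb; have h4 := geo_dominated_op_sum E zp lp zpb.
do 4!eexists; split.
- move: h1; congr op_sum; apply/funext => p; apply/funext => e.
  by rewrite (lbZ _ _ (b_lb _)) scalerA !exprVn.
- move: h2; congr op_sum; apply/funext => p; apply/funext => e.
  by rewrite (lbZ _ _ (b_lb _)) scalerA !exprVn.
- move: h3; congr op_sum; apply/funext => p; apply/funext => e.
  by rewrite (lbZ _ _ (a_lb _)) scalerA !exprVn.
- move: h4; congr op_sum; apply/funext => p; apply/funext => e.
  by rewrite (lbZ _ _ (a_lb _)) scalerA.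
move=> e /=; rewrite {1}/model_ker /laurent (lbD _ _ (model_eval_lb Oz)).
by rewrite addrC addrACA addrC addrA.
Qed.

End LaurentModel.

(** * Supports by level when there is no cycle *)

Section LevelSupport.
Variables (R : realType) (X : choiceType).
Local Notation l2 := (l2 R X).
Local Notation e_ := (l2_basis R).
Implicit Types (f g e : l2) (x y : X).
Variables (phi : X -> X) (w : X -> R[i]) (T : l2 -> l2) (om : X).
Hypothesis orb : single_orbit phi.
Hypothesis omP : ~ has_cycle phi -> generalized_root phi om.
Hypothesis TE : is_wcomp phi w T.
Hypothesis Tb : linear_bounded T.

Local Notation l := (level phi (phi om)).
Local Notation lP := (levelP orb (phi om)).
Local Notation B := (lower phi om).
Local Notation P := (wproj T B).
Local Notation T' := (cdual T).
Local Notation L := (linv T).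
Local Notation Ta := (adj T).
Local Notation Bphi := (@lower_phi X phi om orb).
Local Notation k := (indexE phi om T).

Definition level_supp (m n : int) f := forall x, ~ (m <= l x <= n) -> f x = 0.

Hypothesis nc : ~ has_cycle phi.

Lemma level_step x : l (phi x) = l x - 1.
Proof. exact: (level_acyclic lP 1 x nc). Qed.

Lemma level_supp_wcomp (v : X -> R[i]) (S : l2 -> l2) m n f : is_wcomp phi v S ->
  level_supp m n f -> level_supp (m + 1) (n + 1) (S f).
Proof.
move=> SE fl x nx; rewrite SE fl ?mulr0// level_step => lx; apply: nx; lia.
Qed.

Lemma level_supp_iter_wcomp (v : X -> R[i]) (S : l2 -> l2) i m n f : is_wcomp phi v S ->
  level_supp m n f -> level_supp (m + i%:Z) (n + i%:Z) (iter i S f).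
Proof.
move=> SE fl; elim: i => [|i IH]; first by rewrite !addr0.
have := level_supp_wcomp SE IH; rewrite -!addrA.
by have -> : i%:Z + 1 = i.+1%:Z by lia.
Qed.

Lemma level_supp_adj m n f : level_supp m n f -> level_supp (m - 1) (n - 1) (Ta f).
Proof.
move=> fl y ny; apply: (adj_vanish TE Tb) => x xy; apply: fl => lx; apply: ny.
by rewrite -xy level_step; lia.
Qed.

Lemma level_supp_iter_down (S : l2 -> l2) i m n f :
  (forall m n f, level_supp m n f -> level_supp (m - 1) (n - 1) (S f)) ->
  level_supp m n f -> level_supp (m - i%:Z) (n - i%:Z) (iter i S f).
Proof.
move=> Sl fl; elim: i => [|i IH]; first by rewrite !subr0.
have := Sl _ _ _ IH; rewrite -!addrA -!opprD.
by have -> : i%:Z + 1 = i.+1%:Z by lia.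
Qed.

(** Without a cycle [om] is the only point of level 1. *)
Lemma l2_on_level1 e : l2_on (Gen phi om 1 1) e -> e = e om *: e_ om.
Proof.
move=> /l2_onP e0; apply: l2_ext => x; rewrite l2_scaleE l2_basisE.
have [->|xom] := eqVneq x om; first by rewrite mulr1.
rewrite mulr0 e0// /Gen /= => lx; have [|[|n] xn ln] := @level_le1 _ _ orb _ omP x nc.
- by lia.
- by rewrite xn eqxx in xom.
- by lia.
Qed.

Lemma wcomp_root i : T (e_ (iter i.+1 phi om)) =
  w (iter i phi om) *: e_ (iter i phi om).
Proof.
apply: l2_ext => x; rewrite (wcomp_basis TE) l2_scaleE l2_basisE.
have [->|xi] := eqVneq x (iter i phi om); first by rewrite -iterS eqxx.
case: eqP => [xe|_]; last by rewrite !mulr0.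
have : x = iter i phi om.
  apply: (acyclic_unbranched orb omP nc _ _ xe) => //.
  by rewrite (level_acyclic lP _ _ nc) (level_root orb om nc); lia.
by move/eqP; rewrite (negPf xi).
Qed.

Hypothesis fin_branch : finite_branching_index phi.
Variable c : R.
Hypothesis c0 : 0 < c.
Hypothesis Tc : forall f : l2, c * nrm f <= nrm (T f).
Local Notation Pb := (wproj_lb Tb c0 Tc B).
Local Notation PP := (wproj_idem TE Tb c0 Tc Bphi).

Lemma level_supp_linv m n f : level_supp m n f -> level_supp (m - 1) (n - 1) (L f).
Proof. by move=> /level_supp_adj fl y ny; rewrite (linvE c0 Tc) fl ?mulr0. Qed.

Lemma level_supp_wproj e : level_supp 1 k%:Z (P e).
Proof.
move=> x nx; have := indexE_supp orb fin_branch omP TE Tb c0 Tc (PP e).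
by move/l2_onP; apply.
Qed.

(** [T*] lowers the window of levels and [T'] raises it back, so [P f] stays in the window of [f];
    it also lives on the levels 1 to k, and the two windows are disjoint. *)
Lemma wproj_lev0 m n f : level_supp m n f -> (n < 1 \/ k%:Z < m) -> P f = 0.
Proof.
move=> fl mn.
have Pf : level_supp m n (P f).
  move=> x nx; rewrite /wproj l2_addE l2_oppE restrE fl// if_same sub0r.
  rewrite (cdual_wcomp TE c0 Tc) restrE (level_supp_adj fl) ?if_same ?mulr0 ?oppr0//.
  by rewrite level_step => lx; apply: nx; lia.
apply: l2_ext => x; have [lx|nlx] := pselect (m <= l x <= n); last exact: Pf.
by apply: level_supp_wproj => lx'; case: mn; lia.
Qed.

Lemma root_weight_neq0 i : w (iter i phi om) != 0.
Proof.
apply: (unbranched_weight_neq0 TE c0 Tc); apply: (acyclic_unbranched orb omP nc) => //.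
by rewrite -iterS (level_acyclic lP _ _ nc) (level_root orb om nc); lia.
Qed.

Lemma root_in_E : P (e_ om) = e_ om.
Proof.
have lom := level_root orb om nc.
have nB : ~ B om by rewrite /lower /= lom.
have := basis_wproj TE Tb c0 Tc nB; rewrite asboolT ?addr0 => [<-//|].
by rewrite /lower /= level_step lom.
Qed.

(** The factor by which [T^n] sends the basis vector at [phi^n om] to the one at [om]. *)
Definition root_weight n := \prod_(i < n) w (iter i phi om).

Lemma root_weight_prod_neq0 n : root_weight n != 0.
Proof.
by apply/prodf_neq0 => i _; exact: root_weight_neq0.
Qed.

End LevelSupport.

(** * The model space on l^2(X) *)

Section Model.
Variables (R : realType) (X : choiceType).
Local Notation l2 := (l2 R X).
Local Notation e_ := (l2_basis R).
Implicit Types (f g e : l2) (x y : X).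
Variables (phi : X -> X) (w : X -> R[i]) (T : l2 -> l2) (om : X).
Hypothesis orb : single_orbit phi.
Hypothesis fin_branch : finite_branching_index phi.
Hypothesis omP : ~ has_cycle phi -> generalized_root phi om.
Hypothesis TE : is_wcomp phi w T.
Hypothesis Tb : linear_bounded T.
Variable c : R.
Hypothesis c0 : 0 < c.
Hypothesis Tc : forall f : l2, c * nrm f <= nrm (T f).

Local Notation l := (level phi (phi om)).
Local Notation lP := (levelP orb (phi om)).
Local Notation B := (lower phi om).
Local Notation P := (wproj T B).
Local Notation Pb := (wproj_lb Tb c0 Tc B).
Local Notation T' := (cdual T).
Local Notation L := (linv T).
Local Notation Ta := (adj T).
Local Notation Bphi := (@lower_phi X phi om orb).
Local Notation E := (spaceE phi om T).
Local Notation k := (indexE phi om T).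
Local Notation rm := (inner_radius phi om w).
Local Notation rp := (outer_radius phi om w T).
Local Notation Om := (annulus rm rp).

Local Notation EP := (spaceE_wproj orb omP TE Tb c0 Tc).
Local Notation PP := (wproj_idem TE Tb c0 Tc Bphi).
Local Notation rm0 := (inner_radius_ge0 phi w om).

Lemma closed_span_full (S : set l2) :
  (forall n e, P e = e -> S (iter n T e)) ->
  (forall x, B x -> closed_span S (e_ x)) -> closed_span S = setT.
Proof.
move=> ST SB; apply/seteqP; split=> // f _.
apply: l2_span_basis; [exact: closed_span0| |exact: closed_span_closed|].
  by move=> a u v; exact: closed_span_lin.
move=> x _; have [Bx|nBx] := pselect (B x); first exact: SB.
(* All powers of [T] are treated together, since passing from [x] to [phi x] costs one more
   application of [T]. *)
suff : forall m, closed_span S (iter m T (e_ x)) by move=> /(_ 0%N).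
have lx := not_lower nBx.
elim: `|l x|%N {-2}x (erefl `|l x|%N) nBx lx => [|n IH] {}x xn nBx lx m.
  by move: lx; rewrite -{1}[l x]gez0_abs ?xn//; lia.
rewrite (basis_wproj TE Tb c0 Tc nBx) (lbD _ _ (lb_iter m Tb)) addrC.
have SP : closed_span S (iter m T (P (e_ x))).
  by apply: closed_span_sub; apply: ST; exact: PP.
case: asboolP => [_|nBpx]; first by rewrite (lb0 (lb_iter m Tb)) add0r.
rewrite (lbZ _ _ (lb_iter m Tb)) -iterSr; apply: closed_span_lin => //.
have lpx := level_phi_pos lP (lx : 0 < l x).
by apply: IH => //; [rewrite lpx; lia|exact: not_lower].
Qed.

(* The coefficients of [z ^+ n] and [z ^- n.+1] in the Laurent series of [U f]. *)
Definition pos_coef n f := P (iter n L f).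
Definition neg_coef n f := P (iter n.+1 T f).
Definition pos_coef_adj n f := iter n T' (P f).
Definition neg_coef_adj n f := iter n.+1 Ta (P f).

Lemma pos_coef_lb n : linear_bounded (pos_coef n).
Proof. exact: lb_comp Pb (lb_iter n (linv_lb Tb c0 Tc)). Qed.

Lemma neg_coef_lb n : linear_bounded (neg_coef n).
Proof. exact: lb_comp Pb (lb_iter n.+1 Tb). Qed.

Lemma pos_coef_adj_lb n : linear_bounded (pos_coef_adj n).
Proof. exact: lb_comp (lb_iter n (cdual_lb Tb c0 Tc)) Pb. Qed.

Lemma neg_coef_adj_lb n : linear_bounded (neg_coef_adj n).
Proof. exact: lb_comp (lb_iter n.+1 (adj_lb Tb)) Pb. Qed.

Lemma pos_coef_hdot n f e : hdot (pos_coef n f) e = hdot f (pos_coef_adj n e).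
Proof. exact: (hdot_iter_linv phi om Tb c0 Tc). Qed.

Lemma neg_coef_hdot n f e : hdot (neg_coef n f) e = hdot f (neg_coef_adj n e).
Proof. exact: (hdot_iter_wcomp phi om Tb c0 Tc). Qed.

Lemma pos_coef_adj_bound (r : R) : 0 < r -> (r%:E < rp)%E ->
  exists2 C, 0 <= C & forall n f, nrm (pos_coef_adj n f) <= C * r^-1 ^+ n * nrm f.
Proof. exact: (outer_bound orb fin_branch omP TE Tb c0 Tc). Qed.

Lemma neg_coef_bound (s : R) : (rm < s%:E)%E ->
  exists2 C, 0 <= C & forall n f, nrm (neg_coef n f) <= C * s ^+ n * nrm f.
Proof. exact: (inner_bound orb omP TE Tb c0 Tc). Qed.

Local Notation ev := (model_eval pos_coef neg_coef).
Local Notation pos_geo_dominated :=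
  (pos_geo_dominated rm0 pos_coef_hdot neg_coef_hdot pos_coef_adj_bound neg_coef_bound).
Local Notation neg_geo_dominated :=
  (neg_geo_dominated rm0 pos_coef_hdot neg_coef_hdot pos_coef_adj_bound neg_coef_bound).

Lemma eval_lb z : Om z -> linear_bounded (ev^~ z).
Proof.
exact: (model_eval_lb rm0 pos_coef_lb neg_coef_lb pos_coef_hdot neg_coef_hdot
  pos_coef_adj_bound neg_coef_bound).
Qed.

Lemma eval_wproj f z : Om z -> P (ev f z) = ev f z.
Proof.
move=> Oz; rewrite /model_eval /laurent (lbD _ _ Pb).
have [C [q [C0 q01 fq]]] := geo_dominated_geo f (pos_geo_dominated Oz).1.
have [D [r [D0 r01 fr]]] := geo_dominated_geo f (neg_geo_dominated Oz).1.
rewrite (lb_vsum Pb C0 q01 fq) (lb_vsum Pb D0 r01 fr).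
congr (vsum _ + vsum _); apply/funext => n /=.
  by rewrite (lbZ _ _ Pb) PP.
by rewrite (lbZ _ _ Pb) PP.
Qed.

(** Multiplication by [z] shifts coefficients: [L T] is the identity on the positive side, and the
    leading negative coefficient [P T f] of [U f] becomes the constant coefficient of [U (T f)]. *)
Lemma eval_wcomp f z : Om z -> ev (T f) z = z *: ev f z.
Proof.
move=> Oz; have z0 := annulus_neq0 rm0 pos_coef_hdot neg_coef_hdot
  pos_coef_adj_bound neg_coef_bound Oz.
rewrite /model_eval /laurent scalerDr.
have [C [q [C0 q01 fq]]] := geo_dominated_geo (T f) (pos_geo_dominated Oz).1.
have [D [r [D0 r01 fr]]] := geo_dominated_geo f (pos_geo_dominated Oz).1.
have [C' [q' [C0' q01' fq']]] := geo_dominated_geo f (neg_geo_dominated Oz).1.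
rewrite (vsum_shift C0 q01 fq) -(vsumZ z D0 r01 fr).
rewrite (vsum_shift C0' q01' fq') (scalerDr z).
have -> : z *: (z^-1 ^+ 1 *: neg_coef 0 f) = z ^+ 0 *: pos_coef 0 (T f).
  by rewrite scalerA expr1 mulfV.
have -> : (fun n => z ^+ n.+1 *: pos_coef n.+1 (T f)) = fun n => z *: (z ^+ n *: pos_coef n f).
  apply/funext => n; rewrite scalerA -exprS /pos_coef iterSr.
  by rewrite (linvK TE Tb c0 Tc).
have q1 : geo_le C' q' (fun n => z^-1 ^+ n.+2 *: neg_coef n.+1 f).
  move=> n; rewrite (le_trans (fq' n.+1))// ler_wpM2l//.
  by have /andP[q0 q1] := q01'; rewrite ler_wiXn2l ?leqnSn// ltW.
rewrite -(vsumZ z C0' q01' q1) [RHS]addrCA [RHS]addrA.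
congr (_ + vsum _); apply/funext => n.
by rewrite scalerA (exprS z^-1 n.+1) mulrA mulfV// mul1r /neg_coef -iterSr.
Qed.

Lemma eval_iter n f z : Om z -> ev (iter n T f) z = z ^+ n *: ev f z.
Proof.
move=> Oz; elim: n => [|n IH]; first by rewrite expr0 scale1r.
by rewrite iterS eval_wcomp// IH scalerA -exprS.
Qed.

Lemma eval_const e z : P e = e -> ev e z = e.
Proof.
move=> Pe; have eB : forall x, B x -> e x = 0.
  by have [] := (wprojP TE Tb c0 Tc Bphi e).1 Pe.
rewrite /model_eval /laurent (vsum_single (m := 0%N)); last first.
  by case=> // n _; rewrite /pos_coef (wproj_linv TE Tb c0 Tc Bphi)// scaler0.
rewrite expr0 scale1r /pos_coef /= Pe -[RHS]addr0; congr (_ + _).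
rewrite -[RHS]vsum0; congr vsum; apply/funext => n.
by rewrite /neg_coef (wproj_iter_off TE Tb c0 Tc Bphi)// scaler0.
Qed.

(** [T] sends the basis vector at [phi^(n+1) om] to a multiple of the one at [phi^n om]; dividing by
    [z] gives the induction step. *)
Lemma eval_root n z : ~ has_cycle phi -> Om z ->
  ev (e_ (iter n phi om)) z = (root_weight phi w om n * z ^- n) *: e_ om.
Proof.
move=> nc Oz; have z0 := annulus_neq0 rm0 pos_coef_hdot neg_coef_hdot
  pos_coef_adj_bound neg_coef_bound Oz.
elim: n => [|n IH].
  rewrite /root_weight big_ord0 expr0 invr1 mulr1 scale1r.
  by rewrite eval_const// (root_in_E om orb TE Tb nc c0 Tc).
apply: (scalerI z0); rewrite -eval_wcomp// (wcomp_root orb omP TE nc).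
rewrite (lbZ _ _ (eval_lb Oz)) IH.
rewrite !scalerA; congr (_ *: _).
by rewrite /root_weight big_ord_recr/= exprS; field; rewrite z0 expf_neq0.
Qed.

Section Cyclic.
Variables (p : X) (t : nat).
Hypothesis hc : has_cycle phi.
Hypothesis t0 : (0 < t)%N.
Hypothesis tp : iter t phi p = p.
Hypothesis cs : cycle_set phi = [set` mkseq (fun i => iter i phi p) t].
Local Notation La := (\prod_(i < t) w (iter i phi p)).

Lemma cycleP x : B x -> exists2 j, (j < t)%N & x = iter j phi p.
Proof.
move=> Bx; have : cycle_set phi x.
  by apply/cycle_setE; exact: (level_le0_periodic orb lP).
rewrite cs /= => /mapP[j]; rewrite mem_iota/= add0n => jt ->.
by exists j.
Qed.

Lemma lower_cycle j : B (iter j phi p).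
Proof.
rewrite /lower /= (level_periodic lP)//; apply: periodic_iter.
by exists t.
Qed.

(** [T^t e_z - Lambda e_z] vanishes on the cycle, so it is annihilated by every [P T^(n+1)]. *)
Lemma wproj_cycle_period j m i :
  P (iter (m * t + i.+1) T (e_ (iter j phi p))) =
  La ^+ m *: P (iter i.+1 T (e_ (iter j phi p))).
Proof.
set z := iter j phi p.
have step n : P (iter (t + n.+1) T (e_ z)) = La *: P (iter n.+1 T (e_ z)).
  have -> : iter (t + n.+1) T (e_ z) =
      iter n.+1 T (La *: e_ z) + iter n.+1 T (iter t T (e_ z) - La *: e_ z).
    by rewrite -(lbD _ _ (lb_iter n.+1 Tb)) addrC subrK addnC iterD.
  rewrite (lbD _ _ Pb) (lbZ _ _ (lb_iter n.+1 Tb)) (lbZ _ _ Pb).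
  rewrite (wproj_iter_off TE Tb c0 Tc Bphi) ?addr0// => x Bx.
  have [i' _ ->] := cycleP Bx.
  rewrite l2_addE l2_oppE l2_scaleE (iter_wcomp TE) (cycle_prod w tp).
  by rewrite -iterD addnC iterD tp subrr.
elim: m => [|m IH]; first by rewrite expr0 scale1r.
by rewrite mulSn -addnA addnS step -addnS IH scalerA -exprS.
Qed.

(** A vector supported on the cycle has no positive coefficients. Grouping the negative ones in
    blocks of [t] turns the partial sum of order [N] into that of order [N * t] of the original
    series. *)
Lemma eval_cycle j z : Om z ->
  series (fun m : nat => \sum_(1 <= i < t.+1)
    (La ^+ m / z ^+ (m * t + i)) *: P (iter i T (e_ (iter j phi p)))) @ \oo
  --> ev (e_ (iter j phi p)) z.
Proof.
move=> Oz; set e := e_ (iter j phi p).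
have -> : ev e z = vsum (fun n => z^-1 ^+ n.+1 *: neg_coef n e).
  rewrite /model_eval /laurent -[RHS]add0r; congr (_ + _).
  rewrite -[RHS]vsum0; congr vsum; apply/funext => n.
  rewrite /pos_coef (wproj_linv_on TE Tb c0 Tc Bphi) ?scaler0// => x nBx.
  rewrite l2_basisE; case: eqP => // xj; case: nBx; rewrite xj.
  exact: lower_cycle.
set h := fun n => z^-1 ^+ n.+1 *: neg_coef n e.
have [C [q [C0 q01 hq]]] := geo_dominated_geo e (neg_geo_dominated Oz).1.
have sE N : series (fun m : nat => \sum_(1 <= i < t.+1)
    (La ^+ m / z ^+ (m * t + i)) *: P (iter i T e)) N = series h (N * t)%N.
  elim: N => [|N IH]; first by rewrite /series/= !big_geq.
  rewrite /series/= big_nat_recr//=; rewrite /series/= in IH; rewrite IH.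
  rewrite mulSn [in RHS](@big_cat_nat _ _ _ (N * t)%N) ?leq_addl//=; congr (_ + _).
  rewrite -{2}[(N * t)%N]add0n big_addn addnK big_add1/=.
  apply: eq_bigr => i _; rewrite /h /neg_coef.
  have -> : (i + N * t).+1 = (N * t + i.+1)%N by lia.
  by rewrite wproj_cycle_period scalerA mulrC exprVn.
apply/cvg_nrmP => d d0; have /cvg_nrmP/(_ d d0)[N _ NP] := geo_cvg C0 q01 hq.
exists N => // n /= Nn; rewrite sE; apply: NP => /=.
by rewrite (leq_trans Nn)// leq_pmulr.
Qed.

End Cyclic.
Hypothesis hull : dual_hull T E = setT.
Hypothesis rmp : (rm < rp)%E.

Lemma eval_eq0 f : (forall z, Om z -> ev f z = 0) -> f = 0.
Proof.
move=> f0.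
have Pa n : P (iter n L f) = 0.
  exact: (model_coef_eq0 rm0 rmp pos_coef_hdot neg_coef_hdot
    pos_coef_adj_bound neg_coef_bound f0 n).
(* [P T^n f] is the constant coefficient of [U (T^n f) = z^n U f], so the negative coefficients are
   handled by the positive ones. *)
have Pbn n : P (iter n T f) = 0.
  apply: (model_coef_eq0 rm0 rmp pos_coef_hdot neg_coef_hdot
    pos_coef_adj_bound neg_coef_bound _ 0%N).
  by move=> z Oz; rewrite eval_iter// f0// scaler0.
apply: hdot_eq0 => v; have : dual_hull T E v by rewrite hull.
apply: closed_span_orth => u; rewrite (adjointE Tb) (cauchy_dualE TE Tb c0 Tc) EP.
move=> [[n [x /= Px ->]]|[n [x /= Px ->]]].
  by rewrite -Px -(hdot_iter_wcomp phi om Tb c0 Tc) Pbn hdot0l.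
by rewrite -Px -(hdot_iter_linv phi om Tb c0 Tc) Pa hdot0l.
Qed.

(** Kept transparent: the underlying space must reduce to l^2(X) and the evaluation to [model_eval],
    so that the identity can serve as [U]. *)
Definition model_space : hfspace Om E.
Proof.
refine (@HFSpace R l2 Om E l2 ev _ _ _).
- by move=> f z Oz; rewrite EP /=; exact: eval_wproj.
- by move=> a f g z Oz; have [+ _] := eval_lb Oz; apply.
- move=> f g fg; apply/eqP; rewrite -subr_eq0; apply/eqP/eval_eq0 => z Oz.
  by rewrite (lbB _ _ (eval_lb Oz)) fg// subrr.
Defined.

End Model.

(** * The analytic model, its kernel and its dense subspaces *)

Theorem theorem4p3 (R : realType) (X : countType) (phi : X -> X)
    (w : X -> R[i]) (T : l2 R X -> l2 R X) (om : X) :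
  single_orbit phi ->
  finite_branching_index phi ->
  (~ has_cycle phi -> generalized_root phi om) ->
  is_wcomp phi w T ->
  bounded_op setT setT T ->
  left_invertible T ->
  let E := spaceE phi om T in
  let k := indexE phi om T in
  let rplus := outer_radius phi om w T in
  let rminus := inner_radius phi om w in
  let Om := annulus rminus rplus in
  dual_hull T E = setT ->
  (rminus < rplus)%E ->
  exists (H : hfspace Om E) (K : R[i] -> R[i] -> l2 R X -> l2 R X)
    (U : l2 R X -> H),
    [/\ holomorphic_space H, z_invariant H, reproducing_kernel H K,
        unitary_map U & forall f, mult_z (U f) = U (T f)] /\
    [/\
      (* (i) *)
      forall mu g, Om mu -> E g -> exists2 h : H,
        represents h (fun z => K z mu g) &
        forall f, hdot (U f) h = hdot (hfs_eval (U f) mu) g,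
      (* (ii) *)
      exists A B C D : nat -> nat -> l2 R X -> l2 R X,
        [/\ forall i j, [/\ bounded_op E E (A i j), bounded_op E E (B i j),
                            bounded_op E E (C i j) & bounded_op E E (D i j)],
            forall z l, Om z -> Om l -> exists SA SB SC SD : l2 R X -> l2 R X,
              [/\ op_sum E (fun p e => (z ^- p.1.+1 * l^* ^- p.2.+1)
                                         *: A p.1.+1 p.2.+1 e) SA,
                  op_sum E (fun p e => (z ^- p.1.+1 * l^* ^+ p.2)
                                         *: B p.1.+1 p.2 e) SB,
                  op_sum E (fun p e => (z ^+ p.1 * l^* ^- p.2.+1)
                                         *: C p.1 p.2.+1 e) SC,
                  op_sum E (fun p e => (z ^+ p.1 * l^* ^+ p.2)
                                         *: D p.1 p.2 e) SD &
                  forall e, E e -> K z l e = SA e + SB e + SC e + SD e] &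
            ~ has_cycle phi -> forall e, E e ->
              [/\ forall i j : nat, (1 <= i)%N -> (1 <= j)%N ->
                    `|i%:Z - j%:Z| > k%:Z -> A i j e = 0,
                  forall i j : nat, (1 <= i)%N -> (i + j > k)%N -> B i j e = 0,
                  forall i j : nat, (1 <= j)%N -> (i + j > k)%N -> C i j e = 0 &
                  forall i j : nat, `|i%:Z - j%:Z| > k%:Z -> D i j e = 0]],
      (* (iii), no cycle *)
      ~ has_cycle phi ->
        let Etilde := l2_on (Gen phi om 1 1) in
        [/\ forall n : nat, has_monomials H n%:Z E,
            forall n : nat, (1 <= n)%N -> has_monomials H (- n%:Z) Etilde &
            closed_span
              (\bigcup_n monomials H n%:Z E `|`
               \bigcup_(n in [set n | (1 <= n)%N])
                  monomials H (- n%:Z) Etilde) = setT] &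
      (* (iii), cycle *)
      has_cycle phi ->
        let tau := cycle_card phi in
        let Lambda := \big[*%R/1]_(x \in cycle_set phi) w x in
        exists (A : nat -> nat -> l2 R X) (f : nat -> H),
          [/\ forall i j, (1 <= i <= tau)%N -> (1 <= j <= tau)%N -> E (A j i),
              forall j z, (1 <= j <= tau)%N -> Om z ->
                series (fun k : nat => \sum_(1 <= i < tau.+1)
                  (Lambda ^+ k / z ^+ (k * tau + i)) *: A j i) @ \oo
                  --> hfs_eval (f j) z,
              forall n : nat, has_monomials H n%:Z E &
              closed_span
                (\bigcup_n monomials H n%:Z E `|`
                 [set f j | j in [set j | (1 <= j <= tau)%N]]) = setT]].
Proof.
move=> orb fbr omP TE Tbd Tl E k rplus rminus Om hull rmp.
have Tb := bounded_op_lb Tbd; have [c c0 Tc] := left_invertible_below Tl.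
pose H := model_space orb fbr omP TE Tb c0 Tc hull rmp.
pose P := wproj T (lower phi om).
pose ev := model_eval (pos_coef phi T om) (neg_coef phi T om).
pose ker := model_ker (pos_coef_adj phi T om) (neg_coef_adj phi T om).
have rm0 : (0 <= rminus)%E := inner_radius_ge0 phi w om.
have EP : E = [set f | P f = f] := spaceE_wproj orb omP TE Tb c0 Tc.
have PP f : P (P f) = P f := wproj_idem TE Tb c0 Tc (lower_phi orb) f.
have Pb : linear_bounded P := wproj_lb Tb c0 Tc _.
have a_lb := pos_coef_lb phi om Tb c0 Tc; have b_lb := neg_coef_lb phi om Tb c0 Tc.
have a'_lb := pos_coef_adj_lb phi om Tb c0 Tc; have b'_lb := neg_coef_adj_lb phi om Tb c0 Tc.
have aE := pos_coef_hdot phi om Tb c0 Tc; have bE := neg_coef_hdot phi om Tb c0 Tc.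
have a'_bnd := pos_coef_adj_bound orb fbr omP TE Tb c0 Tc.
have b_bnd := neg_coef_bound orb omP TE Tb c0 Tc.
have evT f z : Om z -> ev (T f) z = z *: ev f z.
  exact: (eval_wcomp orb fbr omP TE Tb c0 Tc).
have kerP f e l : Om l -> hdot (ev f l) e = hdot f (ker l e).
  exact: (model_reproducing rm0 aE bE a'_bnd b_bnd).
have evP f z : Om z -> P (ev f z) = ev f z.
  exact: (eval_wproj orb fbr omP TE Tb c0 Tc).
have ev_lb z : Om z -> linear_bounded (ev^~ z).
  exact: (model_eval_lb rm0 a_lb b_lb aE bE a'_bnd b_bnd).
have ker_lb z : Om z -> linear_bounded (ker z).
  exact: (model_ker_lb rm0 a'_lb b'_lb aE bE a'_bnd b_bnd).
have rep (n : nat) e : P e = e ->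
    represents (iter n T e : H) (fun z => z ^ n%:Z *: e).
  move=> Pe z Oz; rewrite -[LHS]/(ev (iter n T e) z).
  rewrite /ev (eval_iter orb fbr omP TE Tb c0 Tc)//.
  by rewrite (eval_const orb TE Tb c0 Tc).
have has_mono (n : nat) : has_monomials H n%:Z E.
  by move=> e; rewrite EP => Pe; exists (iter n T e); exact: rep.
have mono (n : nat) e : P e = e -> monomials H n%:Z E (iter n T e).
  by move=> Pe; exists e; [rewrite EP|exact: rep].
exists H, (fun z l e => ev (ker l e) z), (idfun : l2 R X -> H).
split; first split.
- move=> h z Oz; exact: (model_eval_derivable rm0 aE bE a'_bnd b_bnd).
- move=> h; exists (T h) => z Oz; exact: evT.
- split=> [z l Oz Ol|l e Ol Ee].
    apply: lb_bounded_op; first exact: (lb_comp (ev_lb z Oz) (ker_lb l Ol)).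
    by move=> x; rewrite EP /=; exact: evP.
  by exists (ker l e) => // f; exact: kerP.
- by split=> // h; exists h.
- move=> f; apply: xget_unique => [z Oz|g gT]; first exact: evT.
  apply: (@hfs_eval_inj _ _ _ _ H) => z Oz; rewrite gT//.
  by apply/esym; exact: evT.
split.
- move=> mu g Omu Eg; exists (ker mu g) => // f.
  by apply/esym; exact: kerP.
(* [z^-(i+1)] comes with [P T^(i+1)] and [z^i] with [P L^i], while the adjoint side contributes
   powers of [T*] and [T']; this fixes the four families. *)
- exists (fun i j e => P (iter i T (iter j (adj T) (P e)))),
    (fun i j e => P (iter i T (iter j (cdual T) (P e)))),
    (fun i j e => P (iter i (linv T) (iter j (adj T) (P e)))),
    (fun i j e => P (iter i (linv T) (iter j (cdual T) (P e)))).
  have opE i j (F G : l2 R X -> l2 R X) : linear_bounded F -> linear_bounded G ->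
      bounded_op E E (fun e => P (iter i F (iter j G (P e)))).
    move=> Fb Gb; apply: lb_bounded_op => [|x]; last by rewrite EP; exact: PP.
    exact: (lb_comp Pb (lb_comp (lb_iter i Fb) (lb_comp (lb_iter j Gb) Pb))).
  have adjb := adj_lb Tb; have cdb := cdual_lb Tb c0 Tc.
  have lib := linv_lb Tb c0 Tc.
  split.
  + by move=> i j; split; exact: opE.
  + move=> z l Oz Ol.
    have [SA [SB [SC [SD [h1 h2 h3 h4 h5]]]]] :=
      model_kernel_blocks rm0 a_lb b_lb aE bE a'_bnd b_bnd E Oz Ol.
    by exists SA, SB, SC, SD; split.
  + move=> nc e _.
    have Pl : level_supp phi om 1 k%:Z (P e) := level_supp_wproj orb omP TE Tb fbr c0 Tc e.
    have z0 m n f : level_supp phi om m n f -> n < 1 \/ k%:Z < m -> P f = 0.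
      exact: (wproj_lev0 orb omP TE Tb nc fbr c0 Tc).
    have upT i m n f : level_supp phi om m n f ->
        level_supp phi om (m + i%:Z) (n + i%:Z) (iter i T f).
      by move=> fl; exact: (level_supp_iter_wcomp orb nc TE fl).
    have upT' i m n f : level_supp phi om m n f ->
        level_supp phi om (m + i%:Z) (n + i%:Z) (iter i (cdual T) f).
      by move=> fl; exact: (level_supp_iter_wcomp orb nc (cdual_wcomp TE c0 Tc) fl).
    have dnA i m n f : level_supp phi om m n f ->
        level_supp phi om (m - i%:Z) (n - i%:Z) (iter i (adj T) f).
      by apply: level_supp_iter_down => {}m {}n {}f; exact: (level_supp_adj orb TE Tb nc).
    have dnL i m n f : level_supp phi om m n f ->
        level_supp phi om (m - i%:Z) (n - i%:Z) (iter i (linv T) f).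
      by apply: level_supp_iter_down => {}m {}n {}f;
        exact: (level_supp_linv orb TE Tb nc c0 Tc).
    (* The windows are 1 to k shifted by [i - j], [i + j], [- (i + j)] and [j - i] respectively; the
       assumption on the indices moves them off 1 to k. *)
    split=> i j.
    * by move=> _ _ ij; apply: (z0 _ _ _ (upT i _ _ _ (dnA j _ _ _ Pl))); lia.
    * by move=> _ ij; apply: (z0 _ _ _ (upT i _ _ _ (upT' j _ _ _ Pl))); lia.
    * by move=> _ ij; apply: (z0 _ _ _ (dnL i _ _ _ (dnA j _ _ _ Pl))); lia.
    * by move=> ij; apply: (z0 _ _ _ (dnL i _ _ _ (upT' j _ _ _ Pl))); lia.
- move=> nc Etilde.
  have evR n z : Om z -> ev (l2_basis R (iter n phi om)) z =
      (root_weight phi w om n * z ^- n) *: l2_basis R om.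
    exact: (eval_root orb fbr omP TE Tb c0 Tc n nc).
  have eR : Etilde (l2_basis R om).
    apply: closed_span_sub; exists om => //.
    by rewrite /Gen /= (level_root orb om nc).
  split=> // [n n1 e eE|].
    have W0 := root_weight_prod_neq0 orb omP TE nc c0 Tc n.
    (* The preimage of [z^-n e] is the basis vector at [phi^n om], normalized by its accumulated
       weight. *)
    exists ((e om / root_weight phi w om n) *: l2_basis R (iter n phi om)).
    move=> z Oz; rewrite -[LHS]/(ev _ z) (lbZ _ _ (ev_lb z Oz)) evR//.
    rewrite [in RHS](l2_on_level1 orb omP nc eE) !scalerA -exprnN; congr (_ *: _).
    by rewrite mulrA divfK// mulrC.
  apply: (@closed_span_full R X phi w T om orb TE Tb c c0 Tc) => [n e Pe|x Bx].
    by left; exists n => //; exact: (mono n e Pe).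
  apply: closed_span_sub; right.
  have [|n xn ln] := @level_le1 _ _ orb _ omP x nc.
    by apply: le_trans Bx _.
  have n1 : (1 <= n)%N.
    by have : level phi (phi om) x <= 0 := Bx; rewrite ln; lia.
  exists n => //; exists (root_weight phi w om n *: l2_basis R om).
    by rewrite /Etilde -[_ *: _]addr0; apply: closed_span_lin => //; exact: closed_span0.
  move=> z Oz; rewrite -[LHS]/(ev (l2_basis R x) z) xn evR// scalerA -exprnN.
  by rewrite mulrC.
move=> hc tau Lambda.
have [p [t [t0 tp us cs]]] := cycle_enum orb hc.
have tauE : tau = t by rewrite /tau (cycle_cardE us cs) size_mkseq.
have LaE : Lambda = \prod_(i < t) w (iter i phi p).
  rewrite /Lambda cs -fsbig_seq// big_map (_ : iota 0 t = index_iota 0 t) ?big_mkord//.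
  by rewrite /index_iota subn0.
(* The function [f_j] is the image of the basis vector at the [j]-th cycle point, and [A j i] is its
   coefficient of [z^-i] within the leading turn. *)
exists (fun j i => P (iter i T (l2_basis R (iter j phi p)))),
  (fun j => l2_basis R (iter j phi p) : H).
split=> //.
- by move=> i j _ _; rewrite EP; exact: PP.
- move=> j z _ Oz; rewrite tauE LaE.
  exact: (eval_cycle orb fbr omP TE Tb c0 Tc hc t0 tp cs).
apply: (@closed_span_full R X phi w T om orb TE Tb c c0 Tc) => [n e Pe|x Bx].
  by left; exists n => //; exact: (mono n e Pe).
apply: closed_span_sub; right; have [j jt ->] := cycleP orb hc cs Bx.
(* The functions are numbered 1 to tau while the cycle is enumerated from 0; index 0 is replaced by
   [t], as [phi^t p = p]. *)
have [j0|j0] := posnP j; last by exists j => //; rewrite /= tauE j0 ltnW.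
by exists t; [rewrite /= tauE t0 leqnn|rewrite j0 tp].
Qed.
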